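(* Let $\mathcal W$ be a Waldhausen category, $\mathcal T$ a triangulated category, and $\mathcal T_3$ a $3$-pretriangulated category. There are: (1) a determinant functor $\det\colon\mathcal W\to\Gamma\mathcal D_*(\mathcal W)$; (2) a derived determinant functor $\det\colon\mathcal W\to\Gamma\mathcal D^{\mathrm{der}}_*(\mathcal W)$; (3) a Breuning determinant functor $\det\colon\mathcal T\to\Gamma\mathcal D_*({}^b\mathcal T)$; (4) a special determinant functor $\det\colon\mathcal T\to\Gamma\mathcal D_*({}^d\mathcal T)$; (5) a virtual determinant functor $\det\colon\mathcal T\to\Gamma\mathcal D_*({}^v\mathcal T)$; (6) a determinant functor $\det\colon\mathcal T_3\to\Gamma\mathcal D_*({}^s\mathcal T_3)$; all of which are universal. In each case it is defined by $\det(X)=[X]$ on objects, $\det(X\to X')=([X'],[X\to X'])$ on equivalences, and $\det(\Delta)=([Y],[\Delta])$ on a triangle $\Delta$ with first, middle and last objects $X,Y,C$ (here ''equivalence'' and ''triangle'' have the meaning of the corresponding setting (1)–(6) described in the context). Moreover, if the targets are simply regarded as categorical groups, forgetting the symmetry, these determinant functors are also universal among non-commutative determinant functors.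
   Context: Categorical groups. A categorical group is a monoidal groupoid in which $x\otimes-$ is an equivalence for every object $x$; a Picard groupoid is a symmetric categorical group. ''ass'' and ''comm'' denote the associativity and symmetry isomorphisms, and a tensor functor $F$ has natural multiplication isomorphisms $F(x)\otimes F(y)\to F(x\otimes y)$ and a unit isomorphism. Waldhausen categories. A Waldhausen category $\mathcal W$ is a category with a chosen zero object $0$, cofibrations $\rightarrowtail$ and weak equivalences in the sense of Waldhausen. A cofiber sequence is $X\rightarrowtail Y\twoheadrightarrow C^f$ with $C^f=0\cup_XY$. $\mathrm{Ho}(\mathcal W)$ is obtained by formally inverting weak equivalences; $S_2\mathcal W$ is the Waldhausen category of cofiber sequences in $\mathcal W$ (with objectwise weak equivalences). A staircase diagram consists of composable cofibrations $X\xrightarrow{f}Y\xrightarrow{g}Z$ together with four compatible cofiber sequences $\Delta_f\colon X\rightarrowtail Y\twoheadrightarrow C^f$, $\Delta_g\colon Y\rightarrowtail Z\twoheadrightarrow C^g$, $\Delta_{gf}\colon X\rightarrowtail Z\twoheadrightarrow C^{gf}$, $\widetilde\Delta\colon C^f\rightarrowtail C^{gf}\twoheadrightarrow C^g$ forming a commutative diagram. Triangulated categories. Let $\mathcal T$ be triangulated with suspension $\Sigma$ and chosen zero object $0$. A triangle is a diagram $X\xrightarrow{f}Y\xrightarrow{i}C\xrightarrow{q}\Sigma X$ in which any two consecutive morphisms (also $q$ followed by $\Sigma f$) compose to $0$. Octahedral diagram: for composable $f\colon X\to Y$, $g\colon Y\to Z$, it consists of triangles $\Delta_f\colon X\xrightarrow{f}Y\xrightarrow{i^f}C^f\xrightarrow{q^f}\Sigma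 X$, $\Delta_g\colon Y\xrightarrow{g}Z\xrightarrow{i^g}C^g\xrightarrow{q^g}\Sigma Y$, $\Delta_{gf}\colon X\xrightarrow{gf}Z\xrightarrow{i^{gf}}C^{gf}\xrightarrow{q^{gf}}\Sigma X$, and $\widetilde\Delta\colon C^f\xrightarrow{\bar g}C^{gf}\xrightarrow{\bar f}C^g\xrightarrow{(\Sigma i^f)q^g}\Sigma C^f$, with $\bar g i^f=i^{gf}g$, $q^{gf}\bar g=q^f$, $\bar f i^{gf}=i^g$, $q^g\bar f=(\Sigma f)q^{gf}$. It is an octahedron if the four triangles are distinguished. An octahedron is special if in addition the triangles $Y\xrightarrow{(g,-i^f)}Z\oplus C^f\xrightarrow{(i^{gf},\bar g)}C^{gf}\xrightarrow{q^g\bar f}\Sigma Y$ and $C^{gf}\xrightarrow{(q^{gf},-\bar f)}\Sigma X\oplus C^g\xrightarrow{(\Sigma f,q^g)}\Sigma Y\xrightarrow{\Sigma(\bar g i^f)}\Sigma C^{gf}$ are distinguished. A contractible triangle is a direct sum of triangles of the forms $A\xrightarrow{1}A\to0\to\Sigma A$, $0\to B\xrightarrow{1}B\to0$, $C\to0\to\Sigma C\xrightarrow{1}\Sigma C$. A triangle is virtual if its direct sum with some contractible triangle is isomorphic to a triangle $(f',i',q')$ such that there are distinguished triangles $(f'',i',q')$, $(f',i'',q')$, $(f',i',q'')$ on the same objects, for suitable $f'',i'',q''$. A virtual octahedron is an octahedral diagram whose four triangles are virtual. A $3$-pretriangulated category $\mathcal T_3$ (Maltsiniotis) is a triangulated category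 with a family of distinguished octahedra satisfying axioms generalizing those for distinguished triangles (closed under isomorphisms and finite direct sums, containing degenerate octahedra, every composable pair completes to a distinguished octahedron, morphisms between bases extend). Settings. In each setting there are equivalences of objects, triangles $\Delta$ with first, middle, last objects $X,Y,C$, equivalences of triangles, and staircases, each having four triangles $\Delta_f,\Delta_g,\Delta_{gf},\widetilde\Delta$: (1) weak equivalences of $\mathcal W$; cofiber sequences; weak equivalences of cofiber sequences; staircase diagrams. (2) isomorphisms in $\mathrm{Ho}(\mathcal W)$; cofiber sequences in $\mathcal W$; isomorphisms in $\mathrm{Ho}(S_2\mathcal W)$; staircase diagrams in $\mathcal W$. (3) isomorphisms; distinguished triangles; isomorphisms of distinguished triangles $(a,b,c)$ (with fourth component $\Sigma a$); octahedra. (4) as (3), with special octahedra only. (5) isomorphisms; virtual triangles; isomorphisms of virtual triangles; virtual octahedra. (6) as (3), with distinguished octahedra only. Determinant functors. A determinant functor to a Picard groupoid $\mathcal P$ is a functor $\det$ from the category of objects and equivalences to $\mathcal P$ together with, for each triangle $\Delta$, a morphism $\det(\Delta)\colon\det(C)\otimes\det(X)\to\det(Y)$ natural for equivalences of triangles, such that (associativity) for each staircase, $\det(\Delta_g)\circ(1\otimes\det(\Delta_f))=\det(\Delta_{gf})\circ(\det(\widetilde\Delta)\otimes1)\circ\mathrm{ass}$ as maps $\det(C^g)\otimes(\det(C^f)\otimes\det(X))\to\det(Z)$; and (commutativity) for objects $X,Y$, if $\Delta_1\colon X\to X\sqcup Y\to Y$ and $\Delta_2\colon Y\to X\sqcup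 Y\to X$ are the triangles given by inclusions and projections (with last map $0$ in the triangulated case), then $\det(\Delta_1)=\det(\Delta_2)\circ\mathrm{comm}$. In settings (2)–(5) these are called derived, Breuning, special, virtual determinant functors. A non-commutative determinant functor takes values in a categorical group and satisfies all except commutativity. Universality. $\det$ with target $V$ is universal if for every determinant functor $\det'$ with target $\mathcal P$ there are a symmetric tensor functor $f\colon V\to\mathcal P$ and a natural transformation $\alpha\colon f\circ\det\Rightarrow\det'$ compatible with additivity data ($\alpha(Y)\circ f(\det(\Delta))\circ\mathrm{mult}=\det'(\Delta)\circ(\alpha(C)\otimes\alpha(X))$), and for any other such $(f',\alpha')$ there is a unique tensor natural transformation $\beta\colon f\Rightarrow f'$ with $\alpha=\alpha'\circ(\beta\,\det)$. In the non-commutative case one drops symmetry of $f,f'$ and uses non-commutative determinant functors. Stable quadratic modules. Groups are additive, $[x,y]=-x-y+x+y$. A stable quadratic module $C_*$ consists of homomorphisms $C_0^{ab}\otimes C_0^{ab}\xrightarrow{\langle\cdot,\cdot\rangle}C_1\xrightarrow{\partial}C_0$ with $\langle c_0,c_0'\rangle+\langle c_0',c_0\rangle=0$, $\partial\langle c_0,c_0'\rangle=[c_0',c_0]$, $\langle\partial c_1,\partial c_1'\rangle=[c_1',c_1]$; $C_0$ acts on $C_1$ by $c_1^{c_0}=c_1+\langle c_0,\partial c_1\rangle$. A presentation by generators in degrees $0,1$ and relations has the evident universal property (morphisms are pairs of homomorphisms compatible with $\partial$ and $\langle\cdot,\cdot\rangle$). $\Gamma C_*$ is the Picard groupoid with object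 set $C_0$, morphisms $(c_0,c_1)\colon c_0+\partial c_1\to c_0$ for $c_i\in C_i$, composition $(c_0,c_1)\circ(c_0+\partial c_1,c_1')=(c_0,c_1+c_1')$, strict tensor product $+$ on objects and $(c_0,c_1)+(c_0',c_1')=(c_0+c_0',c_1^{c_0'}+c_1')$ on morphisms, unit $0$, symmetry $(c_0'+c_0,\langle c_0',c_0\rangle)\colon c_0+c_0'\to c_0'+c_0$. The modules. In setting (1), $\mathcal D_*(\mathcal W)$ (resp. $\mathcal D^{\mathrm{der}}_*(\mathcal W)$, $\mathcal D_*({}^b\mathcal T)$, $\mathcal D_*({}^d\mathcal T)$, $\mathcal D_*({}^v\mathcal T)$, $\mathcal D_*({}^s\mathcal T_3)$ in settings (2),(3),(4),(5),(6)) is presented by generators $[X]$ in degree $0$ for each object, $[X\to X']$ in degree $1$ for each equivalence, $[\Delta]$ in degree $1$ for each triangle, and relations: $\partial[X\to X']=-[X']+[X]$; $\partial[\Delta]=-[Y]+[C]+[X]$; $[0]=0$; $[1_X]=0$; $[X\xrightarrow{1}X\to0]=0=[0\to X\xrightarrow{1}X]$ (completed to triangles); $[X\to Z]=[Y\to Z]+[X\to Y]$ for composable equivalences; $[X\to X']+[C\to C']^{[X]}=-[\Delta']+[Y\to Y']+[\Delta]$ for each equivalence of triangles $\Delta\to\Delta'$; $[\Delta_g]+[\Delta_f]=[\Delta_{gf}]+[\widetilde\Delta]^{[X]}$ for each staircase; $\langle[X],[Y]\rangle=-[\Delta_2]+[\Delta_1]$ for any objects $X,Y$. *)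

(* Defs.v *)
From HB Require Import structures.
From mathcomp Require Import all_boot all_algebra boolp.

Set Implicit Arguments.
Unset Strict Implicit.
Unset Printing Implicit Defensive.

Import GRing.Theory.
Local Open Scope quotient_scope.

Declare Scope cat_scope.
Delimit Scope cat_scope with cat.
Local Open Scope cat_scope.

Reserved Notation "g ∘ f" (at level 40, left associativity).
Reserved Notation "x ⊗ y" (at level 35, right associativity).
Reserved Notation "f ⊠ g" (at level 35, right associativity).

(** * Categories *)

Record category := Category {
  ob :> Type;
  hom : ob -> ob -> Type;
  idm : forall X, hom X X;
  comp : forall X Y Z, hom Y Z -> hom X Y -> hom X Z;
  comp1m : forall X Y (f : hom X Y), comp (idm Y) f = f;
  compm1 : forall X Y (f : hom X Y), comp f (idm X) = f;
  compA : forall X Y Z W (h : hom Z W) (g : hom Y Z) (f : hom X Y),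
    comp h (comp g f) = comp (comp h g) f }.

Arguments idm {c} X.
Arguments comp {c X Y Z} g f.
Notation "g ∘ f" := (comp g f) : cat_scope.

Definition is_iso (C : category) (X Y : C) (f : hom X Y) : Prop :=
  exists g : hom Y X, g ∘ f = idm X /\ f ∘ g = idm Y.

Lemma is_iso_id (C : category) (X : C) : is_iso (idm X).
Proof. by exists (idm X); rewrite comp1m. Qed.

Lemma is_iso_comp (C : category) (X Y Z : C) (g : hom Y Z) (f : hom X Y) :
  is_iso g -> is_iso f -> is_iso (g ∘ f).
Proof.
move=> [g' [g'g gg']] [f' [f'f ff']]; exists (f' ∘ g'); split.
  by rewrite compA -(compA f') g'g compm1 f'f.
by rewrite compA -(compA g) ff' compm1 gg'.
Qed.

Record functor (C D : category) := Functor {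
  fob :> C -> D;
  fmap : forall X Y, hom X Y -> hom (fob X) (fob Y);
  fmap_id : forall X, fmap (idm X) = idm (fob X);
  fmap_comp : forall X Y Z (g : hom Y Z) (f : hom X Y),
    fmap (g ∘ f) = fmap g ∘ fmap f }.

Arguments fmap {C D} _ {X Y} _.

Definition natural (C D : category) (F G : functor C D)
    (a : forall X, hom (F X) (G X)) : Prop :=
  forall X Y (f : hom X Y), a Y ∘ fmap F f = fmap G f ∘ a X.

Definition nat_isomorphic (C D : category) (F G : functor C D) : Prop :=
  exists a : forall X, hom (F X) (G X), natural a /\ forall X, is_iso (a X).

Definition id_functor (C : category) : functor C C :=
  @Functor C C id (fun _ _ f => f) (fun _ => erefl) (fun _ _ _ _ _ => erefl).

Definition comp_functor (C D E : category) (G : functor D E) (F : functor C D) :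
  functor C E.
Proof.
refine (@Functor C E (fun X => G (F X)) (fun _ _ f => fmap G (fmap F f)) _ _).
- by move=> X; rewrite !fmap_id.
- by move=> X Y Z g f; rewrite !fmap_comp.
Defined.

Definition is_equivalence (C D : category) (F : functor C D) : Prop :=
  exists G : functor D C,
    nat_isomorphic (comp_functor G F) (id_functor C) /\
    nat_isomorphic (comp_functor F G) (id_functor D).

Lemma sig_prop_inj (T : Type) (P : T -> Prop) (u v : {x | P x}) :
  sval u = sval v -> u = v.
Proof. by case: u v => [x Px] [y Py] /= e; apply: eq_exist. Qed.

(* The subcategory with all objects and those morphisms which satisfy P. *)
Section Wide.
Variables (C : category) (P : forall X Y : C, hom X Y -> Prop).
Hypothesis P1 : forall X : C, P (idm X).
Hypothesis PM : forall (X Y Z : C) (g : hom Y Z) (f : hom X Y),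
  P g -> P f -> P (g ∘ f).

Definition wide : category.
Proof.
refine (@Category C (fun X Y => {f : hom X Y | P f}) (fun X => exist _ _ (P1 X))
  (fun X Y Z g f => exist _ (sval g ∘ sval f) (PM (proj2_sig g) (proj2_sig f)))
  _ _ _).
- by move=> X Y f; apply: sig_prop_inj; exact: comp1m.
- by move=> X Y f; apply: sig_prop_inj; exact: compm1.
- by move=> X Y Z W h g f; apply: sig_prop_inj; exact: compA.
Defined.
End Wide.

Definition core (C : category) : category :=
  wide (@is_iso_id C) (@is_iso_comp C).

(** * Quotients *)

Record setoid := Setoid {
  scar :> Type;
  srel : scar -> scar -> Prop;
  srel_refl : forall x, srel x x;
  srel_sym : forall x y, srel x y -> srel y x;
  srel_trans : forall x y z, srel x y -> srel y z -> srel x z }.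

Section Quotient.
Variable S : setoid.
Definition srelb : rel {classic S} := fun x y => `[< srel x y >].
Lemma srelb_refl : reflexive srelb.
Proof. by move=> x; apply/asboolP; exact: srel_refl. Qed.
Lemma srelb_sym : symmetric srelb.
Proof. by move=> x y; apply/asboolP/asboolP; exact: srel_sym. Qed.
Lemma srelb_trans : transitive srelb.
Proof.
by move=> y x z /asboolP xy /asboolP yz; apply/asboolP; exact: srel_trans yz.
Qed.
Canonical srelb_equiv := EquivRel srelb srelb_refl srelb_sym srelb_trans.
Definition quot : choiceType := {eq_quot srelb}.
Definition cls (x : S) : quot := \pi_({eq_quot srelb}) (x : {classic S}).
Definition rep (q : quot) : S := repr (q : {eq_quot srelb}).
Lemma clsP x y : cls x = cls y <-> srel x y.
Proof. by split=> [/eqquotP/asboolP //|xy]; apply/eqquotP/asboolP. Qed.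
Lemma repK q : cls (rep q) = q.
Proof. exact: reprK. Qed.
Lemma rep_cls x : srel (rep (cls x)) x.
Proof. by apply/clsP; rewrite repK. Qed.
End Quotient.

(** * Localization of a category *)

(* The morphisms of the localization are formal composites of morphisms of C
   and formal inverses of morphisms satisfying w, up to the congruence
   generated by the category axioms, functoriality of C -> Ho(C), and
   invertibility of the formal inverses. *)
Section Localization.
Variables (C : category) (w : forall X Y : C, hom X Y -> Prop).

Inductive lword : C -> C -> Type :=
| lin X Y (f : hom X Y) : lword X Y
| linv X Y (f : hom X Y) (wf : w f) : lword Y X
| lcomp X Y Z (g : lword Y Z) (f : lword X Y) : lword X Z.

Inductive lrel : forall X Y, lword X Y -> lword X Y -> Prop :=
| lrel_refl X Y (f : lword X Y) : lrel f f
| lrel_sym X Y (f g : lword X Y) : lrel f g -> lrel g f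
| lrel_trans X Y (f g h : lword X Y) : lrel f g -> lrel g h -> lrel f h
| lrel_comp X Y Z (g g' : lword Y Z) (f f' : lword X Y) :
    lrel g g' -> lrel f f' -> lrel (lcomp g f) (lcomp g' f')
| lrel_1m X Y (f : lword X Y) : lrel (lcomp (lin (idm Y)) f) f
| lrel_m1 X Y (f : lword X Y) : lrel (lcomp f (lin (idm X))) f
| lrel_A X Y Z W (h : lword Z W) (g : lword Y Z) (f : lword X Y) :
    lrel (lcomp h (lcomp g f)) (lcomp (lcomp h g) f)
| lrel_in X Y Z (g : hom Y Z) (f : hom X Y) :
    lrel (lin (g ∘ f)) (lcomp (lin g) (lin f))
| lrel_invl X Y (f : hom X Y) (wf : w f) :
    lrel (lcomp (linv wf) (lin f)) (lin (idm X))
| lrel_invr X Y (f : hom X Y) (wf : w f) :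
    lrel (lcomp (lin f) (linv wf)) (lin (idm Y)).

Definition lsetoid (X Y : C) : setoid :=
  Setoid (@lrel_refl X Y) (@lrel_sym X Y) (@lrel_trans X Y).

Definition Ho_hom (X Y : C) : Type := quot (lsetoid X Y).
Definition Ho_comp X Y Z (g : Ho_hom Y Z) (f : Ho_hom X Y) : Ho_hom X Z :=
  cls (lcomp (rep g) (rep f) : lsetoid X Z).

Lemma Ho_compE X Y Z (g : lsetoid Y Z) (f : lsetoid X Y) :
  Ho_comp (cls g) (cls f) = cls (lcomp g f : lsetoid X Z).
Proof. by apply/clsP; apply: lrel_comp; exact: (@rep_cls (lsetoid _ _)). Qed.

Definition Ho : category.
Proof.
refine (@Category C Ho_hom (fun X => cls (lin (idm X) : lsetoid X X)) Ho_comp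
  _ _ _).
- move=> X Y f; rewrite -(@repK (lsetoid X Y) f) Ho_compE; apply/clsP.
  exact: lrel_1m.
- move=> X Y f; rewrite -(@repK (lsetoid X Y) f) Ho_compE; apply/clsP.
  exact: lrel_m1.
- move=> X Y Z W h g f.
  rewrite -(@repK (lsetoid X Y) f) -(@repK (lsetoid Y Z) g).
  rewrite -(@repK (lsetoid Z W) h) !Ho_compE.
  by apply/clsP; exact: lrel_A.
Defined.

Definition Ho_in (X Y : C) (f : hom X Y) : @hom Ho X Y := cls (lin f : lsetoid X Y).
End Localization.

(* The functor Ho(C) -> Ho(D) induced by a functor C -> D which maps
   w-morphisms to v-morphisms. *)
Section LocalizationMap.
Variables (C D : category).
Variables (w : forall X Y : C, hom X Y -> Prop).
Variables (v : forall X Y : D, hom X Y -> Prop).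
Variable F : functor C D.
Hypothesis Fw : forall X Y (f : hom X Y), w f -> v (fmap F f).

Fixpoint lword_map X Y (f : lword w X Y) : lword v (F X) (F Y) :=
  match f with
  | lin _ _ f => lin v (fmap F f)
  | linv _ _ f wf => linv (Fw wf)
  | lcomp _ _ _ g f => lcomp (lword_map g) (lword_map f)
  end.

Lemma lword_map_rel X Y (f g : lword w X Y) :
  lrel f g -> lrel (lword_map f) (lword_map g).
Proof.
elim=> {X Y f g} /=.
- by move=> *; exact: lrel_refl.
- by move=> *; exact: lrel_sym.
- by move=> X Y f g h _ fg _ gh; exact: lrel_trans gh.
- by move=> *; exact: lrel_comp.
- by move=> X Y f; rewrite fmap_id; exact: lrel_1m.
- by move=> X Y f; rewrite fmap_id; exact: lrel_m1.
- by move=> *; exact: lrel_A.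
- by move=> X Y Z g f; rewrite fmap_comp; exact: lrel_in.
- by move=> X Y f wf; rewrite fmap_id; exact: lrel_invl.
- by move=> X Y f wf; rewrite fmap_id; exact: lrel_invr.
Qed.

Definition Ho_fmap X Y (f : @hom (Ho w) X Y) : @hom (Ho v) (F X) (F Y) :=
  cls (lword_map (rep f) : lsetoid v (F X) (F Y)).

Lemma Ho_fmapE X Y (f : lsetoid w X Y) :
  Ho_fmap (cls f) = cls (lword_map f : lsetoid v (F X) (F Y)).
Proof. by apply/clsP; apply: lword_map_rel; exact: (@rep_cls (lsetoid w X Y)). Qed.

Definition Ho_functor : functor (Ho w) (Ho v).
Proof.
refine (@Functor (Ho w) (Ho v) F Ho_fmap _ _).
- by move=> X; rewrite Ho_fmapE /= fmap_id.
- by move=> X Y Z g f; rewrite -(@repK (lsetoid w Y Z) g) -(@repK (lsetoid w X Y) f) /= Ho_compE !Ho_fmapE Ho_compE.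
Defined.
End LocalizationMap.

(** * Monoidal categories, categorical groups, Picard groupoids *)

Record monoidal := Monoidal {
  mcat :> category;
  tens : mcat -> mcat -> mcat;
  tensm : forall X Y X' Y' : mcat,
    hom X X' -> hom Y Y' -> hom (tens X Y) (tens X' Y');
  munit : mcat;
  tensm_id : forall X Y, tensm (idm X) (idm Y) = idm (tens X Y);
  tensm_comp : forall (X Y X' Y' X'' Y'' : mcat) (f' : hom X' X'')
    (g' : hom Y' Y'') (f : hom X X') (g : hom Y Y'),
    tensm (f' ∘ f) (g' ∘ g) = tensm f' g' ∘ tensm f g;
  ass : forall X Y Z, hom (tens X (tens Y Z)) (tens (tens X Y) Z);
  lun : forall X, hom (tens munit X) X;
  run : forall X, hom (tens X munit) X;
  ass_iso : forall X Y Z, is_iso (ass X Y Z);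
  lun_iso : forall X, is_iso (lun X);
  run_iso : forall X, is_iso (run X);
  ass_nat : forall (X Y Z X' Y' Z' : mcat) (f : hom X X') (g : hom Y Y')
    (h : hom Z Z'),
    ass X' Y' Z' ∘ tensm f (tensm g h) = tensm (tensm f g) h ∘ ass X Y Z;
  lun_nat : forall (X Y : mcat) (f : hom X Y),
    lun Y ∘ tensm (idm munit) f = f ∘ lun X;
  run_nat : forall (X Y : mcat) (f : hom X Y),
    run Y ∘ tensm f (idm munit) = f ∘ run X;
  pentagon : forall X Y Z W,
    ass (tens X Y) Z W ∘ ass X Y (tens Z W) =
    tensm (ass X Y Z) (idm W) ∘ ass X (tens Y Z) W ∘ tensm (idm X) (ass Y Z W);
  triangle_id : forall X Y,
    tensm (run X) (idm Y) ∘ ass X munit Y = tensm (idm X) (lun Y) }.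

Notation "x ⊗ y" := (tens x y) : cat_scope.
Notation "f ⊠ g" := (tensm f g) : cat_scope.

Definition tens_left (M : monoidal) (X : M) : functor M M.
Proof.
refine (@Functor M M (fun Y => X ⊗ Y) (fun _ _ f => idm X ⊠ f) _ _).
- by move=> Y; exact: tensm_id.
- by move=> Y Y' Y'' g f; rewrite -tensm_comp comp1m.
Defined.

Record catGroup := CatGroup {
  gmon :> monoidal;
  gmon_groupoid : forall (X Y : gmon) (f : hom X Y), is_iso f;
  gmon_tens_equiv : forall X : gmon, is_equivalence (tens_left X) }.

Record picard := Picard {
  pgrp :> catGroup;
  comm : forall X Y : pgrp, hom (X ⊗ Y) (Y ⊗ X);
  comm_nat : forall (X Y X' Y' : pgrp) (f : hom X X') (g : hom Y Y'),
    comm X' Y' ∘ f ⊠ g = g ⊠ f ∘ comm X Y;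
  comm_sym : forall X Y, comm Y X ∘ comm X Y = idm (X ⊗ Y);
  hexagon : forall X Y Z,
    ass Z X Y ∘ comm (X ⊗ Y) Z ∘ ass X Y Z =
    comm X Z ⊠ idm Y ∘ ass X Z Y ∘ idm X ⊠ comm Y Z }.

Record tensorFunctor (M N : monoidal) := TensorFunctor {
  tfun :> functor M N;
  tmul : forall X Y, hom (tfun X ⊗ tfun Y) (tfun (X ⊗ Y));
  tone : hom (munit N) (tfun (munit M));
  tmul_iso : forall X Y, is_iso (tmul X Y);
  tone_iso : is_iso tone;
  tmul_nat : forall (X Y X' Y' : M) (f : hom X X') (g : hom Y Y'),
    tmul X' Y' ∘ fmap tfun f ⊠ fmap tfun g = fmap tfun (f ⊠ g) ∘ tmul X Y;
  tmul_ass : forall X Y Z,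
    fmap tfun (ass X Y Z) ∘ tmul X (Y ⊗ Z) ∘ idm (tfun X) ⊠ tmul Y Z =
    tmul (X ⊗ Y) Z ∘ tmul X Y ⊠ idm (tfun Z) ∘ ass (tfun X) (tfun Y) (tfun Z);
  tone_lun : forall X,
    fmap tfun (lun X) ∘ tmul (munit M) X ∘ tone ⊠ idm (tfun X) = lun (tfun X);
  tone_run : forall X,
    fmap tfun (run X) ∘ tmul X (munit M) ∘ idm (tfun X) ⊠ tone = run (tfun X) }.

Definition is_symmetric (V P : picard) (f : tensorFunctor V P) : Prop :=
  forall X Y : V, fmap f (comm X Y) ∘ tmul f X Y = tmul f Y X ∘ comm (f X) (f Y).

Definition is_tensor_nat (M N : monoidal) (f f' : tensorFunctor M N)
    (b : forall X, hom (f X) (f' X)) : Prop :=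
  [/\ natural b,
      forall X Y, b (X ⊗ Y) ∘ tmul f X Y = tmul f' X Y ∘ b X ⊠ b Y
    & b (munit M) ∘ tone f = tone f'].

(** * Stable quadratic modules *)

(* Groups are written multiplicatively, following mathcomp's groupType, so that
   c + c' reads c * c', 0 reads 1, - c reads c^-1, and [x, y] = -x-y+x+y is the
   library's [~ x, y].  A map which is bimultiplicative is the same as a
   homomorphism out of the tensor product of the abelianizations: expanding
   br (x * x') (y * y') in two ways shows that its values commute, and hence
   that it is trivial on commutators. *)
Local Open Scope group_scope.

Record sqm := SQM {
  C0 : groupType;
  C1 : groupType;
  bd : C1 -> C0;
  br : C0 -> C0 -> C1;
  bdM : {morph bd : x y / x * y};
  brMl : forall x x' y, br (x * x') y = br x y * br x' y;
  brMr : forall x y y', br x (y * y') = br x y * br x y';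
  br_sym : forall x y, br x y * br y x = 1;
  bd_br : forall x y, bd (br x y) = [~ y, x];
  br_bd : forall a b, br (bd a) (bd b) = [~ b, a] }.

Arguments bd {s} _.
Arguments br {s} _ _.

Section SQMTheory.
Variable M : sqm.
Implicit Types (x y : C0 M) (a b : C1 M).

(* The right action of C0 on C1, written c_1^{c_0}. *)
Definition act a x : C1 M := a * br x (bd a).

Lemma bd1 : bd (1 : C1 M) = 1.
Proof. by apply: (mulgI (bd 1)); rewrite -bdM !mulg1. Qed.
Lemma bdV a : bd a^-1 = (bd a)^-1.
Proof. by apply: (mulgI (bd a)); rewrite -bdM !mulgV bd1. Qed.
Lemma br1l x : br (1 : C0 M) x = 1.
Proof. by apply: (mulgI (br 1 x)); rewrite -brMl !mulg1. Qed.
Lemma br1r x : br x (1 : C0 M) = 1.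
Proof. by apply: (mulgI (br x 1)); rewrite -brMr !mulg1. Qed.
Lemma brVl x y : br x^-1 y = (br x y)^-1.
Proof. by apply: (mulgI (br x y)); rewrite -brMl !mulgV br1l. Qed.
Lemma brVr x y : br x y^-1 = (br x y)^-1.
Proof. by apply: (mulgI (br x y)); rewrite -brMr !mulgV br1r. Qed.
Lemma brC x y : br y x = (br x y)^-1.
Proof. by apply: (mulgI (br x y)); rewrite mulgV br_sym. Qed.
Lemma br_commg x y z : br z [~ x, y] = 1.
Proof.
have c u v : commute (br z u) (br z v).
  have e : br (z * z) (u * v) = br z u * br z v * (br z u * br z v).
    by rewrite brMl !brMr.
  have : br (z * z) (u * v) = br z u * br z u * (br z v * br z v).
    by rewrite brMr !brMl.
  rewrite e -!mulgA => /mulgI; rewrite !mulgA => /mulIg; exact: esym.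
rewrite /commg /conjg !brMr !brVr.
by rewrite (c x y) mulKg mulVg.
Qed.
Lemma br_central x y a : commute (br x y) a.
Proof.
by apply/commgP/eqP; rewrite -br_bd bd_br br_commg.
Qed.

Lemma bd_act a x : bd (act a x) = bd a ^ x.
Proof. by rewrite /act bdM bd_br /commg mulVKg. Qed.
Lemma act1 a : act a 1 = a.
Proof. by rewrite /act br1l mulg1. Qed.
Lemma act_1 x : act 1 x = 1.
Proof. by rewrite /act bd1 br1r mulg1. Qed.
Lemma actM a b x : act (a * b) x = act a x * act b x.
Proof.
rewrite /act bdM brMr -!mulgA; congr (a * _).
by rewrite !mulgA; congr (_ * _); rewrite -br_central.
Qed.
Lemma actMx a x y : act a (x * y) = act (act a x) y.
Proof. by rewrite /act bdM bd_br brMr br_commg mulg1 brMl mulgA. Qed.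
Lemma act_bd a b : act a (bd b) = a ^ b.
Proof. by rewrite /act br_bd /commg mulVKg. Qed.
End SQMTheory.

(** ** The Picard groupoid of a stable quadratic module *)

(* A morphism (y, c) : y + bd c -> y is an element c of C1 such that the source
   x is y + bd c. *)
Section Gamma.
Variable M : sqm.

Definition Gamma_hom (x y : C0 M) : Type := {c : C1 M | x == y * bd c}.

Lemma Gamma_hom_inj x y (f g : Gamma_hom x y) : sval f = sval g -> f = g.
Proof. exact: val_inj. Qed.

Lemma Gamma_comp_subproof x y z (g : Gamma_hom y z) (f : Gamma_hom x y) :
  x == z * bd (sval g * sval f).
Proof.
by case: g f => [c /= /eqP ->] [c' /= /eqP ->]; rewrite bdM mulgA.
Qed.

Lemma Gamma_eq_subproof (x y : C0 M) : x = y -> x == y * bd (1 : C1 M).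
Proof. by move=> ->; rewrite bd1 mulg1. Qed.

Definition Gamma_eq (x y : C0 M) (e : x = y) : Gamma_hom x y :=
  exist _ 1 (Gamma_eq_subproof e).

Definition Gamma_cat : category.
Proof.
refine (@Category (C0 M) Gamma_hom (fun x => Gamma_eq (erefl x))
  (fun x y z g f => exist _ (sval g * sval f) (Gamma_comp_subproof g f)) _ _ _).
- by move=> x y f; apply: Gamma_hom_inj; exact: mul1g.
- by move=> x y f; apply: Gamma_hom_inj; exact: mulg1.
- by move=> x y z t h g f; apply: Gamma_hom_inj; exact: mulgA.
Defined.

Lemma Gamma_tens_subproof (x x' y y' : C0 M) (f : Gamma_hom x x')
  (g : Gamma_hom y y') : x * y == x' * y' * bd (act (sval f) y' * sval g).
Proof.
case: f g => [c /= /eqP ->] [c' /= /eqP ->]; apply/eqP.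
by rewrite bdM bd_act /conjg -!mulgA mulVKg.
Qed.

Definition Gamma_tensm (x y x' y' : C0 M) (f : Gamma_hom x x')
    (g : Gamma_hom y y') : Gamma_hom (x * y) (x' * y') :=
  exist _ (act (sval f) y' * sval g) (Gamma_tens_subproof f g).

Lemma Gamma_iso (x y : C0 M) (f : @hom Gamma_cat x y) : is_iso f.
Proof.
have gP : y == x * bd (sval f)^-1.
  by case: f => [c /= /eqP ->]; rewrite bdV mulgK.
exists (exist _ (sval f)^-1 gP : @hom Gamma_cat y x).
by split; apply: Gamma_hom_inj; [exact: mulVg | exact: mulgV].
Qed.

Definition Gamma_monoidal : monoidal.
Proof.
refine (@Monoidal Gamma_cat (fun x y : C0 M => x * y) Gamma_tensm (1 : C0 M)
  _ _ (fun x y z => Gamma_eq (mulgA x y z)) (fun x => Gamma_eq (mul1g x))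
  (fun x => Gamma_eq (mulg1 x)) _ _ _ _ _ _ _ _).
- by move=> x y; apply: Gamma_hom_inj; rewrite /= act_1 mulg1.
- move=> x y x' y' x'' y'' f' g' f g; apply: Gamma_hom_inj => /=.
  case: g g' => [d /= _] [d' /= /eqP ->].
  rewrite actM actMx act_bd /conjg -!mulgA; congr (_ * _).
  by rewrite mulVKg.
- by move=> *; exact: Gamma_iso.
- by move=> *; exact: Gamma_iso.
- by move=> *; exact: Gamma_iso.
- move=> x y z x' y' z' f g h; apply: Gamma_hom_inj => /=.
  by rewrite mul1g mulg1 actM actMx mulgA.
- by move=> x y f; apply: Gamma_hom_inj; rewrite /= act_1 !mul1g mulg1.
- by move=> x y f; apply: Gamma_hom_inj; rewrite /= act1 !mul1g !mulg1.
- by move=> *; apply: Gamma_hom_inj; rewrite /= ?act_1 ?act1 ?mul1g ?mulg1.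
- by move=> *; apply: Gamma_hom_inj; rewrite /= ?act_1 ?act1 ?mul1g ?mulg1.
Defined.

Lemma Gamma_tens_equiv (x : Gamma_monoidal) : is_equivalence (tens_left x).
Proof.
exists (@tens_left Gamma_monoidal ((x : C0 M)^-1)); split.
  exists (fun y : C0 M => Gamma_eq (mulKg x y)); split=> [y z f|y].
    by apply: Gamma_hom_inj; rewrite /= !act_1 !mul1g mulg1.
  exact: Gamma_iso.
exists (fun y : C0 M => Gamma_eq (mulVKg x y)); split=> [y z f|y].
  by apply: Gamma_hom_inj; rewrite /= !act_1 !mul1g mulg1.
exact: Gamma_iso.
Qed.

Definition Gamma_catGroup : catGroup :=
  @CatGroup Gamma_monoidal Gamma_iso Gamma_tens_equiv.

Lemma Gamma_comm_subproof (x y : C0 M) : x * y == y * x * bd (br y x).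
Proof. by apply/eqP; rewrite bd_br -commgC. Qed.

Definition Gamma : picard.
Proof.
refine (@Picard Gamma_catGroup
  (fun x y : C0 M => exist _ (br y x) (Gamma_comm_subproof x y)) _ _ _).
- move=> x y x' y' f g; apply: Gamma_hom_inj => /=.
  case: f g => [c /= /eqP ->] [d /= /eqP ->].
  rewrite /act brMl !brMr br_bd (brC (bd d) x').
  set u := br y' x'; set p := br y' (bd c); set q := br (bd d) x'.
  rewrite -(br_central y' (bd c) c) -/p.
  have -> : d * q^-1 * c * (u * p * (q * [~ c, d])) = u * p * (d * c * [~ c, d]).
    have cup : commute (d * q^-1 * c) (u * p).
      by apply: commuteM; apply: commute_sym; exact: br_central.
    rewrite (mulgA (d * q^-1 * c) (u * p)) cup -!mulgA; congr (u * (p * (d * _))).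
    by rewrite (mulgA c q) -(br_central (bd d) x' c) -/q !mulgA mulVg mul1g.
  by rewrite -commgC !mulgA.
- move=> x y; apply: Gamma_hom_inj => /=; exact: br_sym.
- move=> x y z; apply: Gamma_hom_inj.
  by rewrite /= !act_1 !mul1g !mulg1 /act bd_br br_commg mulg1 brMr.
Defined.
End Gamma.

(** ** Presentations of stable quadratic modules *)

Inductive word0 (G0 : Type) : Type :=
| W0gen (g : G0) | W0one | W0mul (a b : word0 G0) | W0inv (a : word0 G0).

Inductive word1 (G0 G1 : Type) : Type :=
| W1gen (e : G1) | W1one | W1mul (s t : word1 G0 G1) | W1inv (s : word1 G0 G1)
| W1br (a b : word0 G0).

Arguments W0one {G0}.
Arguments W1gen {G0 G1} e.
Arguments W1one {G0 G1}.
Arguments W1br {G0 G1} a b.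

Declare Scope word_scope.
Delimit Scope word_scope with W.
Notation "a ∔ b" := (W0mul a b) (at level 50, left associativity) : word_scope.
Notation "∸ a" := (W0inv a) (at level 35, right associativity) : word_scope.
Notation "s ⊞ t" := (W1mul s t) (at level 50, left associativity) : word_scope.
Notation "⊟ s" := (W1inv s) (at level 35, right associativity) : word_scope.

Record presentation := Presentation {
  pgen0 : Type;
  pgen1 : Type;
  pbd : pgen1 -> word0 pgen0;
  prel0 : word0 pgen0 -> word0 pgen0 -> Prop;
  prel1 : word1 pgen0 pgen1 -> word1 pgen0 pgen1 -> Prop }.

Section Presented.
Variable P : presentation.
Notation w0 := (word0 (pgen0 P)).
Notation w1 := (word1 (pgen0 P) (pgen1 P)).
Local Open Scope word_scope.

Definition W0comm (a b : w0) : w0 := ∸ a ∔ (∸ b ∔ (a ∔ b)).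
Definition W1comm (s t : w1) : w1 := ⊟ s ⊞ (⊟ t ⊞ (s ⊞ t)).

Fixpoint wbd (s : w1) : w0 :=
  match s with
  | W1gen e => pbd e
  | W1one => W0one
  | W1mul s t => wbd s ∔ wbd t
  | W1inv s => ∸ wbd s
  | W1br a b => W0comm b a
  end.

Inductive weq0 : w0 -> w0 -> Prop :=
| weq0_refl a : weq0 a a
| weq0_sym a b : weq0 a b -> weq0 b a
| weq0_trans a b c : weq0 a b -> weq0 b c -> weq0 a c
| weq0_mul a a' b b' : weq0 a a' -> weq0 b b' -> weq0 (a ∔ b) (a' ∔ b')
| weq0_inv a a' : weq0 a a' -> weq0 (∸ a) (∸ a')
| weq0_A a b c : weq0 (a ∔ (b ∔ c)) (a ∔ b ∔ c)
| weq0_1l a : weq0 (W0one ∔ a) a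
| weq0_1r a : weq0 (a ∔ W0one) a
| weq0_Vl a : weq0 (∸ a ∔ a) W0one
| weq0_Vr a : weq0 (a ∔ ∸ a) W0one
| weq0_rel a b : prel0 a b -> weq0 a b
| weq0_bd s t : weq1 s t -> weq0 (wbd s) (wbd t)
with weq1 : w1 -> w1 -> Prop :=
| weq1_refl s : weq1 s s
| weq1_sym s t : weq1 s t -> weq1 t s
| weq1_trans s t u : weq1 s t -> weq1 t u -> weq1 s u
| weq1_mul s s' t t' : weq1 s s' -> weq1 t t' -> weq1 (s ⊞ t) (s' ⊞ t')
| weq1_inv s s' : weq1 s s' -> weq1 (⊟ s) (⊟ s')
| weq1_A s t u : weq1 (s ⊞ (t ⊞ u)) (s ⊞ t ⊞ u)
| weq1_1l s : weq1 (W1one ⊞ s) s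
| weq1_1r s : weq1 (s ⊞ W1one) s
| weq1_Vl s : weq1 (⊟ s ⊞ s) W1one
| weq1_Vr s : weq1 (s ⊞ ⊟ s) W1one
| weq1_br a a' b b' : weq0 a a' -> weq0 b b' -> weq1 (W1br a b) (W1br a' b')
| weq1_brMl a a' b : weq1 (W1br (a ∔ a') b) (W1br a b ⊞ W1br a' b)
| weq1_brMr a b b' : weq1 (W1br a (b ∔ b')) (W1br a b ⊞ W1br a b')
| weq1_br_sym a b : weq1 (W1br a b ⊞ W1br b a) W1one
| weq1_br_bd s t : weq1 (W1br (wbd s) (wbd t)) (W1comm t s)
| weq1_rel s t : prel1 s t -> weq1 s t.

Definition setoid0 : setoid := Setoid weq0_refl weq0_sym weq0_trans.
Definition setoid1 : setoid := Setoid weq1_refl weq1_sym weq1_trans.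

Definition pres0 : Type := quot setoid0.
HB.instance Definition _ := Choice.copy pres0 (quot setoid0).
Definition pres1 : Type := quot setoid1.
HB.instance Definition _ := Choice.copy pres1 (quot setoid1).

Definition cls0 (a : w0) : pres0 := cls (a : setoid0).
Definition cls1 (s : w1) : pres1 := cls (s : setoid1).

Lemma cls0P a b : cls0 a = cls0 b <-> weq0 a b.
Proof. exact: (@clsP setoid0). Qed.
Lemma cls1P s t : cls1 s = cls1 t <-> weq1 s t.
Proof. exact: (@clsP setoid1). Qed.
Lemma cls0W (x : pres0) : exists a, x = cls0 a.
Proof. by exists (rep x); rewrite /cls0 repK. Qed.
Lemma cls1W (x : pres1) : exists s, x = cls1 s.
Proof. by exists (rep x); rewrite /cls1 repK. Qed.
Lemma rep0 a : weq0 (rep (cls0 a)) a.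
Proof. exact: (@rep_cls setoid0). Qed.
Lemma rep1 s : weq1 (rep (cls1 s)) s.
Proof. exact: (@rep_cls setoid1). Qed.

Definition pmul0 (x y : pres0) : pres0 := cls0 (rep x ∔ rep y).
Definition pinv0 (x : pres0) : pres0 := cls0 (∸ rep x).
Definition pmul1 (x y : pres1) : pres1 := cls1 (rep x ⊞ rep y).
Definition pinv1 (x : pres1) : pres1 := cls1 (⊟ rep x).
Definition pres_bd (x : pres1) : pres0 := cls0 (wbd (rep x)).
Definition pres_br (x y : pres0) : pres1 := cls1 (W1br (rep x) (rep y)).

Lemma pmul0E a b : pmul0 (cls0 a) (cls0 b) = cls0 (a ∔ b).
Proof. by apply/cls0P; apply: weq0_mul; exact: rep0. Qed.
Lemma pinv0E a : pinv0 (cls0 a) = cls0 (∸ a).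
Proof. by apply/cls0P; apply: weq0_inv; exact: rep0. Qed.
Lemma pmul1E s t : pmul1 (cls1 s) (cls1 t) = cls1 (s ⊞ t).
Proof. by apply/cls1P; apply: weq1_mul; exact: rep1. Qed.
Lemma pinv1E s : pinv1 (cls1 s) = cls1 (⊟ s).
Proof. by apply/cls1P; apply: weq1_inv; exact: rep1. Qed.
Lemma pres_bdE s : pres_bd (cls1 s) = cls0 (wbd s).
Proof. by apply/cls0P; apply: weq0_bd; exact: rep1. Qed.
Lemma pres_brE a b : pres_br (cls0 a) (cls0 b) = cls1 (W1br a b).
Proof. by apply/cls1P; apply: weq1_br; exact: rep0. Qed.

Lemma pmul0A : associative pmul0.
Proof.
move=> x y z; have [a ->] := cls0W x; have [b ->] := cls0W y.
by have [c ->] := cls0W z; rewrite !pmul0E; apply/cls0P; exact: weq0_A.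
Qed.
Lemma pmul01l : left_id (cls0 W0one) pmul0.
Proof.
by move=> x; have [a ->] := cls0W x; rewrite pmul0E; apply/cls0P; exact: weq0_1l.
Qed.
Lemma pmul01r : right_id (cls0 W0one) pmul0.
Proof.
by move=> x; have [a ->] := cls0W x; rewrite pmul0E; apply/cls0P; exact: weq0_1r.
Qed.
Lemma pmul0Vl : left_inverse (cls0 W0one) pinv0 pmul0.
Proof.
move=> x; have [a ->] := cls0W x.
by rewrite pinv0E pmul0E; apply/cls0P; exact: weq0_Vl.
Qed.
Lemma pmul0Vr : right_inverse (cls0 W0one) pinv0 pmul0.
Proof.
move=> x; have [a ->] := cls0W x.
by rewrite pinv0E pmul0E; apply/cls0P; exact: weq0_Vr.
Qed.
HB.instance Definition _ :=
  isGroup.Build pres0 pmul0A pmul01l pmul01r pmul0Vl pmul0Vr.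

Lemma pmul1A : associative pmul1.
Proof.
move=> x y z; have [a ->] := cls1W x; have [b ->] := cls1W y.
by have [c ->] := cls1W z; rewrite !pmul1E; apply/cls1P; exact: weq1_A.
Qed.
Lemma pmul11l : left_id (cls1 W1one) pmul1.
Proof.
by move=> x; have [a ->] := cls1W x; rewrite pmul1E; apply/cls1P; exact: weq1_1l.
Qed.
Lemma pmul11r : right_id (cls1 W1one) pmul1.
Proof.
by move=> x; have [a ->] := cls1W x; rewrite pmul1E; apply/cls1P; exact: weq1_1r.
Qed.
Lemma pmul1Vl : left_inverse (cls1 W1one) pinv1 pmul1.
Proof.
move=> x; have [a ->] := cls1W x.
by rewrite pinv1E pmul1E; apply/cls1P; exact: weq1_Vl.
Qed.
Lemma pmul1Vr : right_inverse (cls1 W1one) pinv1 pmul1.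
Proof.
move=> x; have [a ->] := cls1W x.
by rewrite pinv1E pmul1E; apply/cls1P; exact: weq1_Vr.
Qed.
HB.instance Definition _ :=
  isGroup.Build pres1 pmul1A pmul11l pmul11r pmul1Vl pmul1Vr.

Lemma pmul0M a b : (cls0 a * cls0 b)%g = cls0 (a ∔ b).
Proof. exact: pmul0E. Qed.
Lemma pinv0M a : ((cls0 a)^-1)%g = cls0 (∸ a).
Proof. exact: pinv0E. Qed.
Lemma pmul1M s t : (cls1 s * cls1 t)%g = cls1 (s ⊞ t).
Proof. exact: pmul1E. Qed.
Lemma pinv1M s : ((cls1 s)^-1)%g = cls1 (⊟ s).
Proof. exact: pinv1E. Qed.
Lemma pcomm0M a b : [~ cls0 a, cls0 b]%g = cls0 (W0comm a b).
Proof. by rewrite commgEl conjgE !pinv0M (pmul0M a b) (pmul0M _ (a ∔ b)) pmul0M. Qed.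
Lemma pcomm1M s t : [~ cls1 s, cls1 t]%g = cls1 (W1comm s t).
Proof. by rewrite commgEl conjgE !pinv1M (pmul1M s t) (pmul1M _ (s ⊞ t)) pmul1M. Qed.

Definition presented : sqm.
Proof.
refine (@SQM pres0 pres1 pres_bd pres_br _ _ _ _ _ _).
- move=> x y; have [s ->] := cls1W x; have [t ->] := cls1W y.
  by rewrite pmul1M !pres_bdE pmul0M.
- move=> x x' y; have [a ->] := cls0W x; have [b ->] := cls0W x'.
  have [c ->] := cls0W y; rewrite pmul0M !pres_brE pmul1M.
  by apply/cls1P; exact: weq1_brMl.
- move=> x x' y; have [a ->] := cls0W x; have [b ->] := cls0W x'.
  have [c ->] := cls0W y; rewrite pmul0M !pres_brE pmul1M.
  by apply/cls1P; exact: weq1_brMr.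
- move=> x y; have [a ->] := cls0W x; have [b ->] := cls0W y.
  by rewrite !pres_brE pmul1M; apply/cls1P; exact: weq1_br_sym.
- move=> x y; have [a ->] := cls0W x; have [b ->] := cls0W y.
  by rewrite pres_brE pres_bdE pcomm0M.
- move=> x y; have [s ->] := cls1W x; have [t ->] := cls1W y.
  by rewrite !pres_bdE pres_brE pcomm1M; apply/cls1P; exact: weq1_br_bd.
Defined.

Definition pclass0 (a : w0) : C0 presented := cls0 a.
Definition pclass1 (s : w1) : C1 presented := cls1 s.

Lemma pclass_bd s : bd (pclass1 s) = pclass0 (wbd s).
Proof. exact: pres_bdE. Qed.

End Presented.

(* The universal property of the presented module. *)
Record sqm_hom (M N : sqm) := SQMHom {
  sh0 : C0 M -> C0 N;
  sh1 : C1 M -> C1 N;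
  sh0M : {morph sh0 : x y / x * y};
  sh1M : {morph sh1 : x y / x * y};
  sh_bd : forall c, sh0 (bd c) = bd (sh1 c);
  sh_br : forall x y, sh1 (br x y) = br (sh0 x) (sh0 y) }.

Section Universal.
Variables (P : presentation) (M : sqm).
Variables (g0 : pgen0 P -> C0 M) (g1 : pgen1 P -> C1 M).

Fixpoint eval0 (a : word0 (pgen0 P)) : C0 M :=
  match a with
  | W0gen g => g0 g
  | W0one => 1
  | W0mul a b => eval0 a * eval0 b
  | W0inv a => (eval0 a)^-1
  end.

Fixpoint eval1 (s : word1 (pgen0 P) (pgen1 P)) : C1 M :=
  match s with
  | W1gen e => g1 e
  | W1one => 1
  | W1mul s t => eval1 s * eval1 t
  | W1inv s => (eval1 s)^-1
  | W1br a b => br (eval0 a) (eval0 b)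
  end.

Hypothesis g_bd : forall e, bd (g1 e) = eval0 (pbd e).
Hypothesis g_rel0 : forall a b, prel0 a b -> eval0 a = eval0 b.
Hypothesis g_rel1 : forall s t, prel1 s t -> eval1 s = eval1 t.

Lemma eval_bd s : eval0 (wbd s) = bd (eval1 s).
Proof.
elim: s => [e||s IHs t IHt|s IHs|a b] /=.
- by rewrite g_bd.
- by rewrite bd1.
- by rewrite IHs IHt bdM.
- by rewrite IHs bdV.
- by rewrite bd_br.
Qed.

Scheme weq0_mut := Induction for weq0 Sort Prop
  with weq1_mut := Induction for weq1 Sort Prop.
Combined Scheme weq_mut from weq0_mut, weq1_mut.

Lemma eval_weq :
  (forall a b, weq0 (P := P) a b -> eval0 a = eval0 b) /\
  (forall s t, weq1 (P := P) s t -> eval1 s = eval1 t).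
Proof.
apply: (@weq_mut P (fun a b _ => eval0 a = eval0 b)
  (fun s t _ => eval1 s = eval1 t)) => //=.
- by move=> a b c _ -> _ ->.
- by move=> a a' b b' _ -> _ ->.
- by move=> a a' _ ->.
- by move=> *; rewrite mulgA.
- by move=> *; rewrite mul1g.
- by move=> *; rewrite mulg1.
- by move=> *; rewrite mulVg.
- by move=> *; rewrite mulgV.
- by move=> s t _ e; rewrite !eval_bd e.
- by move=> a b c _ -> _ ->.
- by move=> a a' b b' _ -> _ ->.
- by move=> a a' _ ->.
- by move=> *; rewrite mulgA.
- by move=> *; rewrite mul1g.
- by move=> *; rewrite mulg1.
- by move=> *; rewrite mulVg.
- by move=> *; rewrite mulgV.
- by move=> a a' b b' _ -> _ ->.
- by move=> *; rewrite brMl.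
- by move=> *; rewrite brMr.
- by move=> *; rewrite br_sym.
- by move=> s t; rewrite !eval_bd br_bd.
Qed.

Lemma presented_universal :
  exists h : sqm_hom (presented P) M,
    [/\ forall g, sh0 h (pclass0 (W0gen g)) = g0 g,
        forall e, sh1 h (pclass1 (W1gen e)) = g1 e
      & forall h' : sqm_hom (presented P) M,
          (forall g, sh0 h' (pclass0 (W0gen g)) = g0 g) ->
          (forall e, sh1 h' (pclass1 (W1gen e)) = g1 e) ->
          sh0 h' =1 sh0 h /\ sh1 h' =1 sh1 h].
Proof.
have [e0 e1] := eval_weq.
pose f0 (x : C0 (presented P)) := eval0 (rep (x : quot (setoid0 P))).
pose f1 (x : C1 (presented P)) := eval1 (rep (x : quot (setoid1 P))).
have f0E a : f0 (pclass0 a) = eval0 a by apply: e0; exact: rep0.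
have f1E s : f1 (pclass1 s) = eval1 s by apply: e1; exact: rep1.
have f0M : {morph f0 : x y / x * y}.
  move=> x y; have [a ->] := cls0W x; have [b ->] := cls0W y.
  by rewrite [cls0 a * _]pmul0M (f0E (W0mul a b)) (f0E a) (f0E b).
have f1M : {morph f1 : x y / x * y}.
  move=> x y; have [a ->] := cls1W x; have [b ->] := cls1W y.
  by rewrite [cls1 a * _]pmul1M (f1E (W1mul a b)) (f1E a) (f1E b).
have fbd c : f0 (bd c) = bd (f1 c).
  have [s ->] := cls1W c.
  by rewrite [bd _](pclass_bd s) f0E (f1E s) eval_bd.
have fbr x y : f1 (br x y) = br (f0 x) (f0 y).
  have [a ->] := cls0W x; have [b ->] := cls0W y.
  by rewrite [br _ _](pres_brE a b) (f1E (W1br a b)) (f0E a) (f0E b).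
exists (SQMHom f0M f1M fbd fbr); split=> [g|e|h' h0 h1].
- exact: (f0E (W0gen g)).
- exact: (f1E (W1gen e)).
have h01 : sh0 h' 1 = 1.
  by apply: (mulgI (sh0 h' 1)); rewrite -sh0M !mulg1.
have h11 : sh1 h' 1 = 1.
  by apply: (mulgI (sh1 h' 1)); rewrite -sh1M !mulg1.
have E0 a : sh0 h' (pclass0 a) = eval0 a.
  elim: a => [g||a IHa b IHb|a IHa] //=.
  - by rewrite -[pclass0 _](pmul0M a b) sh0M IHa IHb.
  - apply: (mulgI (sh0 h' (pclass0 a))); rewrite -sh0M.
    by rewrite -[pclass0 (W0inv a)](pinv0M a) mulgV h01 IHa mulgV.
have E1 s : sh1 h' (pclass1 s) = eval1 s.
  elim: s => [e||a IHa b IHb|a IHa|a b] //=.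
  - by rewrite -[pclass1 _](pmul1M a b) sh1M IHa IHb.
  - apply: (mulgI (sh1 h' (pclass1 a))); rewrite -sh1M.
    by rewrite -[pclass1 (W1inv a)](pinv1M a) mulgV h11 IHa mulgV.
  - by rewrite -[pclass1 _](pres_brE a b) sh_br -!/(pclass0 _) !E0.
split=> x /=.
  by have [a ->] := cls0W x; rewrite (E0 a) (f0E a).
by have [a ->] := cls1W x; rewrite (E1 a) (f1E a).
Qed.
End Universal.

(** * Settings and determinant functors *)

(* The data of a setting to which the definition of determinant functor and the
   presentation of the universal module refer.
   - stri X Y C: triangles with first, middle and last objects X, Y, C;
   - striE D D' a b c: (a, b, c) are the components of an equivalence D -> D';
   - striL D: D is the triangle X =1=> X -> 0;
   - striR D: D is the triangle 0 -> X =1=> X;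
   - sstair Df Dg Dgf Dt: these triangles belong to a staircase;
   - scop D1 D2: for a coproduct S of X and Y, these are the triangles
     X -> S -> Y and Y -> S -> X given by inclusions and projections. *)
Record setting := Setting {
  seqv : category;
  szero : seqv;
  stri : seqv -> seqv -> seqv -> Type;
  striE : forall X Y C X' Y' C', stri X Y C -> stri X' Y' C' ->
    hom X X' -> hom Y Y' -> hom C C' -> Prop;
  striL : forall X, stri X X szero -> Prop;
  striR : forall X, stri szero X X -> Prop;
  sstair : forall X Y Z Cf Cg Cgf,
    stri X Y Cf -> stri Y Z Cg -> stri X Z Cgf -> stri Cf Cgf Cg -> Prop;
  scop : forall X Y S, stri X S Y -> stri Y S X -> Prop }.

(* The underlying data of a determinant functor with values in M; det_tri D is
   the morphism det(C) ⊗ det(X) -> det(Y). *)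
Record det_data (S : setting) (M : monoidal) := DetData {
  det_ob : seqv S -> M;
  det_mor : forall X X' : seqv S, hom X X' -> hom (det_ob X) (det_ob X');
  det_tri : forall X Y C : seqv S, stri X Y C ->
    hom (det_ob C ⊗ det_ob X) (det_ob Y) }.

Definition is_nc_det (S : setting) (G : catGroup) (d : det_data S G) : Prop :=
  [/\ forall X : seqv S, det_mor d (idm X) = idm (det_ob d X),
      forall (X Y Z : seqv S) (g : hom Y Z) (f : hom X Y),
        det_mor d (g ∘ f) = det_mor d g ∘ det_mor d f,
      forall (X Y C X' Y' C' : seqv S) (D : stri X Y C) (D' : stri X' Y' C')
        (a : hom X X') (b : hom Y Y') (c : hom C C'),
        striE D D' a b c ->
        det_tri d D' ∘ det_mor d c ⊠ det_mor d a = det_mor d b ∘ det_tri d D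
    & forall (X Y Z Cf Cg Cgf : seqv S) (Df : stri X Y Cf) (Dg : stri Y Z Cg)
        (Dgf : stri X Z Cgf) (Dt : stri Cf Cgf Cg),
        sstair Df Dg Dgf Dt ->
        det_tri d Dg ∘ idm (det_ob d Cg) ⊠ det_tri d Df =
        det_tri d Dgf ∘ det_tri d Dt ⊠ idm (det_ob d X)
          ∘ ass (det_ob d Cg) (det_ob d Cf) (det_ob d X)].

Definition is_commutative_det (S : setting) (P : picard) (d : det_data S P) :
    Prop :=
  forall (X Y T : seqv S) (D1 : stri X T Y) (D2 : stri Y T X), scop D1 D2 ->
    det_tri d D1 = det_tri d D2 ∘ comm (det_ob d Y) (det_ob d X).

Definition is_det (S : setting) (P : picard) (d : det_data S P) : Prop :=
  is_nc_det d /\ is_commutative_det d.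

(* f and a form a factorization of d' through d. *)
Definition is_factorization (S : setting) (V P : monoidal) (d : det_data S V)
    (d' : det_data S P) (f : tensorFunctor V P)
    (a : forall X, hom (f (det_ob d X)) (det_ob d' X)) : Prop :=
  (forall (X X' : seqv S) (h : hom X X'),
     a X' ∘ fmap f (det_mor d h) = det_mor d' h ∘ a X) /\
  (forall (X Y C : seqv S) (D : stri X Y C),
     a Y ∘ fmap f (det_tri d D) ∘ tmul f (det_ob d C) (det_ob d X) =
     det_tri d' D ∘ a C ⊠ a X).

Definition is_universal_det (S : setting) (V : picard) (d : det_data S V) :
    Prop :=
  forall (P : picard) (d' : det_data S P), is_det d' ->
  exists (f : tensorFunctor V P)
         (a : forall X, hom (f (det_ob d X)) (det_ob d' X)),
    [/\ is_symmetric f, is_factorization a &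
      forall (f' : tensorFunctor V P)
        (a' : forall X, hom (f' (det_ob d X)) (det_ob d' X)),
        is_symmetric f' -> is_factorization a' ->
        exists! b : forall x : V, hom (f x) (f' x),
          is_tensor_nat b /\ forall X, a X = a' X ∘ b (det_ob d X)].

Definition is_universal_nc_det (S : setting) (V : catGroup) (d : det_data S V) :
    Prop :=
  forall (G : catGroup) (d' : det_data S G), is_nc_det d' ->
  exists (f : tensorFunctor V G)
         (a : forall X, hom (f (det_ob d X)) (det_ob d' X)),
    is_factorization a /\
    forall (f' : tensorFunctor V G)
      (a' : forall X, hom (f' (det_ob d X)) (det_ob d' X)),
      is_factorization a' ->
      exists! b : forall x : V, hom (f x) (f' x),
        is_tensor_nat b /\ forall X, a X = a' X ∘ b (det_ob d X).

(** ** The universal stable quadratic module of a setting *)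

Section UniversalModule.
Variable S : setting.

Inductive dgen : Type :=
| GEqv (X X' : seqv S) (h : hom X X')
| GTri (X Y C : seqv S) (D : stri X Y C).

Notation w0 := (word0 (seqv S)).
Notation w1 := (word1 (seqv S) dgen).
Local Open Scope word_scope.

Definition Wob (X : seqv S) : w0 := W0gen X.
Definition Weqv (X X' : seqv S) (h : hom X X') : w1 := W1gen (GEqv h).
Definition Wtri (X Y C : seqv S) (D : stri X Y C) : w1 := W1gen (GTri D).

Definition dbd (e : dgen) : w0 :=
  match e with
  | GEqv X X' _ => ∸ Wob X' ∔ Wob X
  | GTri X Y C _ => ∸ Wob Y ∔ Wob C ∔ Wob X
  end.

Inductive drel0 : w0 -> w0 -> Prop :=
| drel_zero : drel0 (Wob (szero S)) W0one.

(* wbd does not depend on the relations of a presentation, so the boundary of a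
   word is available before drel1 is defined. *)
Let wbd' := @wbd (@Presentation (seqv S) dgen dbd drel0 (fun _ _ => False)).
Definition Wact (s : w1) (a : w0) : w1 := s ⊞ W1br a (wbd' s).

(* Dg, Df, Dgf and Dt stand for the triangles Delta_g, Delta_f, Delta_gf and
   Delta~ of a staircase; Wact s [X] is the action s^[X]. *)
Inductive drel1 : w1 -> w1 -> Prop :=
| drel_id X : drel1 (Weqv (idm X)) W1one
| drel_triL X (D : stri X X (szero S)) : striL D -> drel1 (Wtri D) W1one
| drel_triR X (D : stri (szero S) X X) : striR D -> drel1 (Wtri D) W1one
| drel_comp X Y Z (g : hom Y Z) (f : hom X Y) :
    drel1 (Weqv (g ∘ f)) (Weqv g ⊞ Weqv f)
| drel_triE X Y C X' Y' C' (D : stri X Y C) (D' : stri X' Y' C')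
    (a : hom X X') (b : hom Y Y') (c : hom C C') :
    striE D D' a b c ->
    drel1 (Weqv a ⊞ Wact (Weqv c) (Wob X)) (⊟ Wtri D' ⊞ Weqv b ⊞ Wtri D)
| drel_stair X Y Z Cf Cg Cgf (Df : stri X Y Cf) (Dg : stri Y Z Cg)
    (Dgf : stri X Z Cgf) (Dt : stri Cf Cgf Cg) :
    sstair Df Dg Dgf Dt ->
    drel1 (Wtri Dg ⊞ Wtri Df) (Wtri Dgf ⊞ Wact (Wtri Dt) (Wob X))
| drel_cop X Y T (D1 : stri X T Y) (D2 : stri Y T X) :
    scop D1 D2 ->
    drel1 (W1br (Wob X) (Wob Y)) (⊟ Wtri D2 ⊞ Wtri D1).

Definition Dpres : presentation := @Presentation (seqv S) dgen dbd drel0 drel1.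

Definition Dmod : sqm := presented Dpres.

Definition Dob (X : seqv S) : C0 Dmod := pclass0 (P := Dpres) (Wob X).
Definition Deqv (X X' : seqv S) (h : hom X X') : C1 Dmod :=
  pclass1 (P := Dpres) (Weqv h).
Definition Dtri (X Y C : seqv S) (D : stri X Y C) : C1 Dmod :=
  pclass1 (P := Dpres) (Wtri D).

Lemma bd_Deqv (X X' : seqv S) (h : hom X X') :
  bd (Deqv h) = (Dob X')^-1 * Dob X.
Proof.
rewrite /Deqv /Dob pclass_bd /pclass0 /=.
by rewrite -(pmul0M (P := Dpres)) -(pinv0M (P := Dpres)).
Qed.

Lemma bd_Dtri (X Y C : seqv S) (D : stri X Y C) :
  bd (Dtri D) = (Dob Y)^-1 * Dob C * Dob X.
Proof.
rewrite /Dtri /Dob pclass_bd /pclass0 /=.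
by rewrite -!(pmul0M (P := Dpres)) -(pinv0M (P := Dpres)).
Qed.

Lemma Deqv_subproof (X X' : seqv S) (h : hom X X') :
  Dob X == Dob X' * bd (Deqv h).
Proof. by rewrite bd_Deqv mulVKg. Qed.

Lemma Dtri_subproof (X Y C : seqv S) (D : stri X Y C) :
  Dob C * Dob X == Dob Y * bd (Dtri D).
Proof. by rewrite bd_Dtri -mulgA mulVKg. Qed.

(* The data det(X) = [X], det(X -> X') = ([X'], [X -> X']) and
   det(D) = ([Y], [D]). *)
Definition Ddet : det_data S (Gamma Dmod) :=
  @DetData S (Gamma Dmod) Dob
    (fun X X' h => exist _ (Deqv h) (Deqv_subproof h))
    (fun X Y C D => exist _ (Dtri D) (Dtri_subproof D)).
End UniversalModule.

(** * Waldhausen categories *)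

Record pointed := Pointed {
  pcat :> category;
  zob : pcat;
  zin : forall X : pcat, hom zob X;
  zout : forall X : pcat, hom X zob;
  zin_uniq : forall (X : pcat) (f : hom zob X), f = zin X;
  zout_uniq : forall (X : pcat) (f : hom X zob), f = zout X }.

Definition zmor (C : pointed) (X Y : C) : hom X Y := zin Y ∘ zout X.

Definition is_pushout (C : category) (X Y Z P : C) (f : hom X Y) (g : hom X Z)
    (u : hom Y P) (v : hom Z P) : Prop :=
  u ∘ f = v ∘ g /\
  forall (Q : C) (u' : hom Y Q) (v' : hom Z Q), u' ∘ f = v' ∘ g ->
    exists! h : hom P Q, h ∘ u = u' /\ h ∘ v = v'.

Definition is_coproduct (C : category) (X Y S : C) (i : hom X S) (j : hom Y S) :
    Prop :=
  forall (Q : C) (u : hom X Q) (v : hom Y Q),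
    exists! h : hom S Q, h ∘ i = u /\ h ∘ j = v.

Record waldhausen := Waldhausen {
  wpt :> pointed;
  cof : forall X Y : wpt, hom X Y -> Prop;
  weq : forall X Y : wpt, hom X Y -> Prop;
  cof_iso : forall (X Y : wpt) (f : hom X Y), is_iso f -> cof f;
  cof_comp : forall (X Y Z : wpt) (g : hom Y Z) (f : hom X Y),
    cof g -> cof f -> cof (g ∘ f);
  cof_zin : forall X : wpt, cof (zin X);
  cof_pushout : forall (X Y Z : wpt) (f : hom X Y) (g : hom X Z), cof f ->
    exists (P : wpt) (u : hom Y P) (v : hom Z P), is_pushout f g u v;
  cof_cobase : forall (X Y Z P : wpt) (f : hom X Y) (g : hom X Z)
    (u : hom Y P) (v : hom Z P), cof f -> is_pushout f g u v -> cof v;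
  weq_iso : forall (X Y : wpt) (f : hom X Y), is_iso f -> weq f;
  weq_comp : forall (X Y Z : wpt) (g : hom Y Z) (f : hom X Y),
    weq g -> weq f -> weq (g ∘ f);
  weq_glue : forall (X Y Z P X' Y' Z' P' : wpt)
    (f : hom X Y) (g : hom X Z) (u : hom Y P) (v : hom Z P)
    (f' : hom X' Y') (g' : hom X' Z') (u' : hom Y' P') (v' : hom Z' P')
    (x : hom X X') (y : hom Y Y') (z : hom Z Z') (p : hom P P'),
    cof f -> cof f' -> is_pushout f g u v -> is_pushout f' g' u' v' ->
    weq x -> weq y -> weq z ->
    y ∘ f = f' ∘ x -> z ∘ g = g' ∘ x -> p ∘ u = u' ∘ y -> p ∘ v = v' ∘ z ->
    weq p }.

Section WaldhausenSettings.
Variable W : waldhausen.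

Record cofseq (X Y C : W) := CofSeq {
  cfi : hom X Y;
  cfp : hom Y C;
  cfi_cof : cof cfi;
  cf_pushout : is_pushout cfi (zout X) cfp (zin C) }.

Definition cofseq_mor (X Y C X' Y' C' : W) (D : cofseq X Y C)
    (D' : cofseq X' Y' C') (a : hom X X') (b : hom Y Y') (c : hom C C') : Prop :=
  b ∘ cfi D = cfi D' ∘ a /\ c ∘ cfp D = cfp D' ∘ b.

Definition cofseq_stair (X Y Z Cf Cg Cgf : W) (Df : cofseq X Y Cf)
    (Dg : cofseq Y Z Cg) (Dgf : cofseq X Z Cgf) (Dt : cofseq Cf Cgf Cg) : Prop :=
  [/\ cfi Dgf = cfi Dg ∘ cfi Df,
      cfi Dt ∘ cfp Df = cfp Dgf ∘ cfi Dg
    & cfp Dt ∘ cfp Dgf = cfp Dg].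

Definition cofseq_cop (X Y S : W) (D1 : cofseq X S Y) (D2 : cofseq Y S X) :
    Prop :=
  [/\ is_coproduct (cfi D1) (cfi D2),
      cfp D1 ∘ cfi D2 = idm Y & cfp D2 ∘ cfi D1 = idm X].

Lemma weq_id (X : W) : weq (idm X).
Proof. by apply: weq_iso; exact: is_iso_id. Qed.

Definition we_cat : category := wide weq_id (@weq_comp W).

(* In a cofiber sequence starting or ending at the zero object, the remaining map
   is forced, so it is enough to require one map to be an identity. *)
Definition waldhausen_setting : setting := @Setting we_cat (zob W) cofseq
  (fun X Y C X' Y' C' D D' a b c => cofseq_mor D D' (sval a) (sval b) (sval c))
  (fun X D => cfi D = idm (X : W))
  (fun X D => cfp D = idm (X : W))
  cofseq_stair cofseq_cop.

(* The category of cofiber sequences, with its objectwise weak equivalences. *)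
Record s2ob := S2Ob { s2X : W; s2Y : W; s2C : W; s2seq : cofseq s2X s2Y s2C }.

Definition s2hom (D D' : s2ob) : Type :=
  {t : hom (s2X D) (s2X D') * hom (s2Y D) (s2Y D') * hom (s2C D) (s2C D') |
   cofseq_mor (s2seq D) (s2seq D') t.1.1 t.1.2 t.2}.

Definition s2id (D : s2ob) : s2hom D D.
Proof.
exists (idm (s2X D), idm (s2Y D), idm (s2C D)).
by split; rewrite /= comp1m compm1.
Defined.

Definition s2comp (D D' D'' : s2ob) (t : s2hom D' D'') (s : s2hom D D') :
  s2hom D D''.
Proof.
exists ((sval t).1.1 ∘ (sval s).1.1, (sval t).1.2 ∘ (sval s).1.2,
        (sval t).2 ∘ (sval s).2).
case: s t => [s [sf sp]] [t [tf tp]]; split=> /=.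
  by rewrite -compA sf compA tf compA.
by rewrite -compA sp compA tp compA.
Defined.

Definition S2 : category.
Proof.
refine (@Category s2ob s2hom s2id s2comp _ _ _).
- move=> D D' [[[a b] c] h]; apply: sig_prop_inj => /=.
  by rewrite !comp1m.
- move=> D D' [[[a b] c] h]; apply: sig_prop_inj => /=.
  by rewrite !compm1.
- move=> D D' D'' D''' [[[? ?] ?] ?] [[[? ?] ?] ?] [[[? ?] ?] ?].
  by apply: sig_prop_inj; rewrite /= !compA.
Defined.

Definition s2weq (D D' : S2) (t : @hom S2 D D') : Prop :=
  [/\ weq (sval t).1.1, weq (sval t).1.2 & weq (sval t).2].

Definition S2_X : functor S2 W :=
  @Functor S2 W s2X (fun _ _ t => (sval t).1.1) (fun _ => erefl)
    (fun _ _ _ _ _ => erefl).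
Definition S2_Y : functor S2 W :=
  @Functor S2 W s2Y (fun _ _ t => (sval t).1.2) (fun _ => erefl)
    (fun _ _ _ _ _ => erefl).
Definition S2_C : functor S2 W :=
  @Functor S2 W s2C (fun _ _ t => (sval t).2) (fun _ => erefl)
    (fun _ _ _ _ _ => erefl).

Lemma S2_X_weq (D D' : S2) (t : @hom S2 D D') : s2weq t -> weq (fmap S2_X t).
Proof. by case. Qed.
Lemma S2_Y_weq (D D' : S2) (t : @hom S2 D D') : s2weq t -> weq (fmap S2_Y t).
Proof. by case. Qed.
Lemma S2_C_weq (D D' : S2) (t : @hom S2 D D') : s2weq t -> weq (fmap S2_C t).
Proof. by case. Qed.

Definition HoW : category := Ho (@weq W).
Definition HoS2 : category := Ho s2weq.

Definition derived_setting : setting := @Setting (core HoW) (zob W) cofseq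
  (fun X Y C X' Y' C' D D' a b c =>
     exists t : @hom (core HoS2) (S2Ob D) (S2Ob D'),
       [/\ sval a = fmap (Ho_functor S2_X_weq) (sval t),
           sval b = fmap (Ho_functor S2_Y_weq) (sval t)
         & sval c = fmap (Ho_functor S2_C_weq) (sval t)])
  (fun X D => cfi D = idm (X : W))
  (fun X D => cfp D = idm (X : W))
  cofseq_stair cofseq_cop.
End WaldhausenSettings.

(** * Triangulated categories *)

HB.instance Definition _ (C : category) (X Y : C) := gen_eqMixin (hom X Y).
HB.instance Definition _ (C : category) (X Y : C) := gen_choiceMixin (hom X Y).

Record preadditive := Preadditive {
  adcat :> pointed;
  adzmod : forall X Y : adcat, GRing.isZmodule (hom X Y) }.

HB.instance Definition _ (A : preadditive) (X Y : A) := @adzmod A X Y.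

Local Open Scope ring_scope.

Record biproduct (A : preadditive) (X Y S : A) := Biproduct {
  bi1 : hom X S;
  bi2 : hom Y S;
  bp1 : hom S X;
  bp2 : hom S Y;
  bp1i1 : bp1 ∘ bi1 = idm X;
  bp2i2 : bp2 ∘ bi2 = idm Y;
  bp1i2 : bp1 ∘ bi2 = 0;
  bp2i1 : bp2 ∘ bi1 = 0;
  bip : bi1 ∘ bp1 + bi2 ∘ bp2 = idm S }.

Record additive := Additive {
  pread :> preadditive;
  compDl : forall (X Y Z : pread) (g g' : hom Y Z) (f : hom X Y),
    (g + g') ∘ f = g ∘ f + g' ∘ f;
  compDr : forall (X Y Z : pread) (g : hom Y Z) (f f' : hom X Y),
    g ∘ (f + f') = g ∘ f + g ∘ f';
  biprod_ex : forall X Y : pread, exists S, inhabited (biproduct X Y S) }.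

Record suspended := Suspended {
  sadd :> additive;
  Sg : functor sadd sadd;
  SgD : forall (X Y : sadd) (f g : hom X Y),
    fmap Sg (f + g) = fmap Sg f + fmap Sg g;
  Sg_equiv : is_equivalence Sg }.

Section Triangles.
Variable T : suspended.
Notation "'Σ' X" := (Sg T X) (at level 30, right associativity).
Notation "'Σm' f" := (fmap (Sg T) f) (at level 30, right associativity).

Record tri (X Y C : T) := Tri { t1 : hom X Y; t2 : hom Y C; t3 : hom C (Σ X) }.

Definition is_triangle (X Y C : T) (D : tri X Y C) : Prop :=
  [/\ t2 D ∘ t1 D = 0, t3 D ∘ t2 D = 0 & Σm (t1 D) ∘ t3 D = 0].

Definition tri_mor (X Y C X' Y' C' : T) (D : tri X Y C) (D' : tri X' Y' C')
    (a : hom X X') (b : hom Y Y') (c : hom C C') : Prop :=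
  [/\ b ∘ t1 D = t1 D' ∘ a, c ∘ t2 D = t2 D' ∘ b & Σm a ∘ t3 D = t3 D' ∘ c].

Definition tri_isomorphic (X Y C X' Y' C' : T) (D : tri X Y C)
    (D' : tri X' Y' C') : Prop :=
  exists (a : hom X X') (b : hom Y Y') (c : hom C C'),
    [/\ is_iso a, is_iso b, is_iso c & tri_mor D D' a b c].

Definition tri_rot (X Y C : T) (D : tri X Y C) : tri Y C (Σ X) :=
  Tri (t2 D) (t3 D) (- Σm (t1 D)).

(* A -1-> A -> 0 -> ΣA;  0 -> B -1-> B -> Σ0;  C -> 0 -> ΣC -1-> ΣC. *)
Definition tri_idL (A : T) : tri A A (zob T) := Tri (idm A) 0 0.
Definition tri_idR (B : T) : tri (zob T) B B := Tri 0 (idm B) 0.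
Definition tri_idS (C : T) : tri C (zob T) (Σ C) := Tri 0 0 (idm (Σ C)).

(* The direct sum of D and D', formed with the given biproducts. *)
Definition tri_sum (X Y C X' Y' C' X'' Y'' C'' : T) (BX : biproduct X X' X'')
    (BY : biproduct Y Y' Y'') (BC : biproduct C C' C'')
    (D : tri X Y C) (D' : tri X' Y' C') : tri X'' Y'' C'' :=
  Tri (bi1 BY ∘ t1 D ∘ bp1 BX + bi2 BY ∘ t1 D' ∘ bp2 BX)
      (bi1 BC ∘ t2 D ∘ bp1 BY + bi2 BC ∘ t2 D' ∘ bp2 BY)
      (Σm (bi1 BX) ∘ t3 D ∘ bp1 BC + Σm (bi2 BX) ∘ t3 D' ∘ bp2 BC).

Inductive contractible : forall X Y C, tri X Y C -> Prop :=
| contractible_L A : contractible (tri_idL A)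
| contractible_R B : contractible (tri_idR B)
| contractible_S C : contractible (tri_idS C)
| contractible_sum X Y C X' Y' C' X'' Y'' C'' (BX : biproduct X X' X'')
    (BY : biproduct Y Y' Y'') (BC : biproduct C C' C'')
    (D : tri X Y C) (D' : tri X' Y' C') :
    contractible D -> contractible D' -> contractible (tri_sum BX BY BC D D').

(* The four triangles Δ_f, Δ_g, Δ_gf and Δ~ of an octahedral diagram. *)
Record octdata := OctData {
  oX : T; oY : T; oZ : T; oCf : T; oCg : T; oCgf : T;
  of_ : tri oX oY oCf;
  og_ : tri oY oZ oCg;
  ogf : tri oX oZ oCgf;
  ot_ : tri oCf oCgf oCg }.

Definition octahedral (O : octdata) : Prop :=
  let f := t1 (of_ O) in let g := t1 (og_ O) in
  let gbar := t1 (ot_ O) in let fbar := t2 (ot_ O) in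
  [/\ [/\ is_triangle (of_ O), is_triangle (og_ O), is_triangle (ogf O)
        & is_triangle (ot_ O)],
      t1 (ogf O) = g ∘ f,
      t3 (ot_ O) = Σm (t2 (of_ O)) ∘ t3 (og_ O),
      gbar ∘ t2 (of_ O) = t2 (ogf O) ∘ g /\ t3 (ogf O) ∘ gbar = t3 (of_ O)
    & fbar ∘ t2 (ogf O) = t2 (og_ O) /\
      t3 (og_ O) ∘ fbar = Σm f ∘ t3 (ogf O)].

(* The property of having the four triangles in a given class. *)
Definition oct_all (P : forall X Y C, tri X Y C -> Prop) (O : octdata) : Prop :=
  [/\ P _ _ _ (of_ O), P _ _ _ (og_ O), P _ _ _ (ogf O) & P _ _ _ (ot_ O)].

Definition oct_mor (O O' : octdata) (x : hom (oX O) (oX O'))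
    (y : hom (oY O) (oY O')) (z : hom (oZ O) (oZ O'))
    (cf : hom (oCf O) (oCf O')) (cg : hom (oCg O) (oCg O'))
    (cgf : hom (oCgf O) (oCgf O')) : Prop :=
  [/\ tri_mor (of_ O) (of_ O') x y cf, tri_mor (og_ O) (og_ O') y z cg,
      tri_mor (ogf O) (ogf O') x z cgf & tri_mor (ot_ O) (ot_ O') cf cgf cg].

Definition oct_isomorphic (O O' : octdata) : Prop :=
  exists (x : hom (oX O) (oX O')) (y : hom (oY O) (oY O'))
    (z : hom (oZ O) (oZ O')) (cf : hom (oCf O) (oCf O'))
    (cg : hom (oCg O) (oCg O')) (cgf : hom (oCgf O) (oCgf O')),
    [/\ is_iso x /\ is_iso y, is_iso z /\ is_iso cf, is_iso cg /\ is_iso cgf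
      & oct_mor x y z cf cg cgf].

Definition oct_sum (O O' : octdata) (X Y Z Cf Cg Cgf : T)
    (BX : biproduct (oX O) (oX O') X) (BY : biproduct (oY O) (oY O') Y)
    (BZ : biproduct (oZ O) (oZ O') Z) (Bf : biproduct (oCf O) (oCf O') Cf)
    (Bg : biproduct (oCg O) (oCg O') Cg)
    (Bgf : biproduct (oCgf O) (oCgf O') Cgf) : octdata :=
  OctData (tri_sum BX BY Bf (of_ O) (of_ O')) (tri_sum BY BZ Bg (og_ O) (og_ O'))
    (tri_sum BX BZ Bgf (ogf O) (ogf O')) (tri_sum Bf Bgf Bg (ot_ O) (ot_ O')).

(* The degenerate octahedra on a triangle X -f-> Y -> C -> ΣX, with bases
   0 -> X -f-> Y, X -1-> X -f-> Y, X -f-> Y -1-> Y and X -f-> Y -> 0. *)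
Definition oct_deg0 (X Y C : T) (D : tri X Y C) : octdata :=
  OctData (tri_idR X) D (tri_idR Y) D.
Definition oct_deg1 (X Y C : T) (D : tri X Y C) : octdata :=
  OctData (tri_idL X) D D (tri_idR C).
Definition oct_deg2 (X Y C : T) (D : tri X Y C) : octdata :=
  OctData D (tri_idL Y) D (tri_idL C).
Definition oct_deg3 (X Y C : T) (D : tri X Y C) : octdata :=
  OctData D (tri_idS Y) (tri_idS X) (Tri (t3 D) (Σm (t1 D)) (Σm (t2 D))).
End Triangles.

Record triangulated := Triangulated {
  tsus :> suspended;
  dist : forall X Y C : tsus, tri X Y C -> Prop;
  dist_triangle : forall (X Y C : tsus) (D : tri X Y C),
    dist D -> is_triangle D;
  dist_iso : forall (X Y C X' Y' C' : tsus) (D : tri X Y C) (D' : tri X' Y' C'),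
    tri_isomorphic D D' -> dist D -> dist D';
  dist_id : forall X : tsus, dist (tri_idL X);
  dist_ex : forall (X Y : tsus) (f : hom X Y),
    exists (C : tsus) (i : hom Y C) (q : hom C (Sg tsus X)), dist (Tri f i q);
  dist_rot : forall (X Y C : tsus) (D : tri X Y C), dist D <-> dist (tri_rot D);
  dist_fill : forall (X Y C X' Y' C' : tsus) (D : tri X Y C)
    (D' : tri X' Y' C') (a : hom X X') (b : hom Y Y'),
    dist D -> dist D' -> b ∘ t1 D = t1 D' ∘ a -> exists c, tri_mor D D' a b c;
  dist_oct : forall (X Y Z Cf Cg Cgf : tsus) (Df : tri X Y Cf)
    (Dg : tri Y Z Cg) (Dgf : tri X Z Cgf),
    dist Df -> dist Dg -> dist Dgf -> t1 Dgf = t1 Dg ∘ t1 Df ->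
    exists Dt : tri Cf Cgf Cg, dist Dt /\ octahedral (OctData Df Dg Dgf Dt) }.

Section TriangulatedSettings.
Variable T : triangulated.
Notation "'Σ' X" := (Sg T X) (at level 30, right associativity).
Notation "'Σm' f" := (fmap (Sg T) f) (at level 30, right associativity).

Definition octahedron (O : octdata T) : Prop :=
  octahedral O /\ oct_all (@dist T) O.

Definition special_octahedron (O : octdata T) : Prop :=
  [/\ octahedron O,
      forall (S : T) (B : biproduct (oZ O) (oCf O) S),
        dist (Tri (bi1 B ∘ t1 (og_ O) - bi2 B ∘ t2 (of_ O))
                  (t2 (ogf O) ∘ bp1 B + t1 (ot_ O) ∘ bp2 B)
                  (t3 (og_ O) ∘ t2 (ot_ O)))
    & forall (S : T) (B : biproduct (Σ (oX O)) (oCg O) S),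
        dist (Tri (bi1 B ∘ t3 (ogf O) - bi2 B ∘ t2 (ot_ O))
                  (Σm (t1 (of_ O)) ∘ bp1 B + t3 (og_ O) ∘ bp2 B)
                  (Σm (t1 (ot_ O) ∘ t2 (of_ O))))].

Definition virtual (X Y C : T) (D : tri X Y C) : Prop :=
  is_triangle D /\
  exists (X' Y' C' : T) (K : tri X' Y' C')
    (XX YY CC : T) (BX : biproduct X X' XX) (BY : biproduct Y Y' YY)
    (BC : biproduct C C' CC)
    (X1 Y1 C1 : T) (D1 : tri X1 Y1 C1),
    [/\ contractible K, is_triangle D1,
        tri_isomorphic (tri_sum BX BY BC D K) D1
      & [/\ exists f'', dist (Tri f'' (t2 D1) (t3 D1)),
            exists i'', dist (Tri (t1 D1) i'' (t3 D1))
          & exists q'', dist (Tri (t1 D1) (t2 D1) q'')]].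

Definition virtual_octahedron (O : octdata T) : Prop :=
  octahedral O /\ oct_all virtual O.

(* D1 and D2 are X -> S -> Y -0-> ΣX and Y -> S -> X -0-> ΣY, where S is a direct
   sum of X and Y. *)
Definition tri_cop (X Y S : T) (D1 : tri X S Y) (D2 : tri Y S X) : Prop :=
  exists B : biproduct X Y S,
    D1 = Tri (bi1 B) (bp2 B) 0 /\ D2 = Tri (bi2 B) (bp1 B) 0.

(* Equivalences are isomorphisms, triangles are those in the class P, and
   staircases are the octahedral diagrams in the class Q. *)
Definition tri_setting (P : forall X Y C : T, tri X Y C -> Prop)
    (Q : octdata T -> Prop) : setting :=
  @Setting (core T) (zob T) (fun X Y C => {D : tri X Y C | P X Y C D})
    (fun X Y C X' Y' C' D D' a b c =>
       tri_mor (sval D) (sval D') (sval a) (sval b) (sval c))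
    (fun X D => sval D = tri_idL (X : T))
    (fun X D => sval D = tri_idR (X : T))
    (fun X Y Z Cf Cg Cgf Df Dg Dgf Dt =>
       Q (OctData (sval Df) (sval Dg) (sval Dgf) (sval Dt)))
    (fun X Y S D1 D2 => tri_cop (sval D1) (sval D2)).

Definition breuning_setting : setting := tri_setting (@dist T) octahedron.
Definition special_setting : setting := tri_setting (@dist T) special_octahedron.
Definition virtual_setting : setting := tri_setting virtual virtual_octahedron.
End TriangulatedSettings.

(* Distinguished octahedra are not required to be closed under the cyclic
   symmetry of octahedral diagrams. *)
Record pretriangulated3 := Pretriangulated3 {
  ptri :> triangulated;
  dist3 : octdata ptri -> Prop;
  dist3_octahedron : forall O, dist3 O -> octahedron O;
  dist3_iso : forall O O', oct_isomorphic O O' -> dist3 O -> dist3 O';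
  dist3_sum : forall (O O' : octdata ptri) (X Y Z Cf Cg Cgf : ptri)
    (BX : biproduct (oX O) (oX O') X) (BY : biproduct (oY O) (oY O') Y)
    (BZ : biproduct (oZ O) (oZ O') Z) (Bf : biproduct (oCf O) (oCf O') Cf)
    (Bg : biproduct (oCg O) (oCg O') Cg)
    (Bgf : biproduct (oCgf O) (oCgf O') Cgf),
    dist3 O -> dist3 O' -> dist3 (oct_sum BX BY BZ Bf Bg Bgf);
  dist3_deg0 : forall (X Y C : ptri) (D : tri X Y C),
    dist D -> dist3 (oct_deg0 D);
  dist3_deg1 : forall (X Y C : ptri) (D : tri X Y C),
    dist D -> dist3 (oct_deg1 D);
  dist3_deg2 : forall (X Y C : ptri) (D : tri X Y C),
    dist D -> dist3 (oct_deg2 D);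
  dist3_deg3 : forall (X Y C : ptri) (D : tri X Y C),
    dist D -> dist3 (oct_deg3 D);
  dist3_ex : forall (X Y Z : ptri) (f : hom X Y) (g : hom Y Z),
    exists (Cf Cg Cgf : ptri) (Df : tri X Y Cf) (Dg : tri Y Z Cg)
      (Dgf : tri X Z Cgf) (Dt : tri Cf Cgf Cg),
      [/\ t1 Df = f, t1 Dg = g & dist3 (OctData Df Dg Dgf Dt)];
  dist3_fill : forall (O O' : octdata ptri) (x : hom (oX O) (oX O'))
    (y : hom (oY O) (oY O')) (z : hom (oZ O) (oZ O')),
    dist3 O -> dist3 O' ->
    y ∘ t1 (of_ O) = t1 (of_ O') ∘ x -> z ∘ t1 (og_ O) = t1 (og_ O') ∘ y ->
    exists cf cg cgf, oct_mor x y z cf cg cgf }.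

Definition pretriangulated3_setting (T3 : pretriangulated3) : setting :=
  tri_setting (@dist T3) (@dist3 T3).

(** ** The modules of the six settings *)

Definition D_W (W : waldhausen) : sqm := Dmod (waldhausen_setting W).
Definition D_der (W : waldhausen) : sqm := Dmod (derived_setting W).
Definition D_bT (T : triangulated) : sqm := Dmod (breuning_setting T).
Definition D_dT (T : triangulated) : sqm := Dmod (special_setting T).
Definition D_vT (T : triangulated) : sqm := Dmod (virtual_setting T).
Definition D_sT3 (T3 : pretriangulated3) : sqm :=
  Dmod (pretriangulated3_setting T3).

(* Main.v *)
(* The main point is universality for non-commutative determinant functors.  A
   categorical group may be replaced by the groupoid of a crossed module
   E_1 -> E_0, whose objects are operators on representatives of isomorphism
   classes.  Given a determinant functor d with values in it, comparing the two
   triangles on X ⊕ Y yields b(X, Y) in E_1 with boundary [d Y, d X]; staircases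
   on X ⊕ Z -> Y ⊕ Z show that b is natural and satisfies a Yang-Baxter identity.
   This is exactly what is needed to adjoin to E_1 elements z_X which act as d X
   and commute up to b, without collapsing E_1: one adds one z_X at a time,
   acting by permutations of the group already built.  The result is a group Q
   with E_1 -> Q -> E_0 and Q / E_1 abelian.  Together with a bimultiplicative
   form which corrects the squares <X, X>, the elements of Q over 1 in E_0 on
   which conjugation is given by this form make up a stable quadratic module
   over Q / E_1, to which the universal one maps.  Lifting objects from Q / E_1
   to Q and projecting to E_0 gives the tensor functor.

   For its uniqueness up to a unique transformation, the pairs (x, θ : f x -> f' x)
   form a group, whose double commutant of the generators is again part of a
   stable quadratic module, and the universal property provides a section.  If
   the target is a Picard groupoid, symmetry holds because it holds on
   generators, by the commutativity axiom.

   The settings enter only through properties of coproducts.  In the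
   triangulated settings the required staircases are direct sums of degenerate
   octahedra. *)

From Stdlib Require List.
From HB Require Import structures.
From mathcomp Require Import all_boot all_algebra boolp.
Require Import Defs.

Set Implicit Arguments.
Unset Strict Implicit.
Unset Printing Implicit Defensive.

Local Open Scope cat_scope.
Local Open Scope group_scope.

(** * Groups presented by words *)

(** A bracket cannot be put on [E_0] itself: the elements [so d X] may satisfy relations there which
    [b] does not respect. In [Q] the letters [z X] satisfy only the relations of a model, so a form
    can be prescribed on them freely. Injectivity of [E_1 -> Q] is then the crux, because morphisms
    of the target are recovered as quotients of elements of [Q] with the same class in [Q / E_1]; a
    presented group could well collapse here, and the Yang-Baxter identity is what prevents it.

    The price is that the equations attached to equivalences and triangles, valid in [E_0], hold in
    [Q] only up to elements of the kernel of [q]. These defects, and not elements of [E_1], are the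
    images of the generators of degree one, and naturality of [b] is what makes conjugation act on
    them as prescribed.

    Operators enter because the isomorphism classes of a categorical group form a group which in
    general has no strictly multiplicative choice of representatives. Operators compose strictly
    once those related by a compatible isomorphism are identified. *)

Record wcong (T : Type) := WCong {
  wrel :> word0 T -> word0 T -> Prop;
  wrel_refl : forall w, wrel w w;
  wrel_sym : forall w w', wrel w w' -> wrel w' w;
  wrel_trans : forall w w' w'', wrel w w' -> wrel w' w'' -> wrel w w'';
  wrel_mul : forall v v' w w', wrel v v' -> wrel w w' ->
    wrel (W0mul v w) (W0mul v' w');
  wrel_inv : forall w w', wrel w w' -> wrel (W0inv w) (W0inv w');
  wrel_A : forall u v w, wrel (W0mul u (W0mul v w)) (W0mul (W0mul u v) w);
  wrel_1l : forall w, wrel (W0mul W0one w) w;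
  wrel_1r : forall w, wrel (W0mul w W0one) w;
  wrel_Vl : forall w, wrel (W0mul (W0inv w) w) W0one;
  wrel_Vr : forall w, wrel (W0mul w (W0inv w)) W0one }.

Section WordGroup.
Variables (T : Type) (R : wcong T).

Definition wsetoid : setoid :=
  Setoid (@wrel_refl T R) (@wrel_sym T R) (@wrel_trans T R).
Definition wgrp : Type := quot wsetoid.
HB.instance Definition _ := Choice.copy wgrp (quot wsetoid).

Definition wcls (w : word0 T) : wgrp := cls (w : wsetoid).
Definition wrep (x : wgrp) : word0 T := rep (x : quot wsetoid).

Lemma wclsP v w : wcls v = wcls w <-> R v w.
Proof. exact: (@clsP wsetoid). Qed.
Lemma wrepK x : wcls (wrep x) = x.
Proof. exact: repK. Qed.
Lemma wrep_cls w : R (wrep (wcls w)) w.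
Proof. exact: (@rep_cls wsetoid). Qed.

Definition wgmul x y := wcls (W0mul (wrep x) (wrep y)).
Definition wginv x := wcls (W0inv (wrep x)).

Lemma wgmulE v w : wgmul (wcls v) (wcls w) = wcls (W0mul v w).
Proof. by apply/wclsP; apply: wrel_mul; exact: wrep_cls. Qed.
Lemma wginvE w : wginv (wcls w) = wcls (W0inv w).
Proof. by apply/wclsP; apply: wrel_inv; exact: wrep_cls. Qed.

Lemma wgmulA : associative wgmul.
Proof.
move=> x y z; rewrite -(wrepK x) -(wrepK y) -(wrepK z) !wgmulE.
by apply/wclsP; exact: wrel_A.
Qed.
Lemma wgmul1l : left_id (wcls W0one) wgmul.
Proof. by move=> x; rewrite -(wrepK x) wgmulE; apply/wclsP; exact: wrel_1l. Qed.
Lemma wgmul1r : right_id (wcls W0one) wgmul.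
Proof. by move=> x; rewrite -(wrepK x) wgmulE; apply/wclsP; exact: wrel_1r. Qed.
Lemma wgmulVl : left_inverse (wcls W0one) wginv wgmul.
Proof.
by move=> x; rewrite -(wrepK x) wginvE wgmulE; apply/wclsP; exact: wrel_Vl.
Qed.
Lemma wgmulVr : right_inverse (wcls W0one) wginv wgmul.
Proof.
by move=> x; rewrite -(wrepK x) wginvE wgmulE; apply/wclsP; exact: wrel_Vr.
Qed.
HB.instance Definition _ :=
  isGroup.Build wgrp wgmulA wgmul1l wgmul1r wgmulVl wgmulVr.

Lemma wclsM v w : wcls (W0mul v w) = wcls v * wcls w.
Proof. exact: esym (wgmulE v w). Qed.
Lemma wclsV w : wcls (W0inv w) = (wcls w)^-1.
Proof. exact: esym (wginvE w). Qed.

Lemma wgrp_ind (P : wgrp -> Prop) :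
  (forall g, P (wcls (W0gen g))) -> (forall x y, P x -> P y -> P (x * y)) ->
  (forall x, P x -> P x^-1) -> P 1 -> forall x, P x.
Proof.
move=> Pg PM PV P1 x; rewrite -(wrepK x); elim: (wrep x) => //= [v IHv w IHw|w IHw].
  by rewrite wclsM; exact: PM.
by rewrite wclsV; exact: PV.
Qed.
End WordGroup.

Section GroupMorphism.
Variables (G H : groupType) (f : G -> H).
Hypothesis fM : {morph f : x y / x * y}.
Lemma morph_one : f 1 = 1.
Proof. by apply: (mulgI (f 1)); rewrite -fM !mulg1. Qed.
Lemma morph_inv x : f x^-1 = (f x)^-1.
Proof. by apply: (mulgI (f x)); rewrite -fM !mulgV morph_one. Qed.
Lemma morph_conj x y : f (x ^ y) = f x ^ f y.
Proof. by rewrite /conjg !fM morph_inv. Qed.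
End GroupMorphism.

Definition weval (T : Type) (G : groupType) (g : T -> G) :=
  fix ev (w : word0 T) : G :=
  match w with
  | W0gen t => g t
  | W0one => 1
  | W0mul v w => ev v * ev w
  | W0inv w => (ev w)^-1
  end.

(** * Permutation groups of types *)

Section Bijections.
Variable T : Type.

Definition bij : Type :=
  {p : (T -> T) * (T -> T) | cancel p.1 p.2 /\ cancel p.2 p.1}.
HB.instance Definition _ := gen_eqMixin bij.
HB.instance Definition _ := gen_choiceMixin bij.

Definition bapp (p : bij) : T -> T := (sval p).1.

Lemma bij_inj (p q : bij) : bapp p =1 bapp q -> p = q.
Proof.
case: p q => [[f f'] [/= fK f'K]] [[g g'] [/= gK g'K]] fg; apply: sig_prop_inj.
have {}fg : f = g by apply: funext => x; exact: fg.
by subst g; congr (_, _); apply: funext => x; apply: (can_inj fK); rewrite f'K g'K.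
Qed.

Definition bij_of (f g : T -> T) (fK : cancel f g) (gK : cancel g f) : bij :=
  exist _ (f, g) (conj fK gK).
Definition bij1 : bij := @bij_of id id (fun _ => erefl) (fun _ => erefl).
Lemma bij_mul_subproof (p q : bij) :
  cancel ((sval p).1 \o (sval q).1) ((sval q).2 \o (sval p).2) /\
  cancel ((sval q).2 \o (sval p).2) ((sval p).1 \o (sval q).1).
Proof.
by case: p q => [p [pK Kp]] [q [qK Kq]]; split=> x /=; rewrite ?pK ?qK ?Kq ?Kp.
Qed.
Definition bij_mul (p q : bij) : bij :=
  exist _ ((sval p).1 \o (sval q).1, (sval q).2 \o (sval p).2)
    (bij_mul_subproof p q).
Definition bij_inv (p : bij) : bij :=
  exist _ ((sval p).2, (sval p).1) (conj (proj2_sig p).2 (proj2_sig p).1).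

Lemma bij_mulA : associative bij_mul.
Proof. by move=> p q r; exact: bij_inj. Qed.
Lemma bij_mul1 : left_id bij1 bij_mul.
Proof. by move=> p; exact: bij_inj. Qed.
Lemma bij_mul1r : right_id bij1 bij_mul.
Proof. by move=> p; exact: bij_inj. Qed.
Lemma bij_mulV : left_inverse bij1 bij_inv bij_mul.
Proof. by move=> p; apply: bij_inj => x; exact: (proj2_sig p).1. Qed.
Lemma bij_mulVr : right_inverse bij1 bij_inv bij_mul.
Proof. by move=> p; apply: bij_inj => x; exact: (proj2_sig p).2. Qed.
HB.instance Definition _ :=
  isGroup.Build bij bij_mulA bij_mul1 bij_mul1r bij_mulV bij_mulVr.

End Bijections.

Definition left_translation (G : groupType) (g : G) : bij G :=
  bij_of (mulKg g) (mulVKg g).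

(** * Crossed modules *)

Reserved Notation "c ◃ x" (at level 28, left associativity).

Record xmod := XMod {
  X0 : groupType;
  X1 : groupType;
  xd : X1 -> X0;
  xact : X1 -> X0 -> X1;
  xdM : {morph xd : x y / x * y};
  xactM : forall a b x, xact (a * b) x = xact a x * xact b x;
  xact_1 : forall a, xact a 1 = a;
  xactA : forall a x y, xact a (x * y) = xact (xact a x) y;
  xd_act : forall a x, xd (xact a x) = xd a ^ x;
  xact_d : forall a b, xact a (xd b) = a ^ b }.

Arguments xd {_} _.
Arguments xact {_} _ _.
Notation "c ◃ x" := (xact c x) : group_scope.

Section XModTheory.
Variable E : xmod.
Implicit Types (a b : X1 E) (x y : X0 E).
Lemma xd1 : xd (1 : X1 E) = 1. Proof. exact: morph_one (@xdM E). Qed.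
Lemma xdV a : xd a^-1 = (xd a)^-1. Proof. exact: morph_inv (@xdM E) _. Qed.
Lemma xact1 x : (1 : X1 E) ◃ x = 1.
Proof. exact: (morph_one (f := xact^~ x) (fun a b => xactM a b x)). Qed.
Lemma xactV a x : a^-1 ◃ x = (a ◃ x)^-1.
Proof. exact: (morph_inv (f := xact^~ x) (fun a b => xactM a b x)). Qed.
Lemma xactK a x : a ◃ x ◃ x^-1 = a.
Proof. by rewrite -xactA mulgV xact_1. Qed.
Lemma xactKV a x : a ◃ x^-1 ◃ x = a.
Proof. by rewrite -xactA mulVg xact_1. Qed.
Lemma xact_inj x : injective (fun a => a ◃ x).
Proof. by move=> a b /= e; rewrite -(xactK a x) e xactK. Qed.
End XModTheory.

(** * The extension of a crossed module by commuting elements *)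

Section Braided.
Variables (E : xmod) (B : Type) (e : B -> X0 E) (b : B -> B -> X1 E).
Hypothesis bd_b : forall X Y, xd (b X Y) = [~ e Y, e X].
Hypothesis b_sym : forall X Y, b X Y * b Y X = 1.
Hypothesis b_YB : forall X Y Z,
  b X Y * (b Z Y ◃ e X) * b Z X = (b Z X ◃ e Y) * b Z Y * (b X Y ◃ e Z).

(* A model over U is a group under E_1 with elements z_X, for X in U, which act
   on E_1 as e X does and which commute up to b.  When E carries no symmetry,
   such elements are not available in E_0 itself. *)
Record model (U : B -> Prop) := Model {
  mK : groupType;
  mk : X1 E -> mK;
  mz : B -> mK;
  mkM : {morph mk : x y / x * y};
  mk_act : forall c X, U X -> mk (c ◃ e X) = mk c ^ mz X;
  mz_comm : forall X Y, U X -> U Y -> X <> Y ->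
    mz Y * mz X = mz X * mz Y * mk (b X Y) }.

Definition msub (U V : B -> Prop) (UV : forall X, U X -> V X) (M : model V) :
    model U :=
  @Model U (mK M) (@mk V M) (mz M) (@mkM V M) (fun c X u => mk_act M c (UV X u))
    (fun X Y u v => @mz_comm V M X Y (UV X u) (UV Y v)).

Definition mgen U (M : model U) (g : B + X1 E) : mK M :=
  match g with inl X => mz M X | inr c => mk M c end.
Definition meval U (M : model U) := weval (mgen M).

Section Initial.
Variable U : B -> Prop.

Definition sublist (F : seq B) := forall X, List.In X F -> U X.

(* Imposing only the consequences of finitely many relations makes the
   injectivity of E_1 -> Q a statement about finite U, see model_inj. *)
Definition mrel (w w' : word0 (B + X1 E)) : Prop :=
  exists F, sublist F /\
    forall M : model (fun X => List.In X F), meval M w = meval M w'.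

Lemma mrel_all w w' :
  (forall F (M : model (fun X => List.In X F)), meval M w = meval M w') -> mrel w w'.
Proof. by move=> h; exists [::]; split=> [X []|M]; exact: h. Qed.

Lemma sublist_cat F F' : sublist F -> sublist F' -> sublist (F ++ F').
Proof. by move=> sF sF' X /(@List.in_app_or _ _ _ _) [/sF|/sF']. Qed.

Lemma meval_msub V V' (VV' : forall X, V X -> V' X) (M : model V') w :
  meval (msub VV' M) w = meval M w.
Proof. by elim: w => //= [v -> w ->|w ->]. Qed.

(** A model over the union of two finite lists restricts to each of them, so a consequence of two
    equations again rests on finitely many relations. *)
Lemma mrel2 (w1 w1' w2 w2' w w' : word0 (B + X1 E)) :
  (forall F (M : model (fun X => List.In X F)), meval M w1 = meval M w1' ->
     meval M w2 = meval M w2' -> meval M w = meval M w') ->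
  mrel w1 w1' -> mrel w2 w2' -> mrel w w'.
Proof.
move=> h [F [sF e1]] [F' [sF' e2]]; exists (F ++ F'); split.
  exact: sublist_cat.
move=> M; apply: h.
  have s X : List.In X F -> List.In X (F ++ F').
    by move=> i; apply: List.in_or_app; left.
  by move: (e1 (msub s M)); rewrite !meval_msub.
have s X : List.In X F' -> List.In X (F ++ F').
  by move=> i; apply: List.in_or_app; right.
by move: (e2 (msub s M)); rewrite !meval_msub.
Qed.

Definition mcong : wcong (B + X1 E).
Proof.
refine (@WCong _ mrel _ _ _ _ _ _ _ _ _ _).
- by move=> w; exact: mrel_all.
- by move=> w w' [F [sF h]]; exists F; split=> // M; rewrite h.
- by move=> w w' w''; apply: mrel2 => F M -> ->.
- by move=> v v' w w'; apply: mrel2 => F M /= -> ->.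
- by move=> w w' ww'; apply: (mrel2 _ ww' ww') => F M /= -> _.
- by move=> u v w; apply: mrel_all => F M /=; rewrite mulgA.
- by move=> w; apply: mrel_all => F M /=; rewrite mul1g.
- by move=> w; apply: mrel_all => F M /=; rewrite mulg1.
- by move=> w; apply: mrel_all => F M /=; rewrite mulVg.
- by move=> w; apply: mrel_all => F M /=; rewrite mulgV.
Defined.

Notation Qg := (wgrp mcong).
Definition qk (c : X1 E) : Qg := wcls mcong (W0gen (inr c)).
Definition qz (X : B) : Qg := wcls mcong (W0gen (inl X)).

Lemma qkM : {morph qk : x y / x * y}.
Proof.
by move=> x y; rewrite -wclsM; apply/wclsP; apply: mrel_all => F M /=; exact: mkM.
Qed.
Lemma qk_act c X : U X -> qk (c ◃ e X) = qk c ^ qz X.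
Proof.
move=> uX.
suff /wclsP : mcong (W0gen (inr (c ◃ e X)))
    (W0mul (W0inv (W0gen (inl X))) (W0mul (W0gen (inr c)) (W0gen (inl X)))).
  by rewrite !wclsM wclsV.
exists [:: X]; split=> [Y /= [<-|[]]//|M /=].
by apply: mk_act; left.
Qed.
Lemma qz_comm X Y : U X -> U Y -> X <> Y -> qz Y * qz X = qz X * qz Y * qk (b X Y).
Proof.
move=> uX uY XY.
suff /wclsP : mcong (W0mul (W0gen (inl Y)) (W0gen (inl X)))
    (W0mul (W0mul (W0gen (inl X)) (W0gen (inl Y))) (W0gen (inr (b X Y)))).
  by rewrite !wclsM.
exists [:: X; Y]; split=> [Z /= [<-|[<-|[]]]//|M /=].
by apply: mz_comm => //=; [left|right; left].
Qed.
Definition Qmodel : model U := Model qkM qk_act qz_comm.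

Lemma Qgrp_ind (P : Qg -> Prop) :
  (forall c, P (qk c)) -> (forall X, P (qz X)) ->
  (forall x y, P x -> P y -> P (x * y)) ->
  (forall x, P x -> P x^-1) -> forall x, P x.
Proof.
move=> Pk Pz PM PV; apply: wgrp_ind => [[X|c]|//|//|]; first exact: Pz.
  exact: Pk.
by have := Pk 1; rewrite (morph_one qkM).
Qed.

Variable M : model U.
Definition Qev (x : Qg) : mK M := meval M (wrep x).
Lemma Qev_cls w : Qev (wcls mcong w) = meval M w.
Proof.
have [F [sF h]] := wrep_cls mcong w.
by move: (h (msub sF M)); rewrite !meval_msub.
Qed.
Lemma QevM : {morph Qev : x y / x * y}.
Proof.
by move=> x y; rewrite -(wrepK x) -(wrepK y) -wclsM !Qev_cls.
Qed.
Lemma Qev_k c : Qev (qk c) = mk M c. Proof. by rewrite Qev_cls. Qed.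
Lemma Qev_z X : Qev (qz X) = mz M X. Proof. by rewrite Qev_cls. Qed.
End Initial.
Notation Qgrp U := (wgrp (mcong U)).

(** ** Twisting a model by an element *)

Section Twist.
Variables (U : B -> Prop) (M : model U) (t : X0 E) (y : B -> X1 E).
Hypothesis ty : forall X, e X ^ t = e X * xd (y X).
Hypothesis yb : forall X Y,
  b X Y * (y Y ◃ e X) * y X = (y X ◃ e Y) * y Y * (b X Y ◃ t).

(** Conjugation by [t] multiplies each [e X] by [xd (y X)]. Hence the letters [mz M X * mk M (y X)],
    with the map from [E_1] twisted by [t], satisfy the relations again; [yb] is the commutation
    relation after this substitution. *)
Definition twist : model U.
Proof.
refine (@Model U (mK M) (fun c => mk M (c ◃ t)) (fun X => mz M X * mk M (y X)) _ _ _).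
- by move=> c d; rewrite xactM mkM.
- move=> c X uX; rewrite conjgM -mk_act // -(morph_conj (@mkM U M)).
  by rewrite -xact_d -!xactA -ty -conjgC.
- move=> X Y uX uY XY; have kA := morph_conj (@mkM U M).
  rewrite -(mulgA (mz M Y)) (mulgA (mk M (y Y))) (conjgC (mk M (y Y))) -mk_act //.
  rewrite -!mulgA (mulgA (mz M Y)) mz_comm // -!mulgA; congr (_ * _).
  rewrite (mulgA (mk M (y X))) (conjgC (mk M (y X))) -mk_act //.
  by rewrite -!mulgA; congr (_ * _); rewrite -!mkM !mulgA yb.
Defined.
End Twist.

Lemma ty_gen Z X : e X ^ e Z = e X * xd (b Z X).
Proof. by rewrite bd_b /commg mulVKg. Qed.

(** Chosen so that the twist by [(e Z)^-1] undoes the twist by [e Z] on letters: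
    [bV Z X * (b Z X ◃ (e Z)^-1) = 1]. *)
Definition bV Z X := (b Z X)^-1 ◃ (e Z)^-1.
Lemma ty_inv Z X : e X ^ (e Z)^-1 = e X * xd (bV Z X).
Proof.
apply: (conjg_inj (e Z)); rewrite conjgKV /bV xd_act xdV conjMg conjgKV.
by rewrite ty_gen mulgK.
Qed.
Lemma yb_inv Z X Y :
  b X Y * (bV Z Y ◃ e X) * bV Z X = (bV Z X ◃ e Y) * bV Z Y * (b X Y ◃ (e Z)^-1).
Proof.
have h W W' : (bV Z W ◃ e W') ◃ e Z = ((b Z W)^-1 ◃ e W') ^ b Z W'.
  by rewrite /bV -!xactA -?mulgA -conjgE ty_gen xactA xact_d.
(* Acting by [e Z] removes the inverse action contained in [bV] and leaves [b_YB] up to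
   conjugation. *)
apply: (@xact_inj _ (e Z)); rewrite !xactM !h /bV !xactKV !xactV.
rewrite !conjVg /conjg !invgM !invgK !mulgA !mulgK.
by apply: (mulgI ((b Z X ◃ e Y) * b Z Y)); rewrite !mulgA -b_YB !gnorm.
Qed.

(** * Adjoining one letter *)

Section Extend.
Variables (F : seq B) (Z : B).
Hypothesis ZF : ~ List.In Z F.
Let U X := List.In X F.

(** Conjugation by the letter [Z], prescribed on a group which does not yet contain it; [b Z X]
    tells how far it moves [z X]. *)
Definition al (x : Qgrp U) : Qgrp U :=
  Qev (twist (Qmodel U) (ty_gen Z) (fun X Y => b_YB X Y Z)) x.
Definition al' (x : Qgrp U) : Qgrp U :=
  Qev (twist (Qmodel U) (ty_inv Z) (yb_inv Z)) x.

Lemma al_k c : al (qk U c) = qk U (c ◃ e Z). Proof. by rewrite /al Qev_k. Qed.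
Lemma al_z X : al (qz U X) = qz U X * qk U (b Z X). Proof. by rewrite /al Qev_z. Qed.
Lemma al'_k c : al' (qk U c) = qk U (c ◃ (e Z)^-1). Proof. by rewrite /al' Qev_k. Qed.
Lemma al'_z X : al' (qz U X) = qz U X * qk U (bV Z X). Proof. by rewrite /al' Qev_z. Qed.
Lemma alM : {morph al : x y / x * y}. Proof. by move=> x y; rewrite /al QevM. Qed.
Lemma al'M : {morph al' : x y / x * y}. Proof. by move=> x y; rewrite /al' QevM. Qed.

Lemma alK : cancel al al'.
Proof.
apply: Qgrp_ind => [c|X|x y hx hy|x hx].
- by rewrite al_k al'_k xactK.
- rewrite al_z al'M al'_z al'_k -mulgA -qkM /bV xactV mulVg.
  by rewrite (morph_one (qkM U)) mulg1.
- by rewrite alM al'M hx hy.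
- by rewrite (morph_inv alM) (morph_inv al'M) hx.
Qed.
Lemma al'K : cancel al' al.
Proof.
apply: Qgrp_ind => [c|X|x y hx hy|x hx].
- by rewrite al'_k al_k xactKV.
- rewrite al'_z alM al_z al_k -mulgA -qkM /bV xactKV mulgV.
  by rewrite (morph_one (qkM U)) mulg1.
- by rewrite al'M alM hx hy.
- by rewrite (morph_inv al'M) (morph_inv alM) hx.
Qed.

(* The new generator acts on the initial model of F by the inverse of al, so that
   conjugation by it restricts to al on left translations. *)
Definition ext_z (X : B) : bij (Qgrp U) :=
  if asbool (X = Z) then bij_of al'K alK else left_translation (qz U X).

Lemma ext_zZ : ext_z Z = bij_of al'K alK.
Proof. by rewrite /ext_z; case: asboolP. Qed.
Lemma ext_zF X : List.In X F -> ext_z X = left_translation (qz U X).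
Proof. by rewrite /ext_z; case: asboolP => // ->. Qed.

Lemma ltM (G : groupType) : {morph (@left_translation G) : x y / x * y}.
Proof. by move=> x y; apply: bij_inj => z; rewrite /= /bapp /= mulgA. Qed.

Lemma ltZ x : left_translation x * bij_of al'K alK =
  bij_of al'K alK * left_translation (al x).
Proof. by apply: bij_inj => y; rewrite /bapp /= al'M alK. Qed.

Lemma ext_act c X : List.In X (Z :: F) ->
  left_translation (qk U (c ◃ e X)) = left_translation (qk U c) ^ ext_z X.
Proof.
move=> /= [<-|XF]; first by rewrite ext_zZ /conjg ltZ mulKg al_k.
by rewrite ext_zF // qk_act // (morph_conj (@ltM _)).
Qed.
Lemma ext_comm X Y : List.In X (Z :: F) -> List.In Y (Z :: F) -> X <> Y ->
  ext_z Y * ext_z X = ext_z X * ext_z Y * left_translation (qk U (b X Y)).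
Proof.
move=> /= [<-|XF] [<-|YF] XY //.
- by rewrite ext_zZ (ext_zF YF) ltZ al_z ltM mulgA.
- rewrite ext_zZ (ext_zF XF) ltZ al_z ltM -!mulgA -!ltM -qkM.
  by rewrite b_sym (morph_one (qkM U)) mulg1.
- by rewrite !ext_zF // -!ltM qz_comm.
Qed.

Definition ext_model : model (fun X => List.In X (Z :: F)).
Proof.
refine (@Model _ (bij (Qgrp U)) (fun c => left_translation (qk U c)) ext_z _
  ext_act ext_comm).
by move=> c d; rewrite qkM ltM.
Defined.
End Extend.

(** A translation is determined by its value at 1, and the group on the remaining letters maps to
    the model given by induction, where [E_1] is already embedded. *)
Lemma model_inj (F : seq B) :
  exists M : model (fun X => List.In X F), injective (mk M).
Proof.
elim: F => [|Z F [M Minj]].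
  (* Over the empty list no relation involves the letters, so [E_1] itself is a model. *)
  exists (@Model (fun X => List.In X [::]) (X1 E) id (fun=> 1) (fun _ _ => erefl)
    (fun _ _ => False_ind _) (fun _ _ => False_ind _)).
  by [].
have [ZF|ZF] := pselect (List.In Z F).
  have s X : List.In X (Z :: F) -> List.In X F by case=> [<-|].
  by exists (msub s M).
exists (ext_model ZF) => c d /= /(congr1 (fun p => bapp p 1)).
rewrite /bapp /= !mulg1 => /(congr1 (Qev M)).
by rewrite !Qev_k => /Minj.
Qed.

Notation T := (fun=> True).
Definition QB := Qgrp T.
Notation κ := (qk T).

(** An equality in [Q] rests on a finite list of letters, over which some model separates the
    elements of [E_1]. *)
Lemma qk_inj : injective κ.
Proof.
move=> c d /wclsP [F [_ h]]; have [M Minj] := model_inj F.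
by apply: Minj; exact: (h M).
Qed.

Definition Emodel : model T.
Proof.
refine (@Model _ (X0 E) xd e (@xdM E) _ _).
  by move=> c X _; rewrite xd_act.
by move=> X Y _ _ _; rewrite bd_b -commgC.
Defined.
Definition qq : QB -> X0 E := Qev Emodel.
Lemma qqM : {morph qq : x y / x * y}. Proof. by move=> x y; rewrite /qq QevM. Qed.
Lemma qq_k c : qq (κ c) = xd c. Proof. by rewrite /qq Qev_k. Qed.
Lemma qq_z X : qq (qz T X) = e X. Proof. by rewrite /qq Qev_z. Qed.

Lemma qk_conj c (u : QB) : κ (c ◃ qq u) = κ c ^ u.
Proof.
move: u c; apply: Qgrp_ind => [d|X|x y hx hy|x hx] c.
- by rewrite qq_k xact_d (morph_conj (qkM T)).
- by rewrite qq_z qk_act.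
- by rewrite qqM xactA hy hx conjgM.
- by rewrite (morph_inv qqM); apply: (conjg_inj x); rewrite -hx xactKV conjgKV.
Qed.
End Braided.

(** * The monoidal groupoid of a crossed module *)

Section XGamma.
Variable E : xmod.

Definition xhom (x y : X0 E) : Type := {c : X1 E | x = y * xd c}.

Lemma xeq_subproof (x y : X0 E) : x = y -> x = y * xd 1.
Proof. by move=> ->; rewrite xd1 mulg1. Qed.
Definition xeq (x y : X0 E) (p : x = y) : xhom x y := exist _ 1 (xeq_subproof p).
Lemma xcomp_subproof (x y t : X0 E) (g : xhom y t) (f : xhom x y) :
  x = t * xd (sval g * sval f).
Proof. by rewrite xdM mulgA -(proj2_sig g); exact: (proj2_sig f). Qed.
Lemma xtens_subproof (x x' y y' : X0 E) (f : xhom x x') (g : xhom y y') :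
  x * y = x' * y' * xd ((sval f ◃ y') * sval g).
Proof.
rewrite {1}(proj2_sig f) {1}(proj2_sig g).
by rewrite xdM xd_act conjgE -!mulgA mulVKg.
Qed.

Definition xcat : category.
Proof.
refine (@Category (X0 E) xhom (fun x => xeq (erefl x))
  (fun x y t g f => exist _ (sval g * sval f) (xcomp_subproof g f)) _ _ _).
- by move=> x y f; apply: sig_prop_inj; exact: mul1g.
- by move=> x y f; apply: sig_prop_inj; exact: mulg1.
- by move=> x y t w h g f; apply: sig_prop_inj; exact: mulgA.
Defined.

Lemma xcat_iso (x y : xcat) (f : hom x y) : is_iso f.
Proof.
have gP : y = x * xd (sval f)^-1.
  by rewrite xdV {1}(proj2_sig f) mulgK.
exists (exist _ (sval f)^-1 gP : @hom xcat y x).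
by split; apply: sig_prop_inj; [exact: mulVg | exact: mulgV].
Qed.

Definition xmonoidal : monoidal.
Proof.
refine (@Monoidal xcat (fun x y : X0 E => x * y)
  (fun x y x' y' f g => exist _ ((sval f ◃ y') * sval g) (xtens_subproof f g))
  (1 : X0 E) _ _ (fun x y t => xeq (mulgA x y t)) (fun x => xeq (mul1g x))
  (fun x => xeq (mulg1 x)) _ _ _ _ _ _ _ _).
- by move=> x y; apply: sig_prop_inj; rewrite /= xact1 mulg1.
- move=> x y x' y' x'' y'' f' g' f g; apply: sig_prop_inj => /=.
  have -> : sval f ◃ y' = sval f ◃ (y'' * xd (sval g')).
    by congr (_ ◃ _); exact: (proj2_sig g').
  rewrite xactM xactA xact_d conjgE -!mulgA; congr (_ * _).
  by rewrite mulVKg.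
- by move=> *; exact: xcat_iso.
- by move=> *; exact: xcat_iso.
- by move=> *; exact: xcat_iso.
- move=> x y t x' y' t' f g h; apply: sig_prop_inj => /=.
  by rewrite mul1g mulg1 xactM xactA mulgA.
- by move=> x y f; apply: sig_prop_inj; rewrite /= xact1 !mul1g mulg1.
- by move=> x y f; apply: sig_prop_inj; rewrite /= xact_1 !mul1g !mulg1.
- by move=> *; apply: sig_prop_inj; rewrite /= ?xact1 ?xact_1 ?mul1g ?mulg1.
- by move=> *; apply: sig_prop_inj; rewrite /= ?xact1 ?xact_1 ?mul1g ?mulg1.
Defined.
End XGamma.

(** * Subgroups as groups in their own right *)

Section Subgroup.
Variables (G : groupType) (P : G -> Prop).
Hypothesis P1 : P 1.
Hypothesis PM : forall x y, P x -> P y -> P (x * y).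
Hypothesis PV : forall x, P x -> P x^-1.

(** The closure proofs are parameters of the type, so that the group structure can be found from the
    type alone. *)
Definition sgrp of P 1 & (forall x y, P x -> P y -> P (x * y))
  & (forall x, P x -> P x^-1) : Type := {x | P x}.
Notation sg := (sgrp P1 PM PV).
HB.instance Definition _ := gen_eqMixin sg.
HB.instance Definition _ := gen_choiceMixin sg.
Definition sg_mul (x y : sg) : sg := exist _ _ (PM (proj2_sig x) (proj2_sig y)).
Definition sg_inv (x : sg) : sg := exist _ _ (PV (proj2_sig x)).
Definition sg_one : sg := exist _ _ P1.
Lemma sg_mulA : associative sg_mul.
Proof. by move=> x y z; apply: sig_prop_inj; exact: mulgA. Qed.
Lemma sg_mul1l : left_id sg_one sg_mul.
Proof. by move=> x; apply: sig_prop_inj; exact: mul1g. Qed.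
Lemma sg_mul1r : right_id sg_one sg_mul.
Proof. by move=> x; apply: sig_prop_inj; exact: mulg1. Qed.
Lemma sg_mulVl : left_inverse sg_one sg_inv sg_mul.
Proof. by move=> x; apply: sig_prop_inj; exact: mulVg. Qed.
Lemma sg_mulVr : right_inverse sg_one sg_inv sg_mul.
Proof. by move=> x; apply: sig_prop_inj; exact: mulgV. Qed.
HB.instance Definition _ :=
  isGroup.Build sg sg_mulA sg_mul1l sg_mul1r sg_mulVl sg_mulVr.
End Subgroup.

(** * Settings with well-behaved coproducts *)

(* In coh_cop_tri the three staircases have the bases X -> Y -> Y ⊕ Z,
   X -> X ⊕ Z -> Y ⊕ Z and Z -> X ⊕ Z -> Y ⊕ Z. *)
Record coherent (S : setting) : Prop := Coherent {
  coh_zero : exists D0 : stri (szero S) (szero S) (szero S),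
    [/\ striL D0,
        forall (X : seqv S) (D : stri X X (szero S)), striL D -> sstair D D D D0
      & forall (X : seqv S) (D : stri (szero S) X X), striR D -> sstair D0 D D D];
  coh_cop : forall X Y : seqv S, exists T (D1 : stri X T Y) (D2 : stri Y T X),
    scop D1 D2;
  coh_copC : forall (X Y T : seqv S) (D1 : stri X T Y) (D2 : stri Y T X),
    scop D1 D2 -> scop D2 D1;
  coh_cop_uniq : forall (X Y T T' : seqv S) (D1 : stri X T Y) (D2 : stri Y T X)
    (D1' : stri X T' Y) (D2' : stri Y T' X), scop D1 D2 -> scop D1' D2' ->
    exists t : hom T T',
      striE D1 D1' (idm X) t (idm Y) /\ striE D2 D2' (idm Y) t (idm X);
  coh_cop_mor : forall (X X' Z : seqv S) (f : hom X X'),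
    exists T T' (D1 : stri X T Z) (D2 : stri Z T X) (D1' : stri X' T' Z)
      (D2' : stri Z T' X') (t : hom T T'),
    [/\ scop D1 D2, scop D1' D2', striE D1 D1' f t (idm Z)
      & striE D2 D2' (idm Z) t f];
  coh_cop_tri : forall (X Y C Z : seqv S) (D : stri X Y C),
    exists XZ YZ CZ (DX1 : stri X XZ Z) (DX2 : stri Z XZ X)
      (DY1 : stri Y YZ Z) (DY2 : stri Z YZ Y) (DC1 : stri C CZ Z)
      (DC2 : stri Z CZ C) (D' : stri X YZ CZ) (D'' : stri XZ YZ C),
    [/\ scop DX1 DX2, scop DY1 DY2, scop DC1 DC2
      & [/\ sstair D DY1 D' DC1, sstair DX1 D'' D' DC2
          & sstair DX2 D'' DY2 D]] }.

(** * Determinant functors with values in a crossed module *)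

(** The last three fields are normalizations matching the relations on the zero object and on
    identity triangles in the presentation; [transport] arranges them by its choice of lift for the
    zero object. *)
Record sdet (S : setting) (E : xmod) := SDet {
  so : seqv S -> X0 E;
  sm : forall X X' : seqv S, hom X X' -> X1 E;
  st : forall X Y C : seqv S, stri X Y C -> X1 E;
  sm_bd : forall (X X' : seqv S) (h : hom X X'), so X = so X' * xd (sm h);
  st_bd : forall (X Y C : seqv S) (D : stri X Y C), so C * so X = so Y * xd (st D);
  sm_id : forall X : seqv S, sm (idm X) = 1;
  sm_comp : forall (X Y Z : seqv S) (g : hom Y Z) (f : hom X Y),
    sm (g ∘ f) = sm g * sm f;
  st_E : forall (X Y C X' Y' C' : seqv S) (D : stri X Y C) (D' : stri X' Y' C')
    (a : hom X X') (b : hom Y Y') (c : hom C C'), striE D D' a b c ->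
    st D' * ((sm c ◃ so X') * sm a) = sm b * st D;
  st_stair : forall (X Y Z Cf Cg Cgf : seqv S) (Df : stri X Y Cf)
    (Dg : stri Y Z Cg) (Dgf : stri X Z Cgf) (Dt : stri Cf Cgf Cg),
    sstair Df Dg Dgf Dt -> st Dg * st Df = st Dgf * (st Dt ◃ so X);
  so_zero : so (szero S) = 1;
  st_L : forall (X : seqv S) (D : stri X X (szero S)), striL D -> st D = 1;
  st_R : forall (X : seqv S) (D : stri (szero S) X X), striR D -> st D = 1 }.

Section Core.
Variables (S : setting) (coh : coherent S) (E : xmod) (d : sdet S E).
Notation B := (seqv S).
Notation e := (so d).
Notation δm := (sm d).
Notation δ := (st d).

Lemma cop_exists (X Y : B) : exists c : {T : B & (stri X T Y * stri Y T X)%type},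
  scop (projT2 c).1 (projT2 c).2.
Proof.
by have [T [D1 [D2 h]]] := coh_cop coh X Y; exists (existT _ T (D1, D2)).
Qed.

(** The isomorphism between two coproducts is the identity on [X] and [Y], so it multiplies [δ D1]
    and [δ D2] on the left by the same factor, which cancels in the quotient. *)
Lemma cb_exists : exists f : B -> B -> X1 E,
  forall X Y T (D1 : stri X T Y) (D2 : stri Y T X), scop D1 D2 ->
    f X Y = (δ D2)^-1 * δ D1.
Proof.
exists (fun X Y => let c := projT2 (sval (cid (cop_exists X Y))) in
  (δ c.2)^-1 * δ c.1) => X Y T D1 D2 s.
case: (cid _) => [[T' [D1' D2']] /= s'].
have [t [/(st_E d) + /(st_E d)]] := coh_cop_uniq coh s' s.
rewrite !sm_id !xact1 !mulg1 => -> ->.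
by rewrite invgM !mulgA mulgVK.
Qed.

Definition cb : B -> B -> X1 E := sval (cid cb_exists).

Lemma cbE X Y T (D1 : stri X T Y) (D2 : stri Y T X) : scop D1 D2 ->
  cb X Y = (δ D2)^-1 * δ D1.
Proof. exact: (proj2_sig (cid cb_exists)). Qed.

Lemma cb_bd X Y : xd (cb X Y) = [~ e Y, e X].
Proof.
have [T [D1 [D2 s]]] := coh_cop coh X Y; rewrite (cbE s) xdM xdV.
rewrite -[xd (δ D1)](mulKg (e T)) -st_bd -[xd (δ D2)](mulKg (e T)) -st_bd.
by rewrite invgM invgK -mulgA mulVKg invgM -!mulgA.
Qed.

Lemma cb_sym X Y : cb X Y * cb Y X = 1.
Proof.
have [T [D1 [D2 s]]] := coh_cop coh X Y.
by rewrite (cbE s) (cbE (coh_copC coh s)) mulgA mulgK mulVg.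
Qed.

(** Naturality of [cb] in triangles: the values [δ D'] and [δ D''] on the sums with [Z] are
    eliminated from the three staircase equations. *)
Lemma cb_tri X Y C (D : stri X Y C) Z :
  δ D * (cb Z C ◃ e X) * cb Z X = cb Z Y * (δ D ◃ e Z).
Proof.
have [XZ [YZ [CZ [X1 [X2 [Y1 [Y2 [C1 [C2 [D' [D'' [sX sY sC [s1 s2 s3]]]]]]]]]]]]] :=
  coh_cop_tri coh Z D.
move: (st_stair d s1) (st_stair d s2) (st_stair d s3) => h1 h2 h3.
rewrite (cbE (coh_copC coh sX)) (cbE (coh_copC coh sY)) (cbE (coh_copC coh sC)).
rewrite xactM xactV -[RHS]mulgA -h3.
have -> : δ D = (δ Y1)^-1 * δ D' * (δ C1 ◃ e X).
  by rewrite -mulgA -h1 mulKg.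
have -> : δ D'' = δ D' * (δ C2 ◃ e X) * (δ X1)^-1 by rewrite -h2 mulgK.
by rewrite !mulgA !mulgK.
Qed.

Lemma cb_mor X X' (f : hom X X') Z : cb Z X' * (δm f ◃ e Z) = δm f * cb Z X.
Proof.
have [T [T' [D1 [D2 [D1' [D2' [t [s s' /(st_E d) h1 /(st_E d) h2]]]]]]]] :=
  coh_cop_mor coh Z f.
move: h1 h2; rewrite !sm_id xact1 mul1g mulg1 => h1 h2.
rewrite (cbE (coh_copC coh s)) (cbE (coh_copC coh s')) -mulgA h2.
by rewrite -[δm f](mulKg (δ D1')) h1 !mulgA mulgK.
Qed.

(** The two split triangles on [X ⊕ Y] have the same middle object [T], so [cb Z T] cancels between
    the two instances of [cb_tri]. *)
Lemma cb_YB X Y Z :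
  cb X Y * (cb Z Y ◃ e X) * cb Z X = (cb Z X ◃ e Y) * cb Z Y * (cb X Y ◃ e Z).
Proof.
have [T [D1 [D2 s]]] := coh_cop coh X Y.
have h1 := cb_tri D1 Z; have h2 := cb_tri D2 Z.
rewrite (cbE s) xactM xactV; apply: (mulgI (δ D2)).
rewrite !mulgA mulgV mul1g h1; apply: (mulIg (δ D1 ◃ e Z)^-1).
by rewrite h2 !mulgK.
Qed.

Lemma cb_zero Z : cb Z (szero S) = 1.
Proof.
have [D0 [L0 _ _]] := coh_zero coh; have := cb_tri D0 Z.
by rewrite (st_L d L0) so_zero xact_1 xact1 mul1g mulg1 => /(canRL (mulgK _)); rewrite mulgV.
Qed.
Lemma cb_zerol Z : cb (szero S) Z = 1.
Proof. by have := cb_sym (szero S) Z; rewrite cb_zero mulg1. Qed.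

(** Since [[e X, e X] = 1], the element [cb X X] is central, and the Yang-Baxter identity for
    [X, X, Y] reduces to its invariance. *)
Lemma cb_self_inv X Y : cb X X ◃ e Y = cb X X.
Proof.
have dd : xd (cb X X) = 1 by rewrite cb_bd commgg.
have c a : commute (cb X X) a.
  by have := xact_d a (cb X X); rewrite dd xact_1 => /esym/conjg_fixP/commgP/commute_sym.
have := cb_YB X X Y; rewrite -mulgA c => /mulgI h.
by rewrite -h.
Qed.

Notation Q := (QB e cb).
Notation κ := (qk e cb (fun=> True)).
Notation z := (qz e cb (fun=> True)).
Notation q := (qq cb_bd).

Lemma κM : {morph κ : x y / x * y}. Proof. exact: qkM. Qed.
Lemma κ1 : κ 1 = 1. Proof. exact: morph_one κM. Qed.
Lemma κV c : κ c^-1 = (κ c)^-1. Proof. exact: morph_inv κM _. Qed.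
Lemma κ_inj : injective κ. Proof. exact: qk_inj cb_bd cb_sym cb_YB. Qed.
Lemma κJ c (u : Q) : κ (c ◃ q u) = κ c ^ u. Proof. exact: qk_conj. Qed.
Lemma qM : {morph q : u v / u * v}. Proof. exact: qqM. Qed.
Lemma q1 : q 1 = 1. Proof. exact: morph_one qM. Qed.
Lemma qV u : q u^-1 = (q u)^-1. Proof. exact: morph_inv qM _. Qed.

(** ** The bimultiplicative form *)

Definition central (u : Q) := forall v : Q, commute u v.
Lemma central1 : central 1. Proof. by move=> v; rewrite /commute mul1g mulg1. Qed.
Lemma centralM u v : central u -> central v -> central (u * v).
Proof. by move=> cu cv w; apply/commute_sym/commuteM; apply: commute_sym. Qed.
Lemma centralV u : central u -> central u^-1.
Proof. by move=> cu w; apply/commute_sym/commuteV/commute_sym. Qed.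

Section CentralMap.
Variables (φ : B -> Q) (φc : forall X, central (φ X)).
(** Central elements commute, so arbitrary central values on the letters, with [E_1] sent to 1,
    respect all relations. Applying this once in each variable gives the form [eps]. *)
Definition cmodel : model e cb (fun=> True).
Proof.
refine (@Model _ _ _ _ _ Q (fun=> 1) φ _ _ _).
- by move=> ? ?; rewrite mulg1.
- by move=> c X _; rewrite conj1g.
- by move=> X Y _ _ _; rewrite mulg1 φc.
Defined.
Definition cext : Q -> Q := Qev cmodel.
Lemma cextM : {morph cext : u v / u * v}.
Proof. by move=> u v; rewrite /cext QevM. Qed.
Lemma cext_κ c : cext (κ c) = 1. Proof. by rewrite /cext Qev_k. Qed.
Lemma cext_z X : cext (z X) = φ X. Proof. by rewrite /cext Qev_z. Qed.
Lemma cext_ind (P : Q -> Prop) : P 1 -> (forall X, P (φ X)) ->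
  (forall u v, P u -> P v -> P (u * v)) -> (forall u, P u -> P u^-1) ->
  forall u, P (cext u).
Proof.
move=> P1 Pφ PM PV; apply: Qgrp_ind => [c|X|u v pu pv|u pu].
- by rewrite cext_κ.
- by rewrite cext_z.
- by rewrite cextM; exact: PM.
- by rewrite (morph_inv cextM); exact: PV.
Qed.
Lemma cext_central u : central (cext u).
Proof.
move: u; apply: cext_ind => //; first exact: central1.
  exact: centralM.
exact: centralV.
Qed.
End CentralMap.

Lemma cext_ext φ φ' (c : forall X, central (φ X)) (c' : forall X, central (φ' X)) :
  φ =1 φ' -> cext c =1 cext c'.
Proof.
move=> h; apply: Qgrp_ind => [a|X|u v hu hv|u hu].
- by rewrite !cext_κ.
- by rewrite !cext_z.
- by rewrite !cextM hu hv.
- by rewrite !(morph_inv (cextM _)) hu.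
Qed.

Lemma cext_mul φ φ' φ'' (c : forall X, central (φ X)) (c' : forall X, central (φ' X))
    (c'' : forall X, central (φ'' X)) :
  (forall X, φ'' X = φ X * φ' X) -> forall u, cext c'' u = cext c u * cext c' u.
Proof.
move=> h; apply: Qgrp_ind => [a|X|u v hu hv|u hu].
- by rewrite !cext_κ mulg1.
- by rewrite !cext_z h.
- rewrite !cextM hu hv -!mulgA; congr (_ * _); rewrite !mulgA; congr (_ * _).
  exact: cext_central.
- rewrite !(morph_inv (cextM _)) hu invgM; apply: centralV; exact: cext_central.
Qed.

Definition sgn (X Y : B) : Q := if asbool (X = Y) then κ (cb X X) else 1.
Lemma sgn_central X Y : central (sgn X Y).
Proof.
rewrite /sgn; case: asboolP => _; last exact: central1.
suff h u : κ (cb X X) ^ u = κ (cb X X).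
  by move=> u; apply/commgP/conjg_fixP.
rewrite -κJ; congr κ; move: u; apply: Qgrp_ind => [c|Y'|u v hu hv|u hu].
- have dd : xd (cb X X) = 1 by rewrite cb_bd commgg.
  rewrite qq_k xact_d; apply/conjg_fixP/commgP.
  apply/commute_sym/commgP/conjg_fixP.
  by rewrite -xact_d dd xact_1.
- by rewrite qq_z cb_self_inv.
- by rewrite qM xactA hu hv.
- by rewrite qV; apply: (@xact_inj _ (q u)); rewrite xactKV hu.
Qed.
Lemma sgn_sym X Y : sgn X Y = sgn Y X.
Proof. by rewrite /sgn; case: asboolP => [->//|n]; case: asboolP => // e; case: n. Qed.
Lemma sgn_sq X Y : sgn X Y * sgn X Y = 1.
Proof.
rewrite /sgn; case: asboolP => _; last exact: mulg1.
by rewrite -κM cb_sym κ1.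
Qed.
Lemma sgn_κ X Y : exists c, sgn X Y = κ c /\ xd c = 1.
Proof.
rewrite /sgn; case: asboolP => _.
  by exists (cb X X); rewrite cb_bd commgg.
by exists 1; rewrite κ1 xd1.
Qed.

(* In a stable quadratic module <X, X> must be b(X, X), an element of order two,
   whereas [z X, z X] = 1: the form eps with eps(z X, z X) = b(X, X) corrects
   the commutator of Q. *)
Definition cnt (X : B) : Q -> Q := cext (sgn_central X).
Lemma cnt_central u : forall X, central (cnt X u).
Proof. by move=> X; exact: cext_central. Qed.
Definition eps (u v : Q) : Q := cext (cnt_central u) v.

Lemma eps_central u v : central (eps u v). Proof. exact: cext_central. Qed.
Lemma epsMr u v w : eps u (v * w) = eps u v * eps u w.
Proof. exact: cextM. Qed.
Lemma epsMl u v w : eps (u * v) w = eps u w * eps v w.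
Proof. by apply: cext_mul => X; exact: cextM. Qed.
Lemma eps_κ u c : eps u (κ c) = 1. Proof. exact: cext_κ. Qed.
Lemma eps_zz X Y : eps (z X) (z Y) = sgn X Y.
Proof. by rewrite /eps cext_z /cnt cext_z sgn_sym. Qed.
Lemma eps_sym u v : eps u v = eps v u.
Proof.
have zs X w : eps (z X) w = eps w (z X).
  rewrite [RHS]cext_z; apply: cext_ext => Y.
  by rewrite /cnt cext_z sgn_sym.
have κs c w : eps (κ c) w = 1.
  apply: (@cext_ind _ _ (fun x => x = 1)) => [//|X|x y -> ->|x ->].
  - exact: cext_κ.
  - exact: mulg1.
  - exact: invg1.
have V1 u' v' : eps u'^-1 v' = (eps u' v')^-1.
  exact: (morph_inv (f := eps^~ v') (fun x y => epsMl x y v')).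
move: v; apply: Qgrp_ind => [c|X|v v' h h'|v h].
- by rewrite eps_κ κs.
- by rewrite zs.
- by rewrite epsMr epsMl h h'.
- by rewrite V1 -h (morph_inv (epsMr u)).
Qed.
Lemma eps_sq u v : eps u v * eps u v = 1.
Proof.
pose P x := central x /\ x * x = 1.
have PM x y : P x -> P y -> P (x * y).
  move=> [cx xx] [cy yy]; split; first exact: centralM.
  by rewrite {2}(cx y) mulgA -(mulgA x) yy mulg1 xx.
have PV x : P x -> P x^-1.
  by move=> [cx xx]; split; [exact: centralV | rewrite -invgM xx invg1].
have P1 : P 1 by split; [exact: central1 | exact: mulg1].
suff [] : P (eps u v) by [].
apply: cext_ind => // X; apply: cext_ind => // Y.
by split; [exact: sgn_central | exact: sgn_sq].
Qed.
Lemma eps_inκ u v : exists c, eps u v = κ c /\ xd c = 1.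
Proof.
pose P x := exists c, x = κ c /\ xd c = 1.
have PM x y : P x -> P y -> P (x * y).
  by move=> [c [-> c1]] [c' [-> c1']]; exists (c * c'); rewrite κM xdM c1 c1' mulg1.
have PV x : P x -> P x^-1.
  by move=> [c [-> c1]]; exists c^-1; rewrite κV xdV c1 invg1.
have P1 : P 1 by exists 1; rewrite κ1 xd1.
suff : P (eps u v) by [].
by apply: cext_ind => // X; apply: cext_ind => // Y; exact: sgn_κ.
Qed.

(** ** The abelian quotient *)

(** [Q / E_1] is a coarser congruence on the words which define [Q], so that a representative word
    of a class yields the set-theoretic section [lift]. *)
Definition arel (w w' : word0 (B + X1 E)) : Prop :=
  exists c, wcls (mcong e cb (fun=> True)) w = wcls _ w' * κ c.

Lemma κ_norm c (u : Q) : κ c * u = u * κ (c ◃ q u).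
Proof. by rewrite κJ conjgC. Qed.

Lemma arel_eq w w' : wcls (mcong e cb (fun=> True)) w = wcls _ w' -> arel w w'.
Proof. by rewrite /arel => ->; exists 1; rewrite κ1 mulg1. Qed.

Definition acong : wcong (B + X1 E).
Proof.
refine (@WCong _ arel _ _ _ _ _ _ _ _ _ _).
- by move=> w; exact: arel_eq.
- by move=> w w' [c h]; exists c^-1; rewrite h -mulgA -κM mulgV κ1 mulg1.
- by move=> w w' w'' [c h] [c' h']; exists (c' * c); rewrite h h' -mulgA κM.
- move=> v v' w w' [c hv] [c' hw]; rewrite /arel !wclsM hv hw.
  exists ((c ◃ q (wcls _ w')) * c').
  by rewrite κM -!mulgA; congr (_ * _); rewrite !mulgA κ_norm.
- move=> w w' [c h]; rewrite /arel !wclsV h.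
  exists (c^-1 ◃ q (wcls _ w')^-1).
  by rewrite -κ_norm κV invgM.
- by move=> *; apply: arel_eq; apply/wclsP; exact: wrel_A.
- by move=> *; apply: arel_eq; apply/wclsP; exact: wrel_1l.
- by move=> *; apply: arel_eq; apply/wclsP; exact: wrel_1r.
- by move=> *; apply: arel_eq; apply/wclsP; exact: wrel_Vl.
- by move=> *; apply: arel_eq; apply/wclsP; exact: wrel_Vr.
Defined.
Notation A := (wgrp acong).

Definition bar (u : Q) : A := wcls acong (wrep u).
Definition lift (x : A) : Q := wcls _ (wrep x).
Lemma barP u v : bar u = bar v <-> exists c, u = v * κ c.
Proof.
by rewrite /bar wclsP; split=> -[c h]; exists c; move: h; rewrite !wrepK.
Qed.
Lemma liftK x : bar (lift x) = x.
Proof.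
rewrite -[RHS]wrepK; apply/wclsP; exists 1.
by rewrite wrepK κ1 mulg1.
Qed.
Lemma barM : {morph bar : u v / u * v}.
Proof.
move=> u v; rewrite /bar -wclsM; apply/wclsP; exists 1.
by rewrite wclsM !wrepK κ1 mulg1.
Qed.
Lemma bar1 : bar 1 = 1. Proof. exact: morph_one barM. Qed.
Lemma barV u : bar u^-1 = (bar u)^-1. Proof. exact: morph_inv barM _. Qed.
Lemma barκ c : bar (κ c) = 1.
Proof. by rewrite -bar1; apply/barP; exists c; rewrite mul1g. Qed.
Lemma bar_eps u v : bar (eps u v) = 1.
Proof. by have [c [-> _]] := eps_inκ u v; exact: barκ. Qed.

Lemma A_comm (x y : A) : commute x y.
Proof.
rewrite -(liftK x) -(liftK y); move: (lift x) (lift y) => {x y}.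
have cM (x u v : A) : commute x u -> commute x v -> commute x (u * v).
  exact: commuteM.
have key u v : commute (bar u) (bar v).
  move: u v; apply: Qgrp_ind => [c|X|u u' h h'|u h] v.
  - by rewrite barκ /commute mul1g mulg1.
  - move: v; apply: Qgrp_ind => [c|Y|v v' h h'|v h].
    + by rewrite barκ /commute mul1g mulg1.
    + have [->//|XY] := pselect (X = Y).
      apply/commute_sym; rewrite /commute -!barM (qz_comm _ _ I I XY).
      by rewrite barM barκ mulg1.
    + by rewrite barM; apply: commuteM.
    + by rewrite barV; apply: commuteV.
  - by rewrite barM; apply/commute_sym/commuteM; exact: commute_sym.
  - by rewrite barV; apply/commute_sym/commuteV/commute_sym.
exact: key.
Qed.

Lemma eps_lift u v : eps (lift (bar u)) (lift (bar v)) = eps u v.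
Proof.
have /barP [c ->] := liftK (bar u); have /barP [c' ->] := liftK (bar v).
by rewrite epsMl !epsMr !(eps_sym (κ c)) !eps_κ !mulg1.
Qed.

(** ** The stable quadratic module *)

(* J is the largest part of the kernel of Q -> E_0 on which conjugation by Q is
   given by eps; this is what makes J -> Q / E_1 a stable quadratic module. *)
Definition J (u : Q) := q u = 1 /\ forall v, [~ u, v] = eps v u.

Lemma J_conj u v : J u -> u ^ v = u * eps v u.
Proof. by move=> [_ h]; rewrite -h /commg mulVKg. Qed.
Lemma J_of u : q u = 1 -> (forall v, u ^ v = u * eps v u) -> J u.
Proof. by move=> qu h; split=> // v; rewrite /commg h mulKg. Qed.

Lemma J1 : J 1.
Proof.
apply: J_of => [|v]; first exact: q1.
by rewrite conj1g (morph_one (epsMr v)) mulg1.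
Qed.
Lemma JM u v : J u -> J v -> J (u * v).
Proof.
move=> Ju Jv; apply: J_of => [|w]; first by rewrite qM Ju.1 Jv.1 mulg1.
rewrite conjMg !J_conj // epsMr -!mulgA; congr (_ * _); rewrite !mulgA.
by rewrite (eps_central w u v).
Qed.
Lemma JV u : J u -> J u^-1.
Proof.
move=> Ju; apply: J_of => [|w]; first by rewrite qV Ju.1 invg1.
rewrite conjVg J_conj // (morph_inv (epsMr w)) invgM.
exact: (centralV (eps_central w u)).
Qed.
Lemma J_eps u v : J (eps u v).
Proof.
apply: J_of => [|w].
  by have [c [-> c1]] := eps_inκ u v; rewrite qq_k c1.
have -> : eps w (eps u v) = 1 by have [c [-> _]] := eps_inκ u v; exact: eps_κ.
by rewrite mulg1 /conjg (eps_central u v w) mulKg.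
Qed.
Notation Jg := (sgrp J1 JM JV).

Lemma κ_comm c u : q u = 1 -> commute (κ c) u.
Proof. by move=> qu; apply/commgP/conjg_fixP; rewrite -κJ qu xact_1. Qed.

(** The base is abelian, so a bracket must have trivial boundary, and it has because the values of
    [eps] come from [E_1]. The axiom on brackets of boundaries is the condition defining [J]. *)
Definition N : sqm.
Proof.
refine (@SQM A Jg (fun u => bar (sval u))
  (fun x y => exist _ (eps (lift x) (lift y)) (J_eps (lift x) (lift y))) _ _ _ _ _ _).
- by move=> u v; exact: barM.
- move=> x x' y; apply: sig_prop_inj => /=; rewrite -epsMl.
  have /barP [c ->] : bar (lift (x * x')) = bar (lift x * lift x').
    by rewrite barM !liftK.
  by rewrite (epsMl (lift x * lift x')) (eps_sym (κ c)) eps_κ mulg1.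
- move=> x y y'; apply: sig_prop_inj => /=; rewrite -epsMr.
  have /barP [c ->] : bar (lift (y * y')) = bar (lift y * lift y').
    by rewrite barM !liftK.
  by rewrite (epsMr _ (lift y * lift y')) eps_κ mulg1.
- by move=> x y; apply: sig_prop_inj; rewrite /= eps_sym eps_sq.
- by move=> x y /=; rewrite bar_eps; apply/esym/eqP/commgP; exact: A_comm.
- move=> [u Ju] [v Jv]; apply: sig_prop_inj => /=.
  rewrite eps_lift; exact: esym (Jv.2 u).
Defined.

(** ** The morphism from the universal module *)

(** The presentation imposes [[0] = 0], whereas the letter of the zero object need not be trivial in
    [Q]; it is replaced by 1, which has the same image in [E_0]. *)
Definition g (X : B) : Q := if asbool (X = szero S) then 1 else z X.
Lemma g0 : g (szero S) = 1.
Proof. by rewrite /g; case: asboolP. Qed.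
Lemma q_g X : q (g X) = e X.
Proof.
rewrite /g; case: asboolP => [->|_]; last exact: qq_z.
by rewrite q1 so_zero.
Qed.

Lemma z_g X : X <> szero S -> z X = g X.
Proof. by rewrite /g; case: asboolP. Qed.

(** For [Z = X] conjugation does nothing, and on the right [κ (cb X X)] cancels against
    [eps (z X) (z X)], which is the same element and squares to 1. *)
Lemma g_conj X Z : g X ^ z Z = g X * κ (cb Z X) * eps (z Z) (g X).
Proof.
rewrite /g; case: asboolP => [->|_].
  by rewrite conj1g cb_zero κ1 (morph_one (epsMr _)) !mulg1.
have [->|ZX] := pselect (Z = X).
  rewrite eps_zz /sgn; case: asboolP => // _.
  by rewrite conjgE mulKg -mulgA -κM cb_sym κ1 mulg1.
rewrite eps_zz /sgn; case: asboolP => // _; rewrite mulg1.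
by rewrite conjgE qz_comm // -mulgA mulKg.
Qed.

Lemma g_comm X Y : g Y * g X = g X * g Y * κ (cb X Y) * eps (g X) (g Y).
Proof.
have [->|n] := pselect (X = szero S); last first.
  by rewrite -(z_g n) conjgC g_conj !mulgA.
rewrite g0 cb_zerol κ1 (eps_sym 1) (morph_one (epsMr _)).
by rewrite !mulg1 mul1g.
Qed.

Definition tau (Z : B) (u : Q) : Q := u ^ z Z * eps (z Z) u.
Lemma tauM Z : {morph tau Z : u v / u * v}.
Proof.
move=> u v; rewrite /tau conjMg epsMr.
move: (u ^ z Z) (v ^ z Z) => u' v'; rewrite -!mulgA; congr (_ * _).
by rewrite !mulgA; congr (_ * _); exact: esym (eps_central (z Z) u _).
Qed.
Lemma tau_κ Z c : tau Z (κ c) = κ (c ◃ e Z).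
Proof. by rewrite /tau eps_κ mulg1 qk_act. Qed.
Lemma tau_g Z X : tau Z (g X) = g X * κ (cb Z X).
Proof. by rewrite /tau g_conj -mulgA eps_sq mulg1. Qed.

(* As tau Z is an endomorphism known on E_1 and on the g X, membership in J can be
   checked on defining equations. *)
Lemma J_gen u : q u = 1 -> (forall Z, tau Z u = u) -> J u.
Proof.
move=> qu h; apply: J_of => //; apply: Qgrp_ind => [c|X|v w hv hw|v hv].
- rewrite (eps_sym (κ c)) eps_κ mulg1.
  exact/conjg_fixP/commgP/commute_sym/κ_comm.
- by rewrite -{2}(h X) /tau -mulgA eps_sq mulg1.
- rewrite conjgM hv conjMg hw epsMl -mulgA; congr (_ * _).
  rewrite /conjg (eps_central v u w) mulKg.
  exact: (eps_central w u).
- apply: (conjg_inj v); rewrite conjgKV conjMg hv.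
  rewrite (eps_sym v^-1) (morph_inv (epsMr u)) conjgE.
  by rewrite ((centralV (eps_central u v)) v) mulKg eps_sym mulgK.
Qed.

(** The defect in [Q] of an equation which holds in [E_0]: [q] sends [g X] to [e X], and
    [e X = e X' * xd (δm h)]. Similarly for [jt] and triangles. *)
Definition jm X X' (h : hom X X') : Q := (g X')^-1 * g X * (κ (δm h))^-1.
Definition jt X Y C (D : stri X Y C) : Q := (g Y)^-1 * g C * g X * (κ (δ D))^-1.

Lemma jmE X X' (h : hom X X') : g X = g X' * jm h * κ (δm h).
Proof. by rewrite /jm !mulgA mulgV mul1g mulgVK. Qed.
Lemma jtE X Y C (D : stri X Y C) : g C * g X = g Y * jt D * κ (δ D).
Proof. by rewrite /jt !mulgA mulgV mul1g mulgVK. Qed.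

Lemma q_jm X X' (h : hom X X') : q (jm h) = 1.
Proof. by rewrite /jm !qM !qV qq_k !q_g (sm_bd d h) mulKg mulgV. Qed.
Lemma q_jt X Y C (D : stri X Y C) : q (jt D) = 1.
Proof. by rewrite /jt !qM !qV qq_k !q_g -(mulgA _ (e C)) (st_bd d D) mulKg mulgV. Qed.

(** Apply the endomorphism [tau Z] to the defining equation: it changes the known factors by values
    of [cb], and naturality makes these changes agree, so that the defect is fixed. The naturality
    is [cb_mor] here and [cb_tri] for triangles. *)
Lemma J_jm X X' (h : hom X X') : J (jm h).
Proof.
have E1 := jmE h; have qj := q_jm h; move: (jm h) E1 qj => j E1 qj.
apply: J_gen => // Z; have := congr1 (tau Z) E1.
rewrite 2!tauM !tau_g tau_κ E1; move: (tau Z j) => t.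
rewrite -!mulgA => /mulgI H.
apply: (mulIg (κ (δm h ◃ e Z))); apply: (mulgI (κ (cb Z X'))); rewrite -H.
by rewrite [RHS]mulgA (κ_comm _ qj) -mulgA -!κM cb_mor.
Qed.

Lemma J_jt X Y C (D : stri X Y C) : J (jt D).
Proof.
have E1 := jtE D; have qj := q_jt D; move: (jt D) E1 qj => j E1 qj.
apply: J_gen => // Z; have := congr1 (tau Z) E1.
rewrite 3!tauM !tau_g tau_κ; move: (tau Z j) => t.
rewrite -!mulgA (mulgA (κ _) (g X)) κ_norm q_g.
rewrite -!mulgA (mulgA (g C)) E1 -!mulgA => /mulgI H.
apply: (mulIg (κ (δ D ◃ e Z))); apply: (mulgI (κ (cb Z Y))); rewrite -H.
by rewrite [RHS]mulgA (κ_comm _ qj) -!mulgA -!κM -cb_tri !mulgA.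
Qed.

Definition Jm X X' (h : hom X X') : C1 N := exist _ (jm h) (J_jm h).
Definition Jt X Y C (D : stri X Y C) : C1 N := exist _ (jt D) (J_jt D).

Definition N0 (X : B) : C0 N := bar (g X).
Definition N1 (x : dgen S) : C1 N :=
  match x with GEqv _ _ h => Jm h | GTri _ _ _ D => Jt D end.

Lemma N_bd x : bd (N1 x) = eval0 (P := Dpres S) N0 (dbd x).
Proof.
case: x => [X X' h|X Y C D] /=.
  by rewrite /jm barM -κV barκ mulg1 barM barV.
by rewrite /jt barM -κV barκ mulg1 !barM barV.
Qed.

Lemma N_rel0 a b : drel0 (S := S) a b -> eval0 (P := Dpres S) N0 a = eval0 (P := Dpres S) N0 b.
Proof. by case=> /=; rewrite /N0 g0 bar1. Qed.

Lemma N_act (u : C1 N) X : sval (act u (N0 X)) = sval u ^ g X.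
Proof.
case: u => [u Ju]; rewrite /act /= J_conj //; congr (_ * _).
exact: eps_lift.
Qed.

Lemma jmM X Y Z (h : hom Y Z) (f : hom X Y) : jm (h ∘ f) = jm h * jm f.
Proof.
move: (jmE (h ∘ f)) (jmE f) (jmE h) (q_jm f).
move: (jm (h ∘ f)) (jm f) (jm h) => u v w; rewrite sm_comp κM => Eu Ev Ew qv.
apply: (mulgI (g Z)); apply: (mulIg (κ (δm h) * κ (δm f))).
rewrite -Eu Ev Ew -!mulgA; congr (_ * (_ * _)).
by rewrite !mulgA; congr (_ * _); exact: κ_comm.
Qed.

(** After multiplication by [g Y'] on the left and by [κ (δm b * δ D)] on the right, both sides
    become [g C * g X]. For a staircase the common value is [g Cg * (g Cf * g X)]. *)
Lemma jt_E X Y C X' Y' C' (D : stri X Y C) (D' : stri X' Y' C')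
    (a : hom X X') (b : hom Y Y') (c : hom C C') : striE D D' a b c ->
  jt D' * (jm a * jm c ^ g X) = jm b * jt D.
Proof.
move/(st_E d) => H; have qc : q (jm c ^ g X) = 1.
  by rewrite (morph_conj qM) q_jm conj1g.
move: (jtE D) (jtE D') (jmE a) (jmE b) (jmE c) qc (q_jm a) (q_jt D).
move: (jt D) (jt D') (jm a) (jm b) (jm c) => D1 D1' ja jb jc.
move=> ED ED' Ea Eb Ec qc qa qD.
apply: (mulgI (g Y')); apply: (mulIg (κ (δm b * δ D))).
have -> : g Y' * (jb * D1) * κ (δm b * δ D) = g C * g X.
  rewrite ED Eb κM -!mulgA; congr (_ * (_ * _)).
  by rewrite !mulgA (κ_comm _ qD).
move: (jc ^ g X) (conjgC jc (g X)) qc => w Ew qw.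
rewrite -H Ec -(mulgA _ (κ _) (g X)) κ_norm q_g -(mulgA (g C')) (mulgA jc).
rewrite Ew {1}Ea -!mulgA (mulgA (κ (δm a)) w) (κ_comm _ qw) -mulgA -κM.
rewrite (mulgA (g C')) ED' -!mulgA; congr (_ * (_ * _)).
rewrite (mulgA (κ _) ja) (κ_comm _ qa) -!mulgA; congr (_ * _).
rewrite (mulgA (κ _) w) (κ_comm _ qw) -!mulgA -!κM; congr (_ * κ (_ * _)).
by rewrite (sm_bd d a) xactA xact_d conjgE mulVKg.
Qed.

Lemma jt_stair X Y Z Cf Cg Cgf (Df : stri X Y Cf) (Dg : stri Y Z Cg)
    (Dgf : stri X Z Cgf) (Dt : stri Cf Cgf Cg) : sstair Df Dg Dgf Dt ->
  jt Dg * jt Df = jt Dgf * jt Dt ^ g X.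
Proof.
move/(st_stair d) => H; have qt : q (jt Dt ^ g X) = 1.
  by rewrite (morph_conj qM) q_jt conj1g.
move: (jtE Df) (jtE Dg) (jtE Dgf) (jtE Dt) (q_jt Df) qt.
move: (jt Df) (jt Dg) (jt Dgf) (jt Dt) => f' g' gf t Ef Eg Egf Et qf qt.
apply: (mulgI (g Z)); apply: (mulIg (κ (δ Dg * δ Df))).
rewrite {2}H !κM.
transitivity (g Cg * (g Cf * g X)).
  rewrite Ef 2!(mulgA (g Cg)) Eg -!mulgA; congr (_ * (_ * _)).
  by rewrite !mulgA (κ_comm _ qf).
move: (t ^ g X) (conjgC t (g X)) qt => w Ew qw.
rewrite mulgA Et -!mulgA (κ_norm _ (g X)) q_g (mulgA t) Ew -mulgA (mulgA (g Cgf)).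
rewrite Egf -!mulgA; congr (_ * (_ * _)).
by rewrite !mulgA (κ_comm _ qw).
Qed.

Lemma jt_cop X Y T (D1 : stri X T Y) (D2 : stri Y T X) : scop D1 D2 ->
  eps (g X) (g Y) = (jt D2)^-1 * jt D1.
Proof.
move=> s; move: (g_comm X Y) (eps_central (g X) (g Y)); rewrite (cbE s).
move: (jtE D1) (jtE D2) (q_jt D1) (q_jt D2).
move: (jt D1) (jt D2) (eps _ _) => u v x -> -> qu qv; rewrite κM κV => H cx.
apply: (mulgI (g T * v)); apply: (mulIg (κ (δ D1))).
by rewrite !mulgA mulgK H !mulgA mulgK -(mulgA _ x) cx mulgA.
Qed.

Lemma N_Wact (x : dgen S) X :
  eval1 (P := Dpres S) N0 N1 (Wact (W1gen x) (Wob X)) = act (N1 x) (N0 X).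
Proof. by rewrite /act N_bd. Qed.

Lemma N_rel1 s t : drel1 (S := S) s t ->
  eval1 (P := Dpres S) N0 N1 s = eval1 (P := Dpres S) N0 N1 t.
Proof.
case=> {s t}.
- move=> X; apply: sig_prop_inj => /=; apply: (mulgI (g X)).
  by apply: (mulIg (κ (δm (idm X)))); rewrite -jmE sm_id κ1 !mulg1.
- move=> X D sD; apply: sig_prop_inj => /=; apply: (mulgI (g X)).
  by apply: (mulIg (κ (δ D))); rewrite -jtE (st_L d sD) g0 κ1 !mulg1 mul1g.
- move=> X D sD; apply: sig_prop_inj => /=; apply: (mulgI (g X)).
  by apply: (mulIg (κ (δ D))); rewrite -jtE (st_R d sD) g0 κ1 !mulg1.
- by move=> X Y Z h f; apply: sig_prop_inj; exact: jmM.
- move=> X Y C X' Y' C' D D' a b c sE; apply: sig_prop_inj.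
  transitivity (jm a * jm c ^ g X); last first.
    by rewrite (canRL (mulKg _) (jt_E sE)) mulgA.
  by rewrite -(N_act (Jm c)) -(N_Wact (GEqv c)).
- move=> X Y Z Cf Cg Cgf Df Dg Dgf Dt s; apply: sig_prop_inj.
  transitivity (jt Dgf * jt Dt ^ g X); first exact: jt_stair.
  by rewrite -(N_act (Jt Dt)) -(N_Wact (GTri Dt)).
- move=> X Y T D1 D2 s; apply: sig_prop_inj; rewrite /= -(jt_cop s).
  exact: eps_lift.
Qed.
(** ** The induced tensor functor *)

Lemma N_hom_exists : exists h : sqm_hom (Dmod S) N,
  [/\ forall X, sh0 h (Dob X) = bar (g X),
      forall X X' (a : @hom B X X'), sval (sh1 h (Deqv a)) = jm a
    & forall X Y C (D : stri X Y C), sval (sh1 h (Dtri D)) = jt D].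
Proof.
have [h [h0 h1 _]] := presented_universal (P := Dpres S) N_bd N_rel0 N_rel1.
exists h; split=> [X|X X' a|X Y C D]; first exact: h0.
  by rewrite (h1 (GEqv a)).
by rewrite (h1 (GTri D)).
Qed.

Definition Nh : sqm_hom (Dmod S) N := sval (cid N_hom_exists).
Lemma Nh_ob X : sh0 Nh (Dob X) = bar (g X).
Proof. by rewrite /Nh; case: cid => h []. Qed.
Lemma Nh_eqv X X' (a : @hom B X X') : sval (sh1 Nh (Deqv a)) = jm a.
Proof. by rewrite /Nh; case: cid => h []. Qed.
Lemma Nh_tri X Y C (D : stri X Y C) : sval (sh1 Nh (Dtri D)) = jt D.
Proof. by rewrite /Nh; case: cid => h []. Qed.

Notation V := (Gamma (Dmod S)).
(** Only a map of sets. Elements of [Q] with equal class in [A] differ by a unique element of [E_1],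
    and these differences are the values on morphisms [fm], the multiplication [mu] and the unit
    [iota] of the tensor functor. *)
Definition sec (x : C0 (Dmod S)) : Q := lift (sh0 Nh x).
Definition jj (c : C1 (Dmod S)) : Q := sval (sh1 Nh c).
Lemma bar_sec x : bar (sec x) = sh0 Nh x. Proof. exact: liftK. Qed.
Lemma q_jj c : q (jj c) = 1. Proof. exact: (proj2_sig (sh1 Nh c)).1. Qed.
Lemma jjM c c' : jj (c * c') = jj c * jj c'.
Proof. by rewrite /jj (sh1M Nh). Qed.
Lemma jj1 : jj 1 = 1.
Proof. by rewrite /jj (morph_one (sh1M Nh)). Qed.
Lemma jj_act c x : jj (act c x) = jj c ^ sec x.
Proof.
rewrite (J_conj (sec x) (proj2_sig (sh1 Nh c))) /act jjM; congr (_ * _).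
rewrite -[RHS]eps_lift bar_sec /jj (sh_br Nh) (sh_bd Nh).
by [].
Qed.

Lemma mdiff_exists u v : bar u = bar v -> {m | u = v * κ m}.
Proof. by move/barP/cid. Qed.

Lemma sec_hom (x y : V) (f : hom x y) : {m | sec x = sec y * jj (sval f) * κ m}.
Proof.
apply: mdiff_exists; rewrite barM !bar_sec {1}(eqP (proj2_sig f)) (sh0M Nh).
by rewrite (sh_bd Nh).
Qed.
Definition fm (x y : V) (f : hom x y) : X1 E := sval (sec_hom f).
Lemma fmE (x y : V) (f : hom x y) : sec x = sec y * jj (sval f) * κ (fm f).
Proof. exact: (proj2_sig (sec_hom f)). Qed.
Lemma fm_uniq (x y : V) (f : hom x y) m :
  sec x = sec y * jj (sval f) * κ m -> fm f = m.
Proof. by rewrite (fmE f) => /mulgI/κ_inj. Qed.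
Lemma fm_bd (x y : V) (f : hom x y) : q (sec x) = q (sec y) * xd (fm f).
Proof. by rewrite {1}(fmE f) !qM q_jj mulg1 qq_k. Qed.

Lemma sec_mul (x y : V) : {m | sec x * sec y = sec ((x : C0 _) * y)%g * κ m}.
Proof. by apply: mdiff_exists; rewrite barM !bar_sec (sh0M Nh). Qed.
Definition mu (x y : V) : X1 E := sval (sec_mul x y).
Lemma muE (x y : V) : sec x * sec y = sec ((x : C0 _) * y)%g * κ (mu x y).
Proof. exact: (proj2_sig (sec_mul x y)). Qed.
Lemma mu_bd (x y : V) :
  q (sec x) * q (sec y) = q (sec ((x : C0 _) * y)%g) * xd (mu x y).
Proof. by rewrite -qM muE qM qq_k. Qed.

Lemma sec_one : {m | 1 = sec 1 * κ m}.
Proof. by apply: mdiff_exists; rewrite bar1 bar_sec (morph_one (sh0M Nh)). Qed.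
Definition iota : X1 E := sval sec_one.
Lemma iotaE : 1 = sec 1 * κ iota. Proof. exact: (proj2_sig sec_one). Qed.
Lemma iota_bd : 1 = q (sec 1) * xd iota.
Proof. by rewrite -q1 {1}iotaE qM qq_k. Qed.

Definition secf : functor V (xcat E).
Proof.
refine (@Functor V (xcat E) (fun x => q (sec x))
  (fun x y f => exist _ (fm f) (fm_bd f)) _ _).
- by move=> x; apply: sig_prop_inj; apply: fm_uniq; rewrite /= jj1 κ1 !mulg1.
- move=> x y t g' f; apply: sig_prop_inj; apply: fm_uniq => /=.
  rewrite {1}(fmE f) {1}(fmE g') jjM κM -!mulgA; congr (_ * (_ * _)).
  by rewrite !mulgA (κ_comm _ (q_jj _)).
Defined.

Lemma fm_eq (x y : C0 (Dmod S)) (p : x = y) :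
  sec x = sec y * κ (@fm x y (Gamma_eq p)).
Proof. by rewrite [LHS](@fmE x y (Gamma_eq p)) jj1 mulg1. Qed.

Lemma mu_nat (x x' y y' : V) (f : hom x x') (f' : hom y y') :
  mu x' y' * ((fm f ◃ q (sec y')) * fm f') =
  @fm ((x : C0 _) * y) ((x' : C0 _) * y') (@tensm V _ _ _ _ f f') * mu x y.
Proof.
have := @fmE ((x : C0 _) * y) ((x' : C0 _) * y') (@tensm V _ _ _ _ f f').
rewrite /= jjM jj_act; set m := fm _ => E1.
apply: κ_inj; rewrite [RHS]κM.
apply: (mulgI (sec ((x' : C0 _) * y') * (jj (sval f) ^ sec y' * jj (sval f')))).
rewrite [RHS]mulgA -E1 -muE (fmE f) (fmE f').
have qj : q (jj (sval f) ^ sec y' * jj (sval f')) = 1.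
  by rewrite qM (morph_conj qM) !q_jj conj1g mulg1.
move: (muE x' y') (q_jj (sval f')) (conjgC (jj (sval f)) (sec y')) qj.
move: (sec ((x' : C0 _) * y')) (jj (sval f)) (jj (sval f')) (jj (sval f) ^ sec y') => P j j' k.
move=> EP qj' Ek qj; rewrite κM mulgA -(mulgA P) -(κ_comm _ qj) mulgA -EP κM.
rewrite -!mulgA; congr (_ * _).
rewrite (mulgA (κ _) (sec y')) (κ_norm _ (sec y')) -!mulgA (mulgA (κ _) j') (κ_comm _ qj').
by rewrite !mulgA Ek.
Qed.

(** Here [m] stands for the value of the functor on the associativity isomorphism: equal objects
    have the same lift only up to a proof of equality, so this value is kept as a variable. *)
Lemma mu_ass (x y t : V) m :
  sec ((x : C0 _) * ((y : C0 _) * t)) = sec ((x : C0 _) * y * t) * κ m ->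
  m * mu x ((y : C0 _) * t) * mu y t = mu ((x : C0 _) * y) t * (mu x y ◃ q (sec t)).
Proof.
move: (muE x ((y : C0 _) * t)) (muE y t) (muE ((x : C0 _) * y) t) (muE x y).
move: (sec ((x : C0 _) * ((y : C0 _) * t))) (sec ((x : C0 _) * y * t)) => u v.
move: (mu x ((y : C0 _) * t)) (mu y t) (mu ((x : C0 _) * y) t) (mu x y) => a b c d'.
move=> Ea Eb Ec Ed Em; apply: κ_inj; apply: (mulgI v).
by rewrite !κM !mulgA -Em -Ea -[LHS]mulgA -Eb -Ec -mulgA -κ_norm !mulgA Ed.
Qed.

Lemma mu_one_l (x : V) m : sec ((1 : C0 _) * (x : C0 _)) = sec x * κ m ->
  m * mu (1 : C0 _) x * (iota ◃ q (sec x)) = 1.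
Proof.
move: (muE (1 : C0 _) x) iotaE.
move: (sec ((1 : C0 _) * (x : C0 _))) (mu _ _) (sec 1) => u a w Ea Ei Em.
apply: κ_inj; rewrite !κM κ1; apply: (mulgI (sec x)).
by rewrite !mulgA -Em -Ea -mulgA -κ_norm mulgA -Ei mulg1 mul1g.
Qed.

Lemma mu_one_r (x : V) m : sec ((x : C0 _) * (1 : C0 _)) = sec x * κ m ->
  m * mu x (1 : C0 _) * iota = 1.
Proof.
move: (muE x (1 : C0 _)) iotaE; move: (sec (_ * _)) (mu _ _) (sec 1) => u a w Ea Ei Em.
apply: κ_inj; rewrite !κM κ1; apply: (mulgI (sec x)).
by rewrite !mulgA -Em -Ea -mulgA -Ei.
Qed.

Definition sec_tensor : tensorFunctor V (xmonoidal E).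
Proof.
refine (@TensorFunctor V (xmonoidal E) secf
  (fun x y => exist _ (mu x y) (mu_bd x y)) (exist _ iota iota_bd) _ _ _ _ _ _).
- by move=> *; exact: xcat_iso.
- exact: xcat_iso.
- move=> x y x' y' f f'; apply: sig_prop_inj; exact: mu_nat.
- move=> x y t; apply: sig_prop_inj => /=; rewrite xact1 mul1g !mulg1.
  exact: mu_ass (fm_eq _).
- move=> x; apply: sig_prop_inj => /=; rewrite mulg1.
  exact: mu_one_l (fm_eq _).
- move=> x; apply: sig_prop_inj => /=; rewrite xact1 mul1g.
  exact: mu_one_r (fm_eq _).
Defined.

Definition sec_a (X : B) : {m | sec (Dob X) = g X * κ m}.
Proof. by apply: mdiff_exists; rewrite bar_sec Nh_ob. Qed.
Definition sa (X : B) : X1 E := sval (sec_a X).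
Lemma saE X : sec (Dob X) = g X * κ (sa X). Proof. exact: (proj2_sig (sec_a X)). Qed.
Lemma sa_bd X : q (sec (Dob X)) = e X * xd (sa X).
Proof. by rewrite saE qM q_g qq_k. Qed.

Lemma xm_subproof X X' (h : @hom B X X') : e X = e X' * xd (δm h).
Proof. exact: sm_bd. Qed.
Lemma xt_subproof X Y C (D : stri X Y C) : e C * e X = e Y * xd (δ D).
Proof. exact: st_bd. Qed.
Definition xdet : det_data S (xmonoidal E) :=
  @DetData S (xmonoidal E) e (fun X X' h => exist _ (δm h) (xm_subproof h))
    (fun X Y C D => exist _ (δ D) (xt_subproof D)).

Lemma sec_factorization :
  @is_factorization S V (xmonoidal E) (Ddet S) xdet sec_tensor
    (fun X => exist _ (sa X) (sa_bd X)).
Proof.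
split=> [X X' h|X Y C D]; apply: sig_prop_inj => /=; apply: κ_inj.
  have := fmE (det_mor (Ddet S) h : @hom V _ _).
  rewrite [jj _]Nh_eqv; set m := fm _; rewrite !saE => H.
  apply: (mulgI (g X' * jm h)); move: (jmE h) (q_jm h) H; move: (jm h) => j Ej qj H.
  rewrite !κM [RHS]mulgA -Ej H -!mulgA.
  by congr (_ * _); rewrite !mulgA (κ_comm _ qj).
have := fmE (det_tri (Ddet S) D : @hom V _ _).
rewrite [jj _]Nh_tri; set m := fm _; rewrite !saE => H.
apply: (mulgI (g Y * jt D)); move: (jtE D) (q_jt D) H; move: (jt D) => j Ej qj H.
rewrite !κM [RHS]mulgA -Ej.
have -> : κ (sa C ◃ e X) * κ (sa X) = (g X)^-1 * κ (sa C) * sec (Dob X).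
  by rewrite saE -!mulgA (mulgA _ (g X)) (κ_norm _ (g X)) q_g -mulgA mulKg.
rewrite -!mulgA mulVKg (mulgA (g C)) -saE muE H -!mulgA.
by congr (_ * _); rewrite !mulgA (κ_comm _ qj).
Qed.
End Core.

(** * Categorical groups *)

Lemma iso_inj (C : category) (X Y Z : C) (i : hom Y Z) (f g : hom X Y) :
  is_iso i -> i ∘ f = i ∘ g -> f = g.
Proof. by move=> [j [ji _]] e; rewrite -[f]comp1m -[g]comp1m -ji -!compA e. Qed.
Lemma iso_surj (C : category) (X Y Z : C) (i : hom X Y) (f g : hom Y Z) :
  is_iso i -> f ∘ i = g ∘ i -> f = g.
Proof. by move=> [j [_ ij]] e; rewrite -[f]compm1 -[g]compm1 -ij !compA e. Qed.

Lemma equivalence_faithful (C D : category) (F : functor C D) :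
  is_equivalence F -> forall X Y (f g : hom X Y), fmap F f = fmap F g -> f = g.
Proof.
move=> [F' [[a [na ia]] _]] X Y f g fg.
have := na _ _ f; have := na _ _ g; rewrite /= fg => -> h.
exact: iso_surj (ia X) (esym h).
Qed.
Lemma equivalence_full (C D : category) (F : functor C D) :
  is_equivalence F -> forall X Y (h : hom (F X) (F Y)), exists f, fmap F f = h.
Proof.
move=> eF X Y h; have [F' [[a [na ia]] [b [nb ib]]]] := eF.
have [a' [a'a aa']] := ia X.
exists (a Y ∘ fmap F' h ∘ a').
have eF' : is_equivalence F' by exists F; split; [exists b|exists a].
apply: (equivalence_faithful eF'); apply: (iso_inj (ia Y)).
have := na _ _ (a Y ∘ fmap F' h ∘ a'); rewrite /= => ->.
by rewrite -!compA a'a compm1.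
Qed.

Section Monoidal.
Variable M : monoidal.
Implicit Types X Y Z : M.
Lemma tens1l X Y Z W (f : hom Y Z) (g : hom Z W) :
  idm X ⊠ (g ∘ f) = idm X ⊠ g ∘ idm X ⊠ f.
Proof. by rewrite -tensm_comp comp1m. Qed.
Lemma tens1r X Y Z W (f : hom Y Z) (g : hom Z W) :
  (g ∘ f) ⊠ idm X = g ⊠ idm X ∘ f ⊠ idm X.
Proof. by rewrite -tensm_comp comp1m. Qed.
Lemma tens_lr X Y Z W (f : hom X Y) (g : hom Z W) :
  f ⊠ idm W ∘ idm X ⊠ g = f ⊠ g.
Proof. by rewrite -tensm_comp comp1m compm1. Qed.
Lemma tens_rl X Y Z W (f : hom X Y) (g : hom Z W) :
  idm Y ⊠ g ∘ f ⊠ idm Z = f ⊠ g.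
Proof. by rewrite -tensm_comp comp1m compm1. Qed.
End Monoidal.

Section Groupoid.
Variable G : catGroup.
Implicit Types X Y Z : G.

Definition inv X Y (f : hom X Y) : hom Y X := sval (cid (gmon_groupoid f)).
Lemma invl X Y (f : hom X Y) : inv f ∘ f = idm X.
Proof. by rewrite /inv; case: cid => h []. Qed.
Lemma invr X Y (f : hom X Y) : f ∘ inv f = idm Y.
Proof. by rewrite /inv; case: cid => h []. Qed.
Lemma compI X Y Z (f : hom Y Z) (g h : hom X Y) : f ∘ g = f ∘ h -> g = h.
Proof. by move/(congr1 (comp (inv f))); rewrite !compA invl !comp1m. Qed.
Lemma Icomp X Y Z (f : hom X Y) (g h : hom Y Z) : g ∘ f = h ∘ f -> g = h.
Proof. by move/(congr1 (fun u => u ∘ inv f)); rewrite -!compA invr !compm1. Qed.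
Lemma compK X Y Z (f : hom Y Z) (g : hom X Y) : inv f ∘ (f ∘ g) = g.
Proof. by rewrite compA invl comp1m. Qed.
Lemma compVK X Y Z (f : hom Y Z) (g : hom X Z) : f ∘ (inv f ∘ g) = g.
Proof. by rewrite compA invr comp1m. Qed.
Lemma VKcomp X Y Z (f : hom Y X) (g : hom Y Z) : g ∘ inv f ∘ f = g.
Proof. by rewrite -compA invl compm1. Qed.

Lemma tens_faithful X Y Z (f g : hom Y Z) : idm X ⊠ f = idm X ⊠ g -> f = g.
Proof. exact: (equivalence_faithful (gmon_tens_equiv X)). Qed.
Lemma tens_full X Y Z (h : hom (X ⊗ Y) (X ⊗ Z)) : exists f, idm X ⊠ f = h.
Proof. exact: (equivalence_full (gmon_tens_equiv X)). Qed.
Lemma tens_surj X Z : exists Y, inhabited (hom (X ⊗ Y) Z).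
Proof.
have [F' [_ [b _]]] := gmon_tens_equiv X.
by exists (F' Z); constructor; exact: (b Z).
Qed.
(** A right inverse [X'] is also a left inverse: the composite [X ⊗ (X' ⊗ X) -> munit G ⊗ X -> X ->
    X ⊗ munit G] comes from a morphism [X' ⊗ X -> munit G], as [X ⊗ -] is full. *)
Lemma left_inverse_exists X : exists X', inhabited (hom (X' ⊗ X) (munit G)).
Proof.
have [X' [w]] := tens_surj X (munit G); exists X'.
have [f _] := tens_full (inv (run X) ∘ lun X ∘ w ⊠ idm X ∘ ass X X' X).
by constructor.
Qed.

(** Tensoring further with a right inverse of [Z] turns [- ⊗ Z] into [- ⊗ munit G], which is
    isomorphic to the identity. *)
Lemma faithful_tens Z X Y (f g : hom X Y) : f ⊠ idm Z = g ⊠ idm Z -> f = g.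
Proof.
move=> fg; have [Z' [w]] := tens_surj Z (munit G).
have e : f ⊠ idm (Z ⊗ Z') = g ⊠ idm (Z ⊗ Z').
  by apply: (@compI _ _ _ (ass _ _ _)); rewrite -tensm_id !ass_nat fg.
have {}e : f ⊠ idm (munit G) = g ⊠ idm (munit G).
  by apply: (@Icomp _ _ _ (idm X ⊠ w)); rewrite !tens_lr -[f ⊠ w]tens_rl -[g ⊠ w]tens_rl e.
by apply: (@Icomp _ _ _ (run X)); rewrite -!run_nat e.
Qed.

(** Kelly's argument: after tensoring with the unit on the left, the identity follows from the
    pentagon and the triangle axiom. *)
Lemma lun_tens X Y : lun X ⊠ idm Y ∘ ass (munit G) X Y = lun (X ⊗ Y).
Proof.
apply: (@tens_faithful (munit G)); apply: (@compI _ _ _ (ass _ _ _)).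
rewrite -[idm _ ⊠ lun (X ⊗ Y)]triangle_id tens1l compA ass_nat.
rewrite -[idm _ ⊠ lun X]triangle_id tens1r -(tensm_id X Y) [RHS]compA ass_nat.
by rewrite -[RHS]compA pentagon !compA.
Qed.
End Groupoid.

(** * Strictification of a categorical group *)

(* An object is replaced by the operators on chosen representatives of the
   isomorphism classes which it induces; these form a group under composition,
   up to isomorphism of the object. *)
Section Strictification.
Variable G : catGroup.

Lemma isoc_sym (X Y : G) : inhabited (hom X Y) -> inhabited (hom Y X).
Proof. by move=> [f]; constructor; exact: (inv f). Qed.
Lemma isoc_trans (X Y Z : G) :
  inhabited (hom X Y) -> inhabited (hom Y Z) -> inhabited (hom X Z).
Proof. by move=> [f] [g]; constructor; exact: (g ∘ f). Qed.
Definition isoc : setoid :=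
  Setoid (fun X : G => inhabits (idm X)) isoc_sym isoc_trans.

Definition Ix := quot isoc.
Definition Φ (i : Ix) : G := rep i.
Lemma Φ_inj i j : hom (Φ i) (Φ j) -> i = j.
Proof. by move=> f; rewrite -(repK i) -(repK j); apply/clsP; constructor. Qed.
Lemma Φ_surj (Z : G) : {i & hom Z (Φ i)}.
Proof.
exists (cls (Z : isoc)).
have /isoc_sym h : srel _ _ := rep_cls (Z : isoc).
by apply: (sval (cid (_ : exists _, True))); have [f] := h; exists f.
Qed.
Definition eqh (i j : Ix) (p : i = j) : hom (Φ i) (Φ j) :=
  match p with erefl => idm (Φ i) end.

(** An object with one selected morphism [oe ⊗ Φ i -> Φ j] for each [i]. Since distinct [Φ j] are
    not isomorphic, [j] is determined by [i]; selecting by a predicate avoids a dependent function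
    [j(i)]. *)
Record op := Op {
  oe : G;
  ou : forall i j, hom (oe ⊗ Φ i) (Φ j) -> Prop;
  ou_ex : forall i j, hom (oe ⊗ Φ i) (Φ j) -> exists h : hom (oe ⊗ Φ i) (Φ j), ou h;
  ou_uniq : forall i j (h h' : hom (oe ⊗ Φ i) (Φ j)), ou h -> ou h' -> h = h' }.

Lemma ou_tgt (x : op) i : exists j (h : hom (oe x ⊗ Φ i) (Φ j)), ou h.
Proof. by have [j f] := Φ_surj (oe x ⊗ Φ i); exists j; exact: ou_ex f. Qed.

Definition aut : Type := forall i, hom (Φ i) (Φ i).
HB.instance Definition _ := gen_eqMixin aut.
HB.instance Definition _ := gen_choiceMixin aut.
Definition aut_mul (c d : aut) : aut := fun i => c i ∘ d i.
Definition aut_inv (c : aut) : aut := fun i => inv (c i).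
Definition aut_one : aut := fun i => idm (Φ i).
Lemma autP (c d : aut) : (forall i, c i = d i) -> c = d.
Proof. exact: functional_extensionality_dep. Qed.
Lemma aut_mulA : associative aut_mul.
Proof. by move=> c d e; apply: autP => i; exact: compA. Qed.
Lemma aut_mul1l : left_id aut_one aut_mul.
Proof. by move=> c; apply: autP => i; exact: comp1m. Qed.
Lemma aut_mul1r : right_id aut_one aut_mul.
Proof. by move=> c; apply: autP => i; exact: compm1. Qed.
Lemma aut_mulVl : left_inverse aut_one aut_inv aut_mul.
Proof. by move=> c; apply: autP => i; exact: invl. Qed.
Lemma aut_mulVr : right_inverse aut_one aut_inv aut_mul.
Proof. by move=> c; apply: autP => i; exact: invr. Qed.
HB.instance Definition _ :=
  isGroup.Build aut aut_mulA aut_mul1l aut_mul1r aut_mulVl aut_mulVr.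

(** A morphism need not carry selected morphisms to selected ones; the family [c] measures the
    difference. Every [θ] has exactly one such label and each label belongs to at most one [θ], so
    labels can replace morphisms. *)
Definition M (c : aut) (x y : op) (θ : hom (oe x) (oe y)) : Prop :=
  forall i j (g : hom (oe y ⊗ Φ i) (Φ j)), ou g ->
    ou (g ∘ (idm (oe y) ⊠ c i) ∘ (θ ⊠ idm (Φ i))).

Lemma M_uniq c x y θ θ' : M c (x := x) (y := y) θ -> M c (x := x) (y := y) θ' -> θ = θ'.
Proof.
move=> m m'; have [i _] := Φ_surj (munit G); have [j [g ug]] := ou_tgt y i.
have /compI /faithful_tens := ou_uniq (m _ _ _ ug) (m' _ _ _ ug); exact.
Qed.

Lemma M_aut_uniq c c' x y θ : M c (x := x) (y := y) θ -> M c' (x := x) (y := y) θ -> c = c'.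
Proof.
move=> m m'; apply: autP => i; have [j [g ug]] := ou_tgt y i.
have /Icomp /compI /tens_faithful := ou_uniq (m _ _ _ ug) (m' _ _ _ ug); exact.
Qed.

Lemma M_ex (x y : op) (θ : hom (oe x) (oe y)) : exists c, M c θ.
Proof.
have h i : exists c : hom (Φ i) (Φ i), forall j (g : hom (oe y ⊗ Φ i) (Φ j)), ou g ->
    ou (g ∘ (idm (oe y) ⊠ c) ∘ (θ ⊠ idm (Φ i))).
  have [j [g ug]] := ou_tgt y i.
  have [k uk] := ou_ex (g ∘ (θ ⊠ idm (Φ i)) : hom (oe x ⊗ _) _).
  have [c hc] := tens_full (inv g ∘ k ∘ inv (θ ⊠ idm (Φ i))).
  exists c => j' g' ug'; have ej : j = j' by apply: Φ_inj; exact: (g' ∘ inv g).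
  subst j'; rewrite (ou_uniq ug' ug) hc !compA invr comp1m VKcomp; exact: uk.
exists (fun i => sval (cid (h i))) => i j g ug.
by case: cid => c hc; exact: hc.
Qed.

Lemma M_id (x : op) : M 1 (x := x) (y := x) (idm (oe x)).
Proof. by move=> i j g ug; rewrite !tensm_id !compm1. Qed.

Lemma M_comp c c' x y z (θ : hom (oe x) (oe y)) (θ' : hom (oe y) (oe z)) :
  M c' θ' -> M c θ -> M (c' * c) (θ' ∘ θ).
Proof.
move=> m' m i j g ug; have := m _ _ _ (m' _ _ _ ug).
congr ou; rewrite /= tens1l tens1r -!compA; congr (_ ∘ (_ ∘ _)).
by rewrite !compA tens_lr tens_rl.
Qed.

Lemma M_inv c x y (θ : hom (oe x) (oe y)) : M c θ -> M c^-1 (inv θ).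
Proof.
move=> m i j g ug.
have [g0 ug0] := ou_ex (g ∘ (inv θ ⊠ idm (Φ i)) : hom (oe y ⊗ _) _).
rewrite (ou_uniq ug (m _ _ _ ug0)).
rewrite -(compA g0) tens_rl -!compA tens_rl -tensm_comp.
by rewrite invr [c i ∘ _]invr tensm_id compm1.
Qed.

(** Only morphisms with label 1 identify operators. The associativity and unit isomorphisms have
    label 1, so the quotient is a strict group, while nontrivial labels remain as its degree-one
    part. *)
Definition op_setoid : setoid.
Proof.
refine (@Setoid op (fun x y => exists θ : hom (oe x) (oe y), M 1 θ) _ _ _).
- by move=> x; exists (idm _); exact: M_id.
- by move=> x y [θ m]; exists (inv θ); rewrite -invg1; exact: M_inv.
- by move=> x y z [θ m] [θ' m']; exists (θ' ∘ θ); rewrite -(mulg1 1); exact: M_comp.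
Defined.

(** ** The group of operators *)

Definition op_mul (x y : op) : op.
Proof.
refine (@Op (oe x ⊗ oe y) (fun i k h =>
  exists j (g : hom (oe y ⊗ Φ i) (Φ j)) (g' : hom (oe x ⊗ Φ j) (Φ k)),
    [/\ ou g, ou g' & h ∘ ass _ _ _ = g' ∘ (idm _ ⊠ g)]) _ _).
- move=> i k h0; have [j [g ug]] := ou_tgt y i.
  have [g' ug'] := ou_ex (h0 ∘ ass _ _ _ ∘ inv (idm _ ⊠ g) : hom (oe x ⊗ _) _).
  exists (g' ∘ (idm _ ⊠ g) ∘ inv (ass _ _ _)); exists j, g, g'; split=> //.
  by rewrite VKcomp.
- move=> i k h h' [j [g [g' [ug ug' e]]]] [j1 [g1 [g1' [ug1 ug1' e1]]]].
  have ej : j = j1 by apply: Φ_inj; exact: (g1 ∘ inv g).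
  subst j1; apply: (@Icomp _ _ _ _ (ass _ _ _)).
  by rewrite e e1 (ou_uniq ug ug1) (ou_uniq ug' ug1').
Defined.

Definition op_d (c : aut) : op.
Proof.
refine (@Op (munit G) (fun i j h => exists p : i = j, h = eqh p ∘ c i ∘ lun _) _ _).
- move=> i j h0; have p : i = j by apply: Φ_inj; exact: (h0 ∘ inv (lun _)).
  by exists (eqh p ∘ c i ∘ lun _); exists p.
- by move=> i j h h' [p ->] [p' ->]; rewrite (Prop_irrelevance p p').
Defined.
Lemma op_dP c i : @ou (op_d c) i i (c i ∘ lun _).
Proof. by exists erefl; rewrite comp1m. Qed.

Definition linv_ob (X : G) := sval (cid (left_inverse_exists X)).
Lemma linv_ev (X : G) : exists _ : hom (linv_ob X ⊗ X) (munit G), True.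
Proof. by rewrite /linv_ob; case: cid => X' [f] /=; exists f. Qed.
Definition ev X : hom (linv_ob X ⊗ X) (munit G) := sval (cid (linv_ev X)).

Definition op_inv (x : op) : op.
Proof.
refine (@Op (linv_ob (oe x)) (fun j i h => exists g : hom (oe x ⊗ Φ i) (Φ j),
  ou g /\ h ∘ (idm _ ⊠ g) = lun _ ∘ (ev (oe x) ⊠ idm _) ∘ ass _ _ _) _ _).
- move=> j i h0.
  have [g0 _] := tens_full (inv h0 ∘ (lun _ ∘ (ev (oe x) ⊠ idm _) ∘ ass _ _ (Φ i))).
  have [g ug] := ou_ex (g0 : hom (oe x ⊗ _) _).
  exists (lun _ ∘ (ev (oe x) ⊠ idm _) ∘ ass _ _ _ ∘ inv (idm _ ⊠ g)).
  by exists g; rewrite VKcomp.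
- move=> j i h h' [g [ug e]] [g' [ug' e']].
  by apply: (@Icomp _ _ _ _ (idm _ ⊠ g)); rewrite e (ou_uniq ug ug') e'.
Defined.

Lemma act_exists (c : aut) (x : op) : exists w : aut,
  forall i j (g : hom (oe x ⊗ Φ i) (Φ j)), ou g -> c j ∘ g = g ∘ (idm _ ⊠ w i).
Proof.
have h i : exists w : hom (Φ i) (Φ i), forall j (g : hom (oe x ⊗ Φ i) (Φ j)), ou g ->
    c j ∘ g = g ∘ (idm _ ⊠ w).
  have [j [g ug]] := ou_tgt x i; have [w hw] := tens_full (inv g ∘ (c j ∘ g)).
  exists w => j' g' ug'; have ej : j = j' by apply: Φ_inj; exact: (g' ∘ inv g).
  by subst j'; rewrite (ou_uniq ug' ug) hw compVK.
exists (fun i => sval (cid (h i))) => i j g ug.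
by case: cid => w hw; exact: hw.
Qed.
Definition op_act (c : aut) (x : op) : aut := sval (cid (act_exists c x)).
Lemma op_actP c x i j (g : hom (oe x ⊗ Φ i) (Φ j)) : ou g ->
  c j ∘ g = g ∘ (idm _ ⊠ op_act c x i).
Proof. by rewrite /op_act; case: cid => w hw ug; exact: hw. Qed.
Lemma op_act_uniq c x (w : aut) :
  (forall i j (g : hom (oe x ⊗ Φ i) (Φ j)), ou g -> c j ∘ g = g ∘ (idm _ ⊠ w i)) ->
  op_act c x = w.
Proof.
move=> h; apply: autP => i; have [j [g ug]] := ou_tgt x i.
by apply: tens_faithful; apply: (@compI _ _ _ _ g); rewrite -(op_actP c ug); exact: h.
Qed.

Lemma M_mul c d x x' y y' (θ : hom (oe x) (oe x')) (ζ : hom (oe y) (oe y')) :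
  M c θ -> M d ζ ->
  @M (op_act c y' * d) (op_mul x y) (op_mul x' y') (θ ⊠ ζ).
Proof.
move=> m m' i k h [j [g [g' [ug ug' e]]]] /=.
exists j, (g ∘ (idm _ ⊠ d i) ∘ (ζ ⊠ idm _)), (g' ∘ (idm _ ⊠ c j) ∘ (θ ⊠ idm _)).
split; [exact: m'|exact: m|].
rewrite -(compA _ _ (ass _ _ _)) -ass_nat compA -(tensm_id (oe x') (oe y')).
rewrite -(compA h) -ass_nat (compA h) e -!compA; congr (_ ∘ _).
rewrite -!tensm_comp !comp1m !compm1; congr (_ ⊠ _).
by rewrite [RHS]compA (op_actP _ ug) -compA -tensm_comp comp1m.
Qed.

Lemma M_ass x y z : @M 1 (op_mul x (op_mul y z)) (op_mul (op_mul x y) z) (ass _ _ _).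
Proof.
move=> i l h [j [g [k' [ug [k [g1 [g2 [ug1 ug2 e1]]]] e]]]].
exists k; exists (g1 ∘ (idm _ ⊠ g) ∘ inv (ass _ _ _)), g2; split=> //.
  by exists j, g, g1; rewrite VKcomp.
rewrite tensm_id compm1; apply: (@Icomp _ _ _ _ (idm _ ⊠ ass _ _ _)).
rewrite -[RHS]compA -tens1l VKcomp -2!compA (compA (_ ⊠ _)) -pentagon (compA h) e.
by rewrite -(compA k') -tensm_id -ass_nat (compA k') e1 tens1l compA.
Qed.

Lemma M_run x : @M 1 (op_mul x (op_d 1)) x (run _).
Proof.
move=> i j g ug; exists i, (lun _), g; split=> //.
  by have := op_dP 1 i; rewrite comp1m.
by rewrite tensm_id compm1 -compA triangle_id.
Qed.

Lemma M_lun x : @M 1 (op_mul (op_d 1) x) x (lun _).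
Proof.
move=> i j g ug; exists j, g, (lun _); split=> //.
  by have := op_dP 1 j; rewrite comp1m.
by rewrite tensm_id compm1 -compA lun_tens lun_nat.
Qed.

Lemma M_ev x : @M 1 (op_mul (op_inv x) x) (op_d 1) (ev (oe x)).
Proof.
move=> i j g [p ->]; subst j; have [j [g' ug']] := ou_tgt x i.
exists j, g', (lun _ ∘ (ev (oe x) ⊠ idm _) ∘ ass _ _ _ ∘ inv (idm _ ⊠ g')).
split=> //; first by exists g'; rewrite VKcomp.
by rewrite VKcomp tensm_id compm1 /= !comp1m.
Qed.

Lemma M_d c y : @M c (op_mul y (op_d c)) y (run _).
Proof.
move=> i j g ug; exists i, (c i ∘ lun _), g; split=> //; first exact: op_dP.
by rewrite /= -compA triangle_id tens1l compA.
Qed.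

Lemma M_dl c x : @M (op_act c x) (op_mul (op_d c) x) x (lun _).
Proof.
move=> i j g ug; exists j, g, (c j ∘ lun _); split=> //; first exact: op_dP.
by rewrite /= -(op_actP c ug) -!compA lun_tens lun_nat.
Qed.
Lemma act1op x : op_act 1 x = 1.
Proof. by apply: op_act_uniq => i j g _; rewrite comp1m tensm_id compm1. Qed.

Lemma M_congr c c' x y (θ : hom (oe x) (oe y)) : c = c' -> M c θ -> M c' θ.
Proof. by move=> ->. Qed.

Definition ops : Type := quot op_setoid.
HB.instance Definition _ := Choice.copy ops (quot op_setoid).
Definition opc (x : op) : ops := cls (x : op_setoid).
Definition opr (x : ops) : op := rep (x : quot op_setoid).
Lemma opcP x y : opc x = opc y <-> exists θ : hom (oe x) (oe y), M 1 θ.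
Proof. exact: (@clsP op_setoid). Qed.
Lemma oprK x : opc (opr x) = x. Proof. exact: repK. Qed.
Lemma opr_c x : exists θ : hom (oe (opr (opc x))) (oe x), M 1 θ.
Proof. exact: (@rep_cls op_setoid). Qed.

Definition ops_mul (x y : ops) := opc (op_mul (opr x) (opr y)).
Lemma ops_mulE x y : ops_mul (opc x) (opc y) = opc (op_mul x y).
Proof.
have [θ m] := opr_c x; have [ζ m'] := opr_c y; apply/opcP.
by exists (θ ⊠ ζ); apply: M_congr (M_mul m m'); rewrite act1op mulg1.
Qed.
Definition ops_one := opc (op_d 1).
Definition ops_inv (x : ops) := opc (op_inv (opr x)).

Lemma ops_mulA : associative ops_mul.
Proof.
move=> x y z; rewrite -(oprK x) -(oprK y) -(oprK z) !ops_mulE.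
by apply/opcP; exists (ass _ _ _); exact: M_ass.
Qed.
Lemma ops_mul1l : left_id ops_one ops_mul.
Proof.
move=> x; rewrite -(oprK x) ops_mulE; apply/opcP.
by exists (lun _); exact: M_lun.
Qed.
Lemma ops_mul1r : right_id ops_one ops_mul.
Proof.
move=> x; rewrite -(oprK x) ops_mulE; apply/opcP.
by exists (run _); exact: M_run.
Qed.
Lemma ops_mulVl : left_inverse ops_one ops_inv ops_mul.
Proof.
move=> x; rewrite -{2}(oprK x) ops_mulE; apply/opcP.
by exists (ev _); exact: M_ev.
Qed.
Lemma ops_mulVr : right_inverse ops_one ops_inv ops_mul.
Proof.
move=> x; rewrite -[LHS]ops_mul1l -(ops_mulVl (ops_inv x)) -ops_mulA.
by rewrite (ops_mulA (ops_inv x) x) ops_mulVl ops_mul1l.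
Qed.
HB.instance Definition _ :=
  isGroup.Build ops ops_mulA ops_mul1l ops_mul1r ops_mulVl ops_mulVr.
Lemma opcM x y : opc (op_mul x y) = opc x * opc y.
Proof. exact: esym (ops_mulE x y). Qed.

Definition ops_d (c : aut) : ops := opc (op_d c).

(** The operator [op_d c] is the unit object acting through [c], and the right unit isomorphism
    [y ⊗ 1 -> y] has label [c]. This identifies the morphisms of [G] with those of the crossed
    module. *)
Lemma M_opsP c x y :
  opc x = opc y * ops_d c <-> exists θ : hom (oe x) (oe y), M c θ.
Proof.
rewrite -opcM opcP; split=> [[θ m]|[θ m]].
  exists (run _ ∘ θ); rewrite -(mulg1 c); apply: M_comp m; exact: M_d.
exists (inv (run _) ∘ θ); rewrite -(mulVg c); apply: M_comp m.
by apply: M_inv; exact: M_d.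
Qed.

Definition ops_act (c : aut) (x : ops) : aut := op_act c (opr x).
Lemma op_act_M c x y (θ : hom (oe x) (oe y)) : M 1 θ -> op_act c x = op_act c y.
Proof.
move=> m; apply/esym/op_act_uniq => i j g ug.
apply: (@Icomp _ _ _ _ (θ ⊠ idm _)); have := m _ _ _ ug.
rewrite tensm_id compm1 => /(op_actP c) H.
by rewrite -compA H -!compA tens_lr tens_rl.
Qed.
Lemma ops_actE c x : ops_act c (opc x) = op_act c x.
Proof. by have [θ m] := opr_c x; exact: op_act_M m. Qed.

Lemma ops_dM : {morph ops_d : c d / c * d}.
Proof.
move=> c d; apply/esym; rewrite -opcM; apply/opcP; exists (lun _).
move=> i j g [p ->]; subst j; exists i, (d i ∘ lun _), (c i ∘ lun _).
split; [exact: op_dP|exact: op_dP|].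
rewrite /= tensm_id compm1 comp1m -!compA lun_tens.
by congr (_ ∘ _); rewrite compA lun_nat.
Qed.
Lemma ops_actM c d x : ops_act (c * d) x = ops_act c x * ops_act d x.
Proof.
apply: op_act_uniq => i j g ug.
by rewrite tens1l -[LHS]compA (op_actP d ug) !compA (op_actP c ug).
Qed.
Lemma ops_act_1 c : ops_act c 1 = c.
Proof.
rewrite [ops_act c _]ops_actE; apply: op_act_uniq => i j g [p ->].
by subst j; rewrite !comp1m lun_nat.
Qed.
Lemma ops_actA c x y : ops_act c (x * y) = ops_act (ops_act c x) y.
Proof.
rewrite -(oprK x) -(oprK y) -opcM !ops_actE.
apply: op_act_uniq => i k h [j [g [g' [ug ug' e]]]].
apply: (@Icomp _ _ _ _ (ass _ _ _)); rewrite -compA e -(compA h) -tensm_id -ass_nat.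
rewrite !compA e (op_actP c ug') -!compA -!tens1l; congr (_ ∘ (_ ⊠ _)).
exact: (op_actP (op_act c (opr x)) ug).
Qed.
Lemma ops_d_act c x : ops_d (ops_act c x) = ops_d c ^ x.
Proof.
rewrite -(oprK x) ops_actE; apply: (mulgI (opc (opr x))); rewrite -conjgC.
transitivity (opc (op_mul (op_d c) (opr x))); last exact: opcM.
by apply/esym/M_opsP; exists (lun _); exact: M_dl.
Qed.
Lemma ops_act_d c d : ops_act c (ops_d d) = c ^ d.
Proof.
rewrite ops_actE; apply: op_act_uniq => i j g [p ->]; subst j.
rewrite !comp1m -[RHS]compA lun_nat !compA.
by rewrite [d i ∘ d^-1 i]invr comp1m.
Qed.

Definition strict_xmod : xmod :=
  XMod ops_dM ops_actM ops_act_1 ops_actA ops_d_act ops_act_d.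
Notation E := strict_xmod.

Lemma strict_hom_exists (x y : X0 E) (c : xhom x y) :
  exists θ : hom (oe (opr x)) (oe (opr y)), M (sval c) θ.
Proof. by apply/M_opsP; rewrite !oprK; exact: (proj2_sig c). Qed.
Definition strict_map (x y : X0 E) (c : xhom x y) := sval (cid (strict_hom_exists c)).
Lemma strict_mapP (x y : X0 E) (c : xhom x y) : M (sval c) (strict_map c).
Proof. exact: (proj2_sig (cid (strict_hom_exists c))). Qed.
Lemma strict_map_uniq (x y : X0 E) (c : xhom x y) θ : M (sval c) θ -> strict_map c = θ.
Proof. exact: M_uniq (strict_mapP c). Qed.

Definition strict_functor : functor (xcat E) G.
Proof.
refine (@Functor (xcat E) G (fun x => oe (opr x)) strict_map _ _).
- by move=> x; apply: strict_map_uniq; exact: M_id.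
- move=> x y z g f; apply: strict_map_uniq.
  by apply: M_comp; exact: strict_mapP.
Defined.

Lemma strict_mul_exists (x y : X0 E) :
  exists θ : hom (oe (opr x) ⊗ oe (opr y)) (oe (opr (x * y))),
    @M 1 (op_mul (opr x) (opr y)) (opr (x * y)) θ.
Proof.
have /opcP [θ m] : opc (op_mul (opr x) (opr y)) = opc (opr (x * y)).
  by rewrite oprK opcM !oprK.
by exists θ.
Qed.
Definition strict_mul (x y : X0 E) := sval (cid (strict_mul_exists x y)).
Lemma strict_mulP (x y : X0 E) :
  @M 1 (op_mul (opr x) (opr y)) (opr (x * y)) (strict_mul x y).
Proof. exact: (proj2_sig (cid (strict_mul_exists x y))). Qed.
Lemma strict_one_exists : exists θ : hom (munit G) (oe (opr (1 : X0 E))),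
  @M 1 (op_d 1) (opr (1 : X0 E)) θ.
Proof.
have /opcP [θ m] : opc (op_d 1) = opc (opr (1 : X0 E)) by rewrite oprK.
by exists θ.
Qed.
Definition strict_one := sval (cid strict_one_exists).
Lemma strict_oneP : @M 1 (op_d 1) (opr (1 : X0 E)) strict_one.
Proof. exact: (proj2_sig (cid strict_one_exists)). Qed.

Arguments M_id x : clear implicits.
Arguments M_ass x y z : clear implicits.
Arguments M_lun x : clear implicits.
Arguments M_run x : clear implicits.
Arguments strict_mulP x y : clear implicits.
Arguments strict_oneP : clear implicits.
Arguments strict_mapP {x y} c.

Definition strict_tensor : tensorFunctor (xmonoidal E) G.
Proof.
refine (@TensorFunctor (xmonoidal E) G strict_functor strict_mul strict_one _ _ _ _ _ _).
- by move=> *; exact: gmon_groupoid.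
- exact: gmon_groupoid.
- move=> x y x' y' f g.
  have m1 := M_comp (strict_mulP x' y') (M_mul (strict_mapP f) (strict_mapP g)).
  have m2 := M_comp (strict_mapP (@tensm (xmonoidal E) _ _ _ _ f g)) (strict_mulP x y).
  by apply: M_uniq m1 _; apply: M_congr m2; rewrite mulg1 mul1g.
- move=> x y z.
  have m1 := M_comp (strict_mapP (@ass (xmonoidal E) x y z))
    (M_comp (strict_mulP x (y * z)) (M_mul (M_id (opr x)) (strict_mulP y z))).
  have m2 := M_comp (strict_mulP (x * y) z)
    (M_comp (M_mul (strict_mulP x y) (M_id (opr z))) (M_ass (opr x) (opr y) (opr z))).
  rewrite /= -!compA; apply: M_uniq m1 _; apply: M_congr m2.
  by rewrite /= !act1op !mulg1.
- move=> x.
  have m1 := M_comp (strict_mapP (@lun (xmonoidal E) x))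
    (M_comp (strict_mulP 1 x) (M_mul strict_oneP (M_id (opr x)))).
  rewrite /= -!compA; apply: M_uniq (M_lun (opr x)); apply: M_congr m1.
  by rewrite /= !act1op !mulg1.
- move=> x.
  have m1 := M_comp (strict_mapP (@run (xmonoidal E) x))
    (M_comp (strict_mulP x 1) (M_mul (M_id (opr x)) strict_oneP)).
  rewrite /= -!compA; apply: M_uniq (M_run (opr x)); apply: M_congr m1.
  by rewrite /= !act1op !mulg1.
Defined.

Lemma strict_faithful (x y : xmonoidal E) (f g : hom x y) :
  fmap strict_tensor f = fmap strict_tensor g -> f = g.
Proof.
move=> e; apply: sig_prop_inj; apply: M_aut_uniq (strict_mapP f) _.
rewrite [strict_map f]e; exact: strict_mapP.
Qed.
Lemma strict_full (x y : xmonoidal E) (h : hom (strict_tensor x) (strict_tensor y)) :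
  exists f, fmap strict_tensor f = h.
Proof.
have [c m] := M_ex (x := opr x) (y := opr y) h.
have p : x = y * ops_d c :> X0 E.
  by rewrite -(oprK x) -(oprK y); apply/M_opsP; exists h.
by exists (exist _ c p); apply: strict_map_uniq.
Qed.
Lemma strict_surj (Z : G) : exists x, inhabited (hom (strict_tensor x) Z).
Proof.
pose pick (X Y : G) (p : inhabited (hom X Y)) : hom X Y :=
  sval (cid (let: inhabits f := p in ex_intro (fun _ => True) f I)).
(* Any object becomes an operator once a morphism is chosen in each nonempty hom set
   [Z ⊗ Φ i -> Φ j]. *)
have [x xZ] : exists x : op, oe x = Z.
  pose U i j (h : hom (Z ⊗ Φ i) (Φ j)) := exists p, h = pick _ _ p.
  have U1 i j : hom (Z ⊗ Φ i) (Φ j) -> exists h, U i j h.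
    by move=> h; exists (pick _ _ (inhabits h)); exists (inhabits h).
  have U2 i j (h h' : hom (Z ⊗ Φ i) (Φ j)) : U _ _ h -> U _ _ h' -> h = h'.
    by move=> [p ->] [p' ->]; rewrite (Prop_irrelevance p p').
  by exists (Op U1 U2).
by exists (opc x); have [θ _] := opr_c x; rewrite -xZ.
Qed.
End Strictification.

(** * Composition of tensor functors *)

Lemma fmap_iso (C D : category) (F : functor C D) (X Y : C) (f : hom X Y) :
  is_iso f -> is_iso (fmap F f).
Proof.
by move=> [g [gf fg]]; exists (fmap F g); rewrite -!fmap_comp gf fg !fmap_id.
Qed.

Section TensorFunctor.
Variables (M N : monoidal) (f : tensorFunctor M N).
Lemma tmul_natl X X' Y (a : hom X X') :
  tmul f X' Y ∘ fmap f a ⊠ idm (f Y) = fmap f (a ⊠ idm Y) ∘ tmul f X Y.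
Proof. by rewrite -tmul_nat fmap_id. Qed.
Lemma tmul_natr X Y Y' (a : hom Y Y') :
  tmul f X Y' ∘ idm (f X) ⊠ fmap f a = fmap f (idm X ⊠ a) ∘ tmul f X Y.
Proof. by rewrite -tmul_nat fmap_id. Qed.
End TensorFunctor.

Section CompTensor.
Variables (M N K : monoidal) (g : tensorFunctor N K) (f : tensorFunctor M N).
Definition cmul X Y := fmap g (tmul f X Y) ∘ tmul g (f X) (f Y).
Definition cone := fmap g (tone f) ∘ tone g.

Lemma cmul_ass X Y Z :
  fmap g (fmap f (ass X Y Z)) ∘ cmul X (Y ⊗ Z) ∘ idm (g (f X)) ⊠ cmul Y Z =
  cmul (X ⊗ Y) Z ∘ cmul X Y ⊠ idm (g (f Z)) ∘ ass (g (f X)) (g (f Y)) (g (f Z)).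
Proof.
rewrite /cmul tens1l tens1r -!compA (compA (tmul g _ _)) tmul_natr.
rewrite [in RHS](compA (tmul g _ _)) tmul_natl !compA -!fmap_comp tmul_ass.
rewrite [in LHS]fmap_comp -!compA; congr (_ ∘ _).
by have := tmul_ass g (f X) (f Y) (f Z); rewrite -!compA.
Qed.
Lemma cone_lun X : fmap g (fmap f (lun X)) ∘ cmul (munit M) X ∘
  cone ⊠ idm (g (f X)) = lun (g (f X)).
Proof.
rewrite /cmul /cone tens1r -!compA (compA (tmul g _ _)) tmul_natl !compA.
by rewrite -!fmap_comp tone_lun tone_lun.
Qed.
Lemma cone_run X : fmap g (fmap f (run X)) ∘ cmul X (munit M) ∘
  idm (g (f X)) ⊠ cone = run (g (f X)).
Proof.
rewrite /cmul /cone tens1l -!compA (compA (tmul g _ _)) tmul_natr !compA.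
by rewrite -!fmap_comp tone_run tone_run.
Qed.

Definition comp_tensor : tensorFunctor M K.
Proof.
refine (@TensorFunctor M K (comp_functor g f) cmul cone _ _ _ cmul_ass
  cone_lun cone_run).
- move=> X Y; apply: is_iso_comp; last exact: tmul_iso.
  by apply: fmap_iso; exact: tmul_iso.
- apply: is_iso_comp; last exact: tone_iso.
  by apply: fmap_iso; exact: tone_iso.
- move=> X Y X' Y' a b; rewrite /cmul -compA tmul_nat !compA -!fmap_comp.
  by rewrite tmul_nat.
Defined.
End CompTensor.

(** * Transport of a determinant functor to a crossed module *)

Lemma xtens_idl (E : xmod) (x y y' : xmonoidal E) (f : hom y y') :
  sval (idm x ⊠ f) = sval f.
Proof. by rewrite /= xact1 mul1g. Qed.
Lemma xtens_idr (E : xmod) (x x' y : xmonoidal E) (f : hom x x') :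
  sval (f ⊠ idm y) = sval f ◃ y.
Proof. exact: mulg1. Qed.

Section Factorizations.
Variable S : setting.

Lemma comp_factorization (V N K : monoidal) (d : det_data S V) (d1 : det_data S N)
    (d2 : det_data S K) (f : tensorFunctor V N) (g : tensorFunctor N K)
    (a : forall X, hom (f (det_ob d X)) (det_ob d1 X))
    (b : forall X, hom (g (det_ob d1 X)) (det_ob d2 X)) :
  is_factorization a -> is_factorization b ->
  is_factorization (f := comp_tensor g f) (d := d) (d' := d2)
    (fun X => b X ∘ fmap g (a X)).
Proof.
move=> [am aT] [bm bT]; split=> [X X' h|X Y C D] /=.
  by rewrite -compA -fmap_comp am fmap_comp !compA bm.
rewrite /cmul !compA -(compA (b Y)) -fmap_comp -(compA (b Y)) -fmap_comp aT.
rewrite fmap_comp -!compA -tmul_nat (compA (fmap g (det_tri d1 D))) compA (compA (b Y)).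
by rewrite bT -!compA -tensm_comp.
Qed.
End Factorizations.

Section Transport.
Variables (S : setting) (coh : coherent S) (G : catGroup) (d : det_data S G).
Hypothesis dP : is_nc_det d.
Notation E := (strict_xmod G).
Notation F := (strict_tensor G).
Notation B := (seqv S).

(** The triangle [D0] gives [det 0 ⊗ det 0 -> det 0], hence an isomorphism [ρ] from the unit to
    [det 0]. Lifting the zero object along [ρ] makes the value of [D0] trivial. *)
Lemma zero_lift : exists D0 : stri (szero S) (szero S) (szero S),
  [/\ striL D0,
      forall (X : B) (D : stri X X (szero S)), striL D -> sstair D D D D0,
      forall (X : B) (D : stri (szero S) X X), striR D -> sstair D0 D D D
    & exists ζ : hom (F (1 : X0 E)) (det_ob d (szero S)),
      ζ ∘ fmap F (@run (xmonoidal E) 1) ∘ tmul F 1 1 = det_tri d D0 ∘ ζ ⊠ ζ].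
Proof.
have [D0 [L0 sL sR]] := coh_zero coh; exists D0; split=> //.
have [ρ hρ] := tens_full (inv (det_tri d D0) ∘ run (det_ob d (szero S))).
exists (ρ ∘ inv (tone F)); set t := inv (tone F).
have -> : (ρ ∘ t) ⊠ (ρ ∘ t) = idm _ ⊠ ρ ∘ ρ ⊠ idm _ ∘ t ⊠ t.
  by rewrite tens_rl -tensm_comp.
rewrite hρ !compA invr comp1m run_nat -!compA; congr (_ ∘ _).
have h := tone_run F (1 : X0 E).
rewrite -[t ⊠ t]tens_lr (compA (run _)) run_nat -compA; congr (_ ∘ _).
rewrite -h -!compA -tens1l invr tensm_id compm1.
by [].
Qed.

(** The value at the zero object is prescribed exactly, and not merely up to isomorphism, because
    [so_zero] is an equality in [E_0]. *)
Lemma lift_exists (D0 : stri (szero S) (szero S) (szero S))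
    (ζ0 : hom (F (1 : X0 E)) (det_ob d (szero S))) :
  exists ζ : forall X : B, {x : X0 E & hom (F x) (det_ob d X)},
    ζ (szero S) = existT _ (1 : X0 E) ζ0.
Proof.
have h X : exists p : {x : X0 E & hom (F x) (det_ob d X)},
    forall e : szero S = X, p = eq_rect _
      (fun X => {x : X0 E & hom (F x) (det_ob d X)}) (existT _ (1 : X0 E) ζ0) _ e.
  have [e|n] := pselect (szero S = X).
    by subst X; exists (existT _ (1 : X0 E) ζ0) => e; rewrite (Prop_irrelevance e erefl).
  have [x [f]] := strict_surj (det_ob d X).
  by exists (existT _ x f) => e; case: n.
exists (fun X => sval (cid (h X))); case: cid => p hp /=.
exact: (hp erefl).
Qed.

Lemma transport : exists (s : sdet S E)
    (ζ : forall X : B, hom (F (so s X)) (det_ob d X)),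
  is_factorization (d := xdet s) (d' := d) (f := F) ζ.
Proof.
have [dI dM dE dS] := dP.
have [D0 [L0 sL sR [ζ0 h0]]] := zero_lift.
have [p pz] := lift_exists D0 ζ0.
pose e X : X0 E := projT1 (p X); pose ζ X : hom (F (e X)) (det_ob d X) := projT2 (p X).
have m_ex X X' (h : @hom B X X') :
    exists f : @hom (xmonoidal E) (e X) (e X'), ζ X' ∘ fmap F f = det_mor d h ∘ ζ X.
  have [f hf] := strict_full (inv (ζ X') ∘ (det_mor d h ∘ ζ X)).
  by exists f; rewrite hf compVK.
have t_ex X Y C (D : stri X Y C) :
    exists f : @hom (xmonoidal E) ((e C : X0 E) * e X)%g (e Y),
      ζ Y ∘ fmap F f ∘ tmul F (e C) (e X) = det_tri d D ∘ ζ C ⊠ ζ X.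
  have [f hf] := strict_full (inv (ζ Y) ∘ (det_tri d D ∘ ζ C ⊠ ζ X) ∘
    inv (tmul F (e C) (e X))).
  by exists f; rewrite hf !compA invr comp1m VKcomp.
pose m X X' h := sval (cid (m_ex X X' h)).
have mP X X' h : ζ X' ∘ fmap F (m X X' h) = det_mor d h ∘ ζ X.
  exact: (proj2_sig (cid (m_ex X X' h))).
pose t X Y C D := sval (cid (t_ex X Y C D)).
have tP X Y C D : ζ Y ∘ fmap F (t X Y C D) ∘ tmul F (e C) (e X) =
    det_tri d D ∘ ζ C ⊠ ζ X.
  exact: (proj2_sig (cid (t_ex X Y C D))).
have faith x Y (f f' : @hom (xmonoidal E) x (e Y)) :
    ζ Y ∘ fmap F f = ζ Y ∘ fmap F f' -> sval f = sval f'.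
  by move=> /compI /strict_faithful ->.
have e0 : e (szero S) = 1 by rewrite /e pz.
have t0 : sval (t _ _ _ D0) = 1.
  (* Generalizing over the pair chosen at the zero object allows its known value to be substituted
     under the dependent types. *)
  suff h (u : {x : X0 E & hom (F x) (det_ob d (szero S))})
      (f : @hom (xmonoidal E) ((projT1 u : X0 E) * projT1 u)%g (projT1 u)) :
      u = existT _ (1 : X0 E) ζ0 ->
      projT2 u ∘ fmap F f ∘ tmul F _ _ = det_tri d D0 ∘ projT2 u ⊠ projT2 u ->
      sval f = 1.
    exact: h pz (tP _ _ _ D0).
  move=> eu; subst u; rewrite /= -h0 => /Icomp /compI /strict_faithful ->.
  by [].
clearbody m t; clearbody ζ; clearbody e.
have tE X Y C X' Y' C' (D : stri X Y C) (D' : stri X' Y' C') (a : @hom B X X')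
    (b : @hom B Y Y') (c : @hom B C C') : striE D D' a b c ->
    sval (t _ _ _ D') * ((sval (m _ _ c) ◃ e X') * sval (m _ _ a)) =
    sval (m _ _ b) * sval (t _ _ _ D).
  move=> /dE h.
  apply: (faith _ _ (t _ _ _ D' ∘ @tensm (xmonoidal E) _ _ _ _ (m _ _ c) (m _ _ a))
    (m _ _ b ∘ t _ _ _ D)).
  apply: (@Icomp _ _ _ _ (tmul F _ _)).
  rewrite !fmap_comp -!compA -tmul_nat !compA tP -compA -tensm_comp !mP tensm_comp.
  by rewrite compA h -compA -tP !compA.
have tS X Y Z Cf Cg Cgf (Df : stri X Y Cf) (Dg : stri Y Z Cg)
    (Dgf : stri X Z Cgf) (Dt : stri Cf Cgf Cg) : sstair Df Dg Dgf Dt ->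
    sval (t _ _ _ Dg) * sval (t _ _ _ Df) =
    sval (t _ _ _ Dgf) * (sval (t _ _ _ Dt) ◃ e X).
  move=> /dS h.
  pose f : @hom (xmonoidal E) _ (e Z) :=
    t _ _ _ Dg ∘ @tensm (xmonoidal E) _ _ _ _ (idm (e Cg : xmonoidal E)) (t _ _ _ Df).
  pose f' : @hom (xmonoidal E) _ (e Z) :=
    t _ _ _ Dgf ∘ @tensm (xmonoidal E) _ _ _ _ (t _ _ _ Dt) (idm (e X : xmonoidal E))
      ∘ @ass (xmonoidal E) (e Cg) (e Cf) (e X).
  have -> : sval (t _ _ _ Dg) * sval (t _ _ _ Df) = sval f.
    by rewrite -(@xtens_idl E (e Cg) _ _ (t _ _ _ Df)).
  have -> : sval (t _ _ _ Dgf) * (sval (t _ _ _ Dt) ◃ e X) = sval f'.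
    by rewrite -(@xtens_idr E _ _ (e X) (t _ _ _ Dt)) -[LHS]mulg1.
  apply: faith; apply: (@Icomp _ _ _ _ (tmul F _ _)).
  apply: (@Icomp _ _ _ _ (idm _ ⊠ tmul F _ _)).
  rewrite /f /f' !fmap_comp.
  transitivity (det_tri d Dg ∘ (ζ Cg ⊠ (det_tri d Df ∘ ζ Cf ⊠ ζ X))).
    rewrite -!compA (compA (fmap F (_ ⊠ _))) -tmul_natr -!compA -tens1l !compA tP.
    by rewrite -compA -tensm_comp compm1 compA tP.
  have -> : det_tri d Dg ∘ ζ Cg ⊠ (det_tri d Df ∘ ζ Cf ⊠ ζ X) =
      det_tri d Dgf ∘ (det_tri d Dt ∘ ζ Cg ⊠ ζ Cf) ⊠ ζ X ∘ ass _ _ _.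
    rewrite -(tens_rl (ζ Cg)) tens1l -!compA tens_rl !compA h -!compA ass_nat.
    have -> : (det_tri d Dt ∘ ζ Cg ⊠ ζ Cf) ⊠ ζ X =
        det_tri d Dt ⊠ idm _ ∘ (ζ Cg ⊠ ζ Cf) ⊠ ζ X by rewrite -tensm_comp comp1m.
    by rewrite !compA.
  rewrite -!compA; have := tmul_ass F (e Cg) (e Cf) (e X); rewrite -!compA => ->.
  rewrite (compA (fmap F (_ ⊠ _))) -tmul_natl -!compA (compA (_ ⊠ _)) -tens1r.
  by rewrite !compA tP -(compA _ (ζ _ ⊠ ζ _)) -tensm_comp compm1 compA tP.
pose s := @SDet S E e (fun X X' h => sval (m X X' h)) (fun X Y C D => sval (t X Y C D))
  (fun X X' h => proj2_sig (m X X' h)) (fun X Y C D => proj2_sig (t X Y C D)).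
have mI X : sval (m _ _ (@idm B X)) = 1.
  apply: (faith _ _ _ (idm (e X : xmonoidal E))).
  by rewrite mP dI comp1m fmap_id compm1.
have mM X Y Z (h : @hom B Y Z) (f : @hom B X Y) :
    sval (m _ _ (h ∘ f)) = sval (m _ _ h) * sval (m _ _ f).
  apply: (faith _ _ _ (m _ _ h ∘ m _ _ f)).
  by rewrite mP dM fmap_comp compA mP -!compA mP.
(* The staircase made of [D] three times and of [D0] says that the value of [D] is idempotent, hence
   trivial; likewise for [tR], where the action of [e (szero S) = 1] is trivial. *)
have tL X (D : stri X X (szero S)) : striL D -> sval (t _ _ _ D) = 1.
  move=> /sL /tS; rewrite t0 xact1 mulg1 => h.
  by apply: (mulgI (sval (t _ _ _ D))); rewrite h mulg1.
have tR X (D : stri (szero S) X X) : striR D -> sval (t _ _ _ D) = 1.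
  move=> /sR /tS; rewrite t0; move: (sval (t _ _ _ D)) => c.
  by rewrite e0 xact_1 => /mulgI.
exists (s mI mM tE tS e0 tL tR), ζ; split=> [X X' h|X Y C D].
  by rewrite -mP; congr (_ ∘ fmap F _); exact: sig_prop_inj.
by rewrite -tP; congr (_ ∘ fmap F _ ∘ _); exact: sig_prop_inj.
Qed.
End Transport.

Lemma nc_factor (S : setting) (coh : coherent S) (G : catGroup) (d : det_data S G) :
  is_nc_det d -> exists (f : tensorFunctor (Gamma (Dmod S)) G)
    (a : forall X, hom (f (det_ob (Ddet S) X)) (det_ob d X)), is_factorization a.
Proof.
move=> dP; have [s [ζ ζP]] := transport coh dP.
eexists; eexists; exact: comp_factorization (sec_factorization coh s) ζP.
Qed.

(** * Morphisms out of a presented module are determined by the generators *)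

Lemma existT_inj (A : Type) (P : A -> Type) (x : A) (u v : P x) :
  existT P x u = existT P x v -> u = v.
Proof.
move=> e; have h : forall (s : {x & P x}) (e : existT P x u = s),
    eq_rect x P u (projT1 s) (congr1 (@projT1 A P) e) = projT2 s.
  by move=> s e'; subst s.
by have := h _ e; rewrite (Prop_irrelevance (congr1 (@projT1 A P) e) (erefl x)).
Qed.

Lemma sqm_hom_ext (P : presentation) (M : sqm) (h h' : sqm_hom (presented P) M) :
  (forall g, sh0 h (pclass0 (W0gen g)) = sh0 h' (pclass0 (W0gen g))) ->
  (forall e, sh1 h (pclass1 (W1gen e)) = sh1 h' (pclass1 (W1gen e))) ->
  sh0 h =1 sh0 h' /\ sh1 h =1 sh1 h'.
Proof.
move=> e0 e1.
have E0 x : sh0 h x = sh0 h' x.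
  have [a ->] := cls0W x; elim: a => [g||a IHa b IHb|a IHa].
  - exact: e0.
  - by rewrite [cls0 _]/(1 : C0 (presented P)) !(morph_one (@sh0M _ _ _)).
  - by rewrite -pmul0M !(sh0M _ (cls0 a : C0 (presented P))) IHa IHb.
  - by rewrite -pinv0M !(morph_inv (@sh0M _ _ _) (cls0 a : C0 (presented P))) IHa.
split=> // x; have [s ->] := cls1W x; elim: s => [e||s IHs t IHt|s IHs|a b].
- exact: e1.
- by rewrite [cls1 _]/(1 : C1 (presented P)) !(morph_one (@sh1M _ _ _)).
- by rewrite -pmul1M !(sh1M _ (cls1 s : C1 (presented P))) IHs IHt.
- by rewrite -pinv1M !(morph_inv (@sh1M _ _ _) (cls1 s : C1 (presented P))) IHs.
- by rewrite -pres_brE !(sh_br _ (cls0 a : C0 (presented P))) !E0.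
Qed.

(** * Comparison of tensor functors *)

Section Comparison.
Variables (D : sqm) (G : catGroup) (f f' : tensorFunctor (Gamma D) G).
Notation V := (Gamma D).

(* These pairs form a group over D_0; a tensor transformation from f to f' is a
   homomorphic section of it which is compatible with cd below. *)
Definition cmp : Type := {x : V & hom (f x) (f' x)}.
HB.instance Definition _ := gen_eqMixin cmp.
HB.instance Definition _ := gen_choiceMixin cmp.

Definition mkc (x : V) (θ : hom (f x) (f' x)) : cmp := existT _ x θ.

Lemma mkc_inj x (θ η : hom (f x) (f' x)) : mkc θ = mkc η -> θ = η.
Proof. exact: existT_inj. Qed.

Definition geq (x y : V) (p : x = y) : hom x y := @Gamma_eq D x y p.
(** Objects such as [x + (y + z)] and [(x + y) + z] are equal but not convertible; equality of pairs
    over them is naturality against the structural isomorphism. *)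
Lemma cmp_eq (x y : V) (p : x = y) (θ : hom (f x) (f' x)) (η : hom (f y) (f' y)) :
  η ∘ fmap f (geq p) = fmap f' (geq p) ∘ θ -> existT _ x θ = existT _ y η :> cmp.
Proof.
subst y; have -> : geq erefl = idm x by exact: Gamma_hom_inj.
by rewrite !fmap_id compm1 comp1m => ->.
Qed.

Lemma cmp_tens_exists (x y : V) (a : hom (f x) (f' x)) (b : hom (f y) (f' y)) :
  exists c, c ∘ tmul f x y = tmul f' x y ∘ (a ⊠ b).
Proof. by exists (tmul f' x y ∘ (a ⊠ b) ∘ inv (tmul f x y)); rewrite VKcomp. Qed.
Definition cmp_tens x y (a : hom (f x) (f' x)) (b : hom (f y) (f' y)) :
    hom (f (x ⊗ y)) (f' (x ⊗ y)) := sval (cid (cmp_tens_exists a b)).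
Lemma cmp_tensE x y (a : hom (f x) (f' x)) (b : hom (f y) (f' y)) :
  cmp_tens a b ∘ tmul f x y = tmul f' x y ∘ (a ⊠ b).
Proof. exact: (proj2_sig (cid (cmp_tens_exists a b))). Qed.
Lemma cmp_tens_uniq x y (a : hom (f x) (f' x)) (b : hom (f y) (f' y)) c :
  c ∘ tmul f x y = tmul f' x y ∘ (a ⊠ b) -> c = cmp_tens a b.
Proof. by rewrite -cmp_tensE => /Icomp. Qed.

Definition cmp_mul (u v : cmp) : cmp :=
  existT _ (projT1 u ⊗ projT1 v) (cmp_tens (projT2 u) (projT2 v)).
Lemma cmp_unit_exists : exists c, c ∘ tone f = tone f'.
Proof. by exists (tone f' ∘ inv (tone f)); rewrite VKcomp. Qed.
Definition cmp_unit : hom (f (munit V)) (f' (munit V)) := sval (cid cmp_unit_exists).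
Definition cmp_one : cmp := existT _ (munit V) cmp_unit.
Lemma cmp_unitE : cmp_unit ∘ tone f = tone f'.
Proof. exact: (proj2_sig (cid cmp_unit_exists)). Qed.

Lemma cmp_mulA : associative cmp_mul.
Proof.
move=> [x a] [y b] [z c]; apply: (cmp_eq (p := mulgA _ _ _)) => /=.
have h := tmul_ass f x y z; have h' := tmul_ass f' x y z.
apply: (@Icomp _ _ _ _ (tmul f _ _)); apply: (@Icomp _ _ _ _ (idm _ ⊠ tmul f y z)).
rewrite -!compA (compA (fmap f _)) [X in _ ∘ X]h !compA !cmp_tensE.
rewrite -!compA (compA (_ ⊠ _) (_ ⊠ _)) -tensm_comp cmp_tensE compm1.
rewrite -[c]comp1m tensm_comp -!compA -ass_nat !compA -h' -!compA.
congr (_ ∘ _); rewrite !compA cmp_tensE -!compA; congr (_ ∘ _).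
by rewrite -!tensm_comp compm1 !comp1m cmp_tensE.
Qed.

Lemma cmp_mul1l : left_id cmp_one cmp_mul.
Proof.
move=> [x a]; apply: (cmp_eq (p := mul1g _)) => /=.
have h := tone_lun f x; have h' := tone_lun f' x.
apply: (@Icomp _ _ _ _ (tmul f _ _)); apply: (@Icomp _ _ _ _ (tone f ⊠ idm _)).
rewrite -!compA (compA (fmap f _)) [X in _ ∘ X]h -lun_nat -[lun (f' x)]h' -!compA.
congr (_ ∘ _); rewrite !compA cmp_tensE -!compA; congr (_ ∘ _).
by rewrite -!tensm_comp compm1 comp1m cmp_unitE compm1.
Qed.
Lemma cmp_mul1r : right_id cmp_one cmp_mul.
Proof.
move=> [x a]; apply: (cmp_eq (p := mulg1 _)) => /=.
have h := tone_run f x; have h' := tone_run f' x.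
apply: (@Icomp _ _ _ _ (tmul f _ _)); apply: (@Icomp _ _ _ _ (idm _ ⊠ tone f)).
rewrite -!compA (compA (fmap f _)) [X in _ ∘ X]h -run_nat -[run (f' x)]h' -!compA.
congr (_ ∘ _); rewrite !compA cmp_tensE -!compA; congr (_ ∘ _).
by rewrite -!tensm_comp compm1 comp1m cmp_unitE compm1.
Qed.

Lemma cmp_inv_exists (u : cmp) : exists v, cmp_mul u v = cmp_one.
Proof.
case: u => [x a]; pose p : x ⊗ ((x : C0 D)^-1 : V) = munit V := mulgV _.
have [b hb] := tens_full (inv (a ⊠ idm _) ∘ (inv (tmul f' _ _) ∘
  (inv (fmap f' (geq p)) ∘ (cmp_unit ∘ (fmap f (geq p) ∘ tmul f _ _))))).
exists (existT _ ((x : C0 D)^-1 : V) b); apply: (cmp_eq (p := p)) => /=.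
apply: (@Icomp _ _ _ _ (tmul f _ _)); rewrite -!compA cmp_tensE.
by rewrite -tens_lr hb !compVK.
Qed.
Definition cmp_inv (u : cmp) := sval (cid (cmp_inv_exists u)).
Lemma cmp_mulVr : right_inverse cmp_one cmp_inv cmp_mul.
Proof. by move=> u; exact: (proj2_sig (cid (cmp_inv_exists u))). Qed.
Lemma cmp_mulVl : left_inverse cmp_one cmp_inv cmp_mul.
Proof.
move=> u; rewrite -[LHS]cmp_mul1r -(cmp_mulVr (cmp_inv u)) -cmp_mulA.
by rewrite (cmp_mulA u) cmp_mulVr cmp_mul1l.
Qed.
HB.instance Definition _ :=
  isGroup.Build cmp cmp_mulA cmp_mul1l cmp_mul1r cmp_mulVl cmp_mulVr.

Definition cob (u : cmp) : C0 D := projT1 u.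
Lemma cobM : {morph cob : u v / u * v}. Proof. by []. Qed.

(** ** The boundary of a comparison *)

Lemma cd_subproof (c : C1 D) : bd c == 1 * bd c.
Proof. by rewrite mul1g. Qed.
Definition cto (c : C1 D) : @hom V (bd c) (1 : C0 D) := exist _ c (cd_subproof c).
(** The comparison at [bd c] forced by naturality against the morphism [cto c] to the unit, where
    the comparison must be [cmp_unit]. *)
Definition cd (c : C1 D) : cmp :=
  existT _ (bd c : V) (inv (fmap f' (cto c)) ∘ (cmp_unit ∘ fmap f (cto c))).

Lemma cd_uniq c (x : V) (θ : hom (f x) (f' x)) (m : @hom V x (1 : C0 D)) :
  sval m = c -> fmap f' m ∘ θ = cmp_unit ∘ fmap f m -> cd c = mkc θ.
Proof.
move=> mc; have p : bd c = x by rewrite (eqP (proj2_sig m)) mc mul1g.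
subst x; have -> : m = cto c by exact: Gamma_hom_inj.
by move=> h; rewrite /cd -h compK.
Qed.

(** Transport along [k] is multiplication by [cd (sval k)], because [k] is the tensor product of an
    identity with [cto]. Thus naturality of a transformation becomes an equation in the group of
    comparisons. *)
Lemma mul_cd (x y : V) (η : hom (f y) (f' y)) (k : hom x y) :
  mkc η * cd (sval k) = mkc (inv (fmap f' k) ∘ (η ∘ fmap f k)).
Proof.
case: k => c /= kP; have p : (y : C0 D) * bd c = x by rewrite (eqP kP).
subst x; set k := exist _ c kP; congr mkc; symmetry; apply: cmp_tens_uniq.
apply: (@compI _ _ _ _ (fmap f' k)).
have kE : k = @run V y ∘ idm (y : V) ⊠ cto c.
  by apply: Gamma_hom_inj; rewrite /= act_1 !mul1g.
have E1 : fmap f k ∘ tmul f _ _ = run (f y) ∘ idm _ ⊠ (inv (tone f) ∘ fmap f (cto c)).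
  rewrite kE fmap_comp -compA -tmul_natr -tone_run -!compA; congr (_ ∘ (_ ∘ _)).
  by rewrite -tens1l compVK.
have E2 : fmap f' k ∘ tmul f' _ _ = run (f' y) ∘ idm _ ⊠ (inv (tone f') ∘ fmap f' (cto c)).
  rewrite kE fmap_comp -compA -tmul_natr -tone_run -!compA; congr (_ ∘ (_ ∘ _)).
  by rewrite -tens1l compVK.
rewrite [RHS]compA E2 -!compA compVK E1 -tensm_comp comp1m /= -!compA compVK.
rewrite compA -run_nat -!compA; congr (_ ∘ _); rewrite tens_lr.
by congr (_ ⊠ _); apply: (@compI _ _ _ _ (tone f')); rewrite -{1}cmp_unitE -!compA !compVK.
Qed.

Lemma cdM : {morph cd : c c' / c * c'}.
Proof.
move=> c c'; have kP : (bd c : C0 D) * bd c' == bd c * bd c' by [].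
pose k : @hom V ((bd c : C0 D) * bd c') (bd c) := exist _ c' kP.
transitivity (mkc (inv (fmap f' k) ∘ (inv (fmap f' (cto c)) ∘
    (cmp_unit ∘ fmap f (cto c)) ∘ fmap f k))); last by rewrite -mul_cd.
apply: (cd_uniq (m := cto c ∘ k)) => //.
by rewrite !fmap_comp -!compA compVK compVK.
Qed.
Lemma cdV c : cd c^-1 = (cd c)^-1. Proof. exact: (morph_inv cdM). Qed.
Lemma cd1 : cd 1 = 1. Proof. exact: (morph_one cdM). Qed.

Lemma mul_cd_act (u : cmp) c : u * cd (act c (cob u)) = cd c * u.
Proof.
case: u => x a; rewrite /cob /=.
have kP : (bd c : C0 D) * x == (x : C0 D) * bd (act c x) by rewrite bd_act -conjgC.
pose k : @hom V ((bd c : C0 D) * x) x := exist _ (act c x) kP.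
have kE : k = @lun V x ∘ cto c ⊠ idm (x : V).
  by apply: Gamma_hom_inj; rewrite /= mulg1 mul1g.
have -> : mkc a * cd (act c x) = mkc (inv (fmap f' k) ∘ (a ∘ fmap f k)).
  exact: (mul_cd a k).
congr mkc; apply: cmp_tens_uniq; apply: (@compI _ _ _ _ (fmap f' k)).
have E1 : fmap f k ∘ tmul f _ _ = lun (f x) ∘ (inv (tone f) ∘ fmap f (cto c)) ⊠ idm _.
  rewrite kE fmap_comp -compA -tmul_natl -tone_lun -!compA; congr (_ ∘ (_ ∘ _)).
  by rewrite -tens1r compVK.
have E2 : fmap f' k ∘ tmul f' _ _ = lun (f' x) ∘ (inv (tone f') ∘ fmap f' (cto c)) ⊠ idm _.
  rewrite kE fmap_comp -compA -tmul_natl -tone_lun -!compA; congr (_ ∘ (_ ∘ _)).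
  by rewrite -tens1r compVK.
rewrite [RHS]compA E2 -!compA compVK E1 -tensm_comp comp1m /= -!compA compVK.
rewrite compA -lun_nat -!compA; congr (_ ∘ _); rewrite tens_rl.
by congr (_ ⊠ _); apply: (@compI _ _ _ _ (tone f')); rewrite -{1}cmp_unitE -!compA !compVK.
Qed.
Lemma cd_act (u : cmp) c : cd (act c (cob u)) = cd c ^ u.
Proof. by apply: (mulgI u); rewrite mul_cd_act -conjgC. Qed.
End Comparison.

(** * Comparison of two factorizations of one determinant functor *)

Section ComparisonDet.
Variables (S : setting) (coh : coherent S) (G : catGroup).
Notation V := (Gamma (Dmod S)).
Notation D := (Dmod S).
Variables (f f' : tensorFunctor V G) (d : det_data S G).
Variables (a : forall X, hom (f (det_ob (Ddet S) X)) (det_ob d X))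
  (a' : forall X, hom (f' (det_ob (Ddet S) X)) (det_ob d X)).
Hypothesis (aP : is_factorization a) (aP' : is_factorization a').
Notation A := (cmp f f').
Notation cd := (@cd D G f f').

(** The value on generators forced by the condition [a X = a' X ∘ b (Dob X)]. *)
Definition cgen (X : seqv S) : A :=
  @mkc D G f f' (Dob X) (inv (a' X) ∘ a X).

Lemma cgen_mor X X' (h : @hom (seqv S) X X') : cgen X = cgen X' * cd (Deqv h).
Proof.
rewrite [RHS](mul_cd (inv (a' X') ∘ a X') (det_mor (Ddet S) h)); congr mkc.
apply: (@compI _ _ _ _ (fmap f' (det_mor (Ddet S) h))).
apply: (@compI _ _ _ _ (a' X')); rewrite compVK -!compA compVK aP.1.
by rewrite compA aP'.1 -compA compVK.
Qed.

Lemma cgen_tri X Y C (T : stri X Y C) : cgen C * cgen X = cgen Y * cd (Dtri T).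
Proof.
rewrite [RHS](mul_cd (inv (a' Y) ∘ a Y) (det_tri (Ddet S) T)).
symmetry; congr mkc; apply: cmp_tens_uniq.
apply: (@compI _ _ _ _ (fmap f' (det_tri (Ddet S) T))).
apply: (@compI _ _ _ _ (a' Y)); rewrite -!compA compVK compVK compA aP.2.
rewrite !compA aP'.2 -compA -tensm_comp.
by rewrite /= !compVK.
Qed.

Lemma Dmod_rel s t : drel1 (S := S) s t ->
  pclass1 (P := Dpres S) s = pclass1 (P := Dpres S) t.
Proof. by move=> h; apply/cls1P; exact: weq1_rel. Qed.

Lemma Dob_zero : Dob (szero S) = 1 :> C0 D.
Proof. by apply/cls0P; apply: weq0_rel; exact: drel_zero. Qed.

Lemma cgen_zero : cgen (szero S) = 1.
Proof.
have [D0 [L0 _ _]] := coh_zero coh; have := cgen_tri D0.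
have -> : Dtri D0 = 1 by exact: Dmod_rel (drel_triL L0).
by rewrite cd1 => /mulgI.
Qed.

Lemma Dtri_cop X Y T (D1 : stri X T Y) (D2 : stri Y T X) : scop D1 D2 ->
  br (Dob X : C0 D) (Dob Y) = (Dtri D2 : C1 D)^-1 * Dtri D1.
Proof.
move=> /drel_cop/Dmod_rel h.
transitivity (pclass1 (P := Dpres S) (W1br (Wob X) (Wob Y))).
  exact: (pres_brE (P := Dpres S)).
rewrite h /pclass1 -[LHS](pmul1M (P := Dpres S)).
by congr (_ * _); exact: esym (pinv1M (P := Dpres S) _).
Qed.

Lemma cgen_comm X Y : cd (br (Dob X) (Dob Y)) = [~ cgen Y, cgen X].
Proof.
have [T [D1 [D2 s]]] := coh_cop coh X Y; rewrite (Dtri_cop s) cdM cdV.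
apply: (mulgI (cgen X * cgen Y)); rewrite -commgC (cgen_tri D1).
by rewrite (cgen_tri D2) -!mulgA mulVKg.
Qed.

Notation cob := (@cob D G f f').
(** The boundary axiom for brackets, with the bracket pulled back from [D]; it need not hold for all
    pairs of comparisons. *)
Definition ccomp (u v : A) : Prop := cd (br (cob u) (cob v)) = [~ v, u].

Lemma ccomp_sym u v : ccomp u v -> ccomp v u.
Proof. by move=> h; rewrite /ccomp (brC (cob u)) cdV h invgR. Qed.
Lemma cd_br_conj (u w : A) x : cd (br (cob u) x) ^ w = cd (br (cob u) x).
Proof. by rewrite -cd_act /act bd_br br_commg mulg1. Qed.
Lemma commgM (K : groupType) (x y z : K) : [~ x, y * z] = [~ x, z] * [~ x, y] ^ z.
Proof.
by rewrite !commgEl conjMg conjVg conjgM -mulgA mulVKg.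
Qed.
Lemma ccompMl u u' v : ccomp u v -> ccomp u' v -> ccomp (u * u') v.
Proof.
rewrite /ccomp => h h'; rewrite commgM -h -h' cd_br_conj -cdM cobM brMl.
by rewrite br_central.
Qed.
Lemma ccomp1 v : ccomp 1 v.
Proof. by rewrite /ccomp br1l cd1 commg1. Qed.
Lemma ccompVl u v : ccomp u v -> ccomp u^-1 v.
Proof.
move=> h; have e : [~ v, u^-1] * [~ v, u] ^ u^-1 = 1 by rewrite -commgM mulgV commg1.
move: e; rewrite -h cd_br_conj => /(canRL (mulgK _)); rewrite mul1g /ccomp => ->.
rewrite -cdV -brVl; congr (cd (br _ _)); exact: (morph_inv (@cobM D G f f')).
Qed.

(* The set of all u with ccomp u v for all v need not contain the generators;
   their double commutant under ccomp does, and it is a group on which ccomp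
   holds throughout. *)
Definition ccomm1 (u : A) := forall X, ccomp u (cgen X).
Definition ccomm2 (u : A) := forall v, ccomm1 v -> ccomp u v.
Lemma ccomm2_1 : ccomm2 1. Proof. by move=> v _; exact: ccomp1. Qed.
Lemma ccomm2M u v : ccomm2 u -> ccomm2 v -> ccomm2 (u * v).
Proof. by move=> hu hv w hw; apply: ccompMl; [exact: hu|exact: hv]. Qed.
Lemma ccomm2V u : ccomm2 u -> ccomm2 u^-1.
Proof. by move=> hu w hw; apply: ccompVl; exact: hu. Qed.
Lemma ccomm1_gen X : ccomm1 (cgen X).
Proof. by move=> Y; exact: cgen_comm. Qed.
Lemma ccomm2_gen X : ccomm2 (cgen X).
Proof. by move=> v hv; apply: ccomp_sym; exact: hv. Qed.
Lemma ccomm2_cd c : ccomm2 (cd c).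
Proof.
move=> v _; rewrite /ccomp commgEr -cdV -cd_act -cdM; congr cd.
rewrite /act bdV brVr (brC (bd c) (cob v)) invgK -mulgA.
by rewrite (br_central (bd c) (cob v) c) mulKg.
Qed.
Lemma ccomm2P u v : ccomm2 u -> ccomm2 v -> ccomp u v.
Proof. by move=> hu hv; apply: hu => X; apply: hv; exact: ccomm1_gen. Qed.

Notation C2 := (sgrp ccomm2_1 ccomm2M ccomm2V).

(** Degree one and the bracket are those of [D]; only the base is replaced, by a group of
    comparisons. A morphism [D -> csqm] over [D] is therefore a coherent choice of comparisons. *)
Definition csqm : sqm.
Proof.
refine (@SQM C2 (C1 D) (fun c => exist _ (cd c) (ccomm2_cd c))
  (fun u v => br (cob (sval u)) (cob (sval v))) _ _ _ _ _ _).
- by move=> c c'; apply: sig_prop_inj; exact: cdM.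
- by move=> u u' v; exact: brMl.
- by move=> u v v'; exact: brMr.
- by move=> u v; exact: br_sym.
- move=> u v; apply: sig_prop_inj.
  exact: (ccomm2P (proj2_sig u) (proj2_sig v)).
- by move=> c c'; exact: br_bd.
Defined.

Definition c0 (X : seqv S) : C0 csqm := exist _ (cgen X) (ccomm2_gen X).
Definition c1 (x : dgen S) : C1 csqm := pclass1 (P := Dpres S) (W1gen x).

Lemma c_bd x : bd (c1 x) = eval0 (P := Dpres S) c0 (dbd x).
Proof.
case: x => [X X' h|X Y C T]; apply: sig_prop_inj => /=.
  by rewrite (cgen_mor h) mulKg.
by rewrite -mulgA [cgen C * _](cgen_tri T) mulKg.
Qed.

Lemma c_eval0 w : cob (sval (eval0 (P := Dpres S) c0 w)) = pclass0 (P := Dpres S) w.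
Proof.
have hM (x y : C2) : cob (sval (x * y)) = cob (sval x) * cob (sval y) by [].
elim: w => [X||u IHu v IHv|u IHu]; [by []|by []| |].
  rewrite -[RHS](pmul0M (P := Dpres S)) -[cls0 u]IHu -[cls0 v]IHv; exact: hM.
rewrite -[RHS](pinv0M (P := Dpres S)) -[cls0 u]IHu.
exact: (morph_inv (@cobM D G f f')).
Qed.
Lemma c_eval1 s : eval1 (P := Dpres S) c0 c1 s = pclass1 (P := Dpres S) s.
Proof.
elim: s => [x||s IHs t IHt|s IHs|u v] //=.
- by rewrite IHs IHt; exact: (pmul1M (P := Dpres S)).
- by rewrite IHs; exact: (pinv1M (P := Dpres S)).
- by rewrite !c_eval0; exact: (pres_brE (P := Dpres S)).
Qed.
Lemma c_rel0 u v : drel0 (S := S) u v ->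
  eval0 (P := Dpres S) c0 u = eval0 (P := Dpres S) c0 v.
Proof. by case; apply: sig_prop_inj; exact: cgen_zero. Qed.
Lemma c_rel1 s t : drel1 (S := S) s t ->
  eval1 (P := Dpres S) c0 c1 s = eval1 (P := Dpres S) c0 c1 t.
Proof. by move=> /Dmod_rel; rewrite !c_eval1. Qed.

Lemma comparison_exists : exists b : forall x : V, hom (f x) (f' x),
  is_tensor_nat b /\ forall X, a X = a' X ∘ b (det_ob (Ddet S) X).
Proof.
have [h [h0 h1 _]] := presented_universal (P := Dpres S) c_bd c_rel0 c_rel1.
have π0 : {morph (fun x => cob (sval (sh0 h x))) : x y / x * y}.
  by move=> x y; rewrite (sh0M h).
have π_bd c : cob (sval (sh0 h (bd c))) = @bd D (sh1 h c) by rewrite (sh_bd h).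
have π_br x y : sh1 h (br x y) = @br D (cob (sval (sh0 h x))) (cob (sval (sh0 h y))).
  by rewrite (sh_br h).
(* Followed by the projection to [D], the morphism [h] fixes the generators and so is the identity;
   hence [sh0 h x] is a comparison at [x] itself. *)
pose π : sqm_hom D D := @SQMHom D D _ (sh1 h) π0 (sh1M h) π_bd π_br.
pose ι : sqm_hom D D := @SQMHom D D id id (fun _ _ => erefl) (fun _ _ => erefl)
  (fun _ => erefl) (fun _ _ => erefl).
have [e0 e1] : sh0 π =1 sh0 ι /\ sh1 π =1 sh1 ι.
  by apply: sqm_hom_ext => [X|x] /=; rewrite ?h0 ?h1.
have b_ex x : exists θ : hom (f x) (f' x), sval (sh0 h x) = mkc θ.
  have := e0 x; rewrite /=; case: (sval (sh0 h x)) => y θ /= p; subst y.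
  by exists θ.
pose b x := sval (cid (b_ex x)).
have bE x : sval (sh0 h x) = mkc (b x) by exact: (proj2_sig (cid (b_ex x))).
exists b; split; last first.
  move=> X; have -> : b (det_ob (Ddet S) X) = inv (a' X) ∘ a X.
    by apply: mkc_inj; rewrite -bE [sh0 h _]h0.
  by rewrite compVK.
split.
- move=> x y k; apply: (@compI _ _ _ _ (inv (fmap f' k))); rewrite compK.
  apply: mkc_inj; rewrite -mul_cd -!bE.
  (* The boundary of [csqm] is [cd], so naturality is the compatibility of [h] with boundaries. *)
  have <- : sval (sh0 h (bd (sval k))) = cd (sval k).
    by rewrite (sh_bd h) [sh1 h _](e1 (sval k)).
  transitivity (sval (sh0 h ((y : C0 D) * bd (sval k)))); first by rewrite (sh0M h).
  by rewrite -(eqP (proj2_sig k)).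
- move=> x y; rewrite -cmp_tensE; congr (_ ∘ _).
  apply: mkc_inj; rewrite -bE (sh0M h) /= !bE.
  by [].
- rewrite -(cmp_unitE f f'); congr (_ ∘ _); apply: mkc_inj.
  by rewrite -bE (morph_one (sh0M h)).
Qed.
End ComparisonDet.

(** * Universality from coherence *)

Section UniversalDet.
Variable S : setting.
Notation D := (Dmod S).
Notation V := (Gamma (Dmod S)).

Lemma Dmod_act (x : dgen S) (X : seqv S) :
  pclass1 (P := Dpres S) (Wact (W1gen x) (Wob X)) =
  act (pclass1 (P := Dpres S) (W1gen x) : C1 D) (Dob X).
Proof.
rewrite /act -[LHS](pmul1M (P := Dpres S)); congr (_ * _).
rewrite (pclass_bd (P := Dpres S) (W1gen x)).
exact: esym (pres_brE (P := Dpres S) (Wob X) (dbd x)).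
Qed.

Lemma Ddet_nc : @is_nc_det S V (Ddet S).
Proof.
split.
- by move=> X; apply: Gamma_hom_inj; exact: Dmod_rel (drel_id X).
- move=> X Y Z g f; apply: Gamma_hom_inj; rewrite /= /Deqv.
  by rewrite (Dmod_rel (drel_comp g f)); exact: esym (pmul1M (P := Dpres S) _ _).
- move=> X Y C X' Y' C' T T' a b c E; apply: Gamma_hom_inj => /=.
  have : Deqv a * act (Deqv c : C1 D) (Dob X) =
      (Dtri T')^-1 * Deqv b * Dtri T :> C1 D.
    rewrite -(Dmod_act (GEqv c)) [LHS](pmul1M (P := Dpres S)).
    rewrite [LHS](Dmod_rel (drel_triE E)) /pclass1.
    by rewrite -(pmul1M (P := Dpres S)) -(pmul1M (P := Dpres S)) -(pinv1M (P := Dpres S)).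
  (* The presentation acts by the source object [[X]], the tensor product of morphisms by the target
     [[X']]; the two differ by conjugation with [[a]]. *)
  have -> : act (Deqv c : C1 D) (Dob X) = act (Deqv c : C1 D) (Dob X') ^ (Deqv a : C1 D).
    by rewrite {1}(eqP (Deqv_subproof a)) actMx act_bd.
  by rewrite -conjgC => h; rewrite h -!mulgA mulVKg.
- move=> X Y Z Cf Cg Cgf Tf Tg Tgf Tt s; apply: Gamma_hom_inj => /=.
  rewrite act_1 mul1g !mulg1 -(Dmod_act (GTri Tt)).
  rewrite [LHS](pmul1M (P := Dpres S)) [RHS](pmul1M (P := Dpres S)).
  exact: Dmod_rel (drel_stair s).
Qed.

Lemma Ddet_comm : @is_commutative_det S V (Ddet S).
Proof.
move=> X Y T D1 D2 s; apply: Gamma_hom_inj.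
transitivity ((Dtri D2 : C1 D) * br (Dob X : C0 D) (Dob Y)); last by [].
by rewrite (Dtri_cop s) mulVKg.
Qed.

Section Group.
Variable G : catGroup.

Lemma comparison_uniq (f f' : tensorFunctor V G) (b b' : forall x : V, hom (f x) (f' x)) :
  is_tensor_nat b -> is_tensor_nat b' ->
  (forall X : seqv S, b (Dob X) = b' (Dob X)) -> b = b'.
Proof.
move=> [nb mb ub] [nb' mb' ub'] e; apply: functional_extensionality_dep => x.
have E1 : b (1 : C0 D) = b' (1 : C0 D) by apply: (@Icomp _ _ _ _ (tone f)); rewrite ub ub'.
have [w ->] := cls0W x; elim: w => [X||u IHu v IHv|u IHu] //.
- exact: e.
- rewrite -pmul0M; apply: (@Icomp _ _ _ _ (tmul f _ _)).
  by rewrite [LHS]mb [RHS]mb' IHu IHv.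
- rewrite -pinv0M; have h : b (1 : C0 D) = b' (1 : C0 D) by [].
  rewrite -(mulgV (cls0 u : C0 D)) in h.
  have := mb (cls0 u : C0 D) ((cls0 u : C0 D)^-1).
  rewrite [b (_ ⊗ _)]h mb' IHu => /compI h'; apply/esym/tens_faithful.
  by apply: (@Icomp _ _ _ _ (b' (cls0 u : C0 D) ⊠ idm _)); rewrite !tens_rl.
Qed.
End Group.

Hypothesis coh : coherent S.

Theorem Ddet_universal_nc : @is_universal_nc_det S V (Ddet S).
Proof.
move=> G d dP; have [f [a aP]] := nc_factor coh dP.
exists f, a; split=> // f' a' aP'; have [b [nb hb]] := comparison_exists coh aP aP'.
exists b; split=> // b' [nb' hb']; apply: comparison_uniq => // X.
by apply: (@compI _ _ _ _ (a' X)); rewrite -hb -hb'.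
Qed.

(** * Symmetry of the induced functor *)

Section Symmetry.
Variables (P : picard) (f : tensorFunctor V P).

Definition sym_at (x y : V) : Prop :=
  fmap f (comm x y) ∘ tmul f x y = tmul f y x ∘ comm (f x) (f y).

Lemma sym_at_sym x y : sym_at x y -> sym_at y x.
Proof.
rewrite /sym_at => h; apply: (@Icomp _ _ _ _ (comm (f x) (f y))).
by rewrite -!compA -h comm_sym compm1 compA -fmap_comp comm_sym fmap_id comp1m.
Qed.

(** The hexagons in source and target express the symmetry of [x ⊗ y] with [t] through those of [x]
    and [y]. The converse direction serves to pass to inverses. *)
Lemma sym_at_mul x y t : sym_at x t -> (sym_at y t <-> sym_at (x ⊗ y) t).
Proof.
move=> hx.
pose p := fmap f (comm x t ⊠ idm y) ∘ fmap f (ass x t y) ∘ tmul f x (t ⊗ y).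
have E1 : fmap f (ass t x y) ∘ (fmap f (comm (x ⊗ y) t) ∘ tmul f (x ⊗ y) t) ∘
    (tmul f x y ⊠ idm _) ∘ ass _ _ _ = p ∘ idm _ ⊠ (fmap f (comm y t) ∘ tmul f y t).
  rewrite -!compA (compA (tmul f (x ⊗ y) t)) -tmul_ass !compA -!fmap_comp.
  rewrite hexagon !fmap_comp /p tens1l -!compA; congr (_ ∘ (_ ∘ _)).
  by rewrite !compA tmul_natr.
have E2 : fmap f (ass t x y) ∘ (tmul f t (x ⊗ y) ∘ comm (f (x ⊗ y)) (f t)) ∘
    (tmul f x y ⊠ idm _) ∘ ass _ _ _ = p ∘ idm _ ⊠ (tmul f t y ∘ comm (f y) (f t)).
  transitivity (fmap f (ass t x y) ∘ tmul f t (x ⊗ y) ∘ idm (f t) ⊠ tmul f x y ∘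
      (comm (f x ⊗ f y) (f t) ∘ ass (f x) (f y) (f t))).
    by rewrite -!compA (compA (comm _ _)) comm_nat -!compA.
  rewrite tmul_ass -!compA; have := hexagon (f x) (f y) (f t); rewrite -!compA => ->.
  transitivity (fmap f (comm x t ⊠ idm y) ∘ (fmap f (ass x t y) ∘ tmul f x (t ⊗ y) ∘
      idm (f x) ⊠ tmul f t y) ∘ idm (f x) ⊠ comm (f y) (f t)).
    rewrite tmul_ass !compA -tmul_natl; congr (_ ∘ _ ∘ _).
    by rewrite -!compA; congr (_ ∘ _); rewrite -!tens1r hx.
  by rewrite tens1l /p !compA.
split=> [hy|].
  rewrite /sym_at; apply: (@compI _ _ _ _ (fmap f (ass t x y))).
  apply: (@Icomp _ _ _ _ (tmul f x y ⊠ idm _)); apply: (@Icomp _ _ _ _ (ass _ _ _)).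
  by rewrite E1 E2 hy.
rewrite /sym_at => hxy; apply: tens_faithful; apply: (@compI _ _ _ _ p).
by rewrite -E1 -E2 hxy.
Qed.

Lemma sym_at_all : (forall X Y : seqv S, sym_at (Dob X : C0 D) (Dob Y : C0 D)) ->
  is_symmetric f.
Proof.
move=> hg.
have close t : (forall X : seqv S, sym_at (Dob X : C0 D) t) -> forall x, sym_at x t.
  move=> ht x.
  (* The unit is the class of the zero object, hence itself a generator. *)
  have h1 : sym_at (1 : C0 D) t by rewrite -(Dob_zero S); exact: ht.
  have [w ->] := cls0W x; elim: w => [X||u IHu v IHv|u IHu] //.
  - exact: ht.
  - by rewrite -pmul0M; apply: (iffLR (sym_at_mul _ IHu)).
  - rewrite -pinv0M; apply/(sym_at_mul _ IHu).
    by rewrite -(mulgV (cls0 u : C0 D)) in h1.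
move=> x y; apply: (close y) => X; apply: sym_at_sym; apply: close => Y; exact: hg.
Qed.
End Symmetry.

Theorem Ddet_universal : @is_universal_det S V (Ddet S).
Proof.
move=> P d [dP dc]; have [f [a [aP hf]]] := Ddet_universal_nc dP.
exists f, a; split=> //; last by move=> f' a' _ aP'; exact: hf.
apply: sym_at_all => Y X; have [T [D1 [D2 s]]] := coh_cop coh X Y.
(* Both determinant functors express the value on [D1] by that on [D2] and the symmetry; cancelling
   the value on [D2] leaves the symmetry of [f] on generators. *)
have [_ aT] := aP; have h1 := aT _ _ _ D1; have h2 := aT _ _ _ D2.
move: h1; rewrite (Ddet_comm s) (dc _ _ _ _ _ s) fmap_comp -[RHS]compA comm_nat.
rewrite [RHS]compA -h2 -!compA => /compI /compI; exact.
Qed.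

Theorem Ddet_universal_det :
  [/\ @is_det S V (Ddet S), @is_universal_det S V (Ddet S)
    & @is_universal_nc_det S V (Ddet S)].
Proof.
split; [|exact: Ddet_universal|exact: Ddet_universal_nc].
by split; [exact: Ddet_nc|exact: Ddet_comm].
Qed.
End UniversalDet.

(** * Waldhausen categories *)

Section Waldhausen.
Variable W : waldhausen.
Implicit Types X Y Z : W.

Lemma zmor_l X Y Z (f : hom Y Z) : f ∘ zmor X Y = zmor X Z.
Proof. by rewrite /zmor compA; congr (_ ∘ _); exact: zin_uniq. Qed.
Lemma zmor_r X Y Z (f : hom X Y) : zmor Y Z ∘ f = zmor X Z.
Proof. by rewrite /zmor -compA; congr (_ ∘ _); exact: zout_uniq. Qed.
Lemma zmor_zout X Y (f : hom (zob W) Y) : f ∘ zout X = zmor X Y.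
Proof. by rewrite /zmor (zin_uniq f). Qed.
Lemma zin_eq X (f g : hom (zob W) X) : f = g.
Proof. by rewrite (zin_uniq f) (zin_uniq g). Qed.

Lemma cofseq_zero X Y C (D : cofseq X Y C) : cfp D ∘ cfi D = zmor X C.
Proof. by have [-> _] := cf_pushout D. Qed.

Lemma cofseq_lift X Y C (D : cofseq X Y C) Q (u : hom Y Q) :
  u ∘ cfi D = zmor X Q -> exists! h : hom C Q, h ∘ cfp D = u.
Proof.
move=> e; have [_ /(_ Q u (zin Q) e) [h [[h1 h2] hu]]] := cf_pushout D.
by exists h; split=> // h' e'; apply: hu; split=> //; exact: zin_eq.
Qed.

Lemma pushout_cofiber X Y C (i : hom X Y) (p : hom Y C) :
  p ∘ i = zmor X C ->
  (forall Q (u : hom Y Q), u ∘ i = zmor X Q -> exists! h : hom C Q, h ∘ p = u) ->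
  is_pushout i (zout X) p (zin C).
Proof.
move=> pi hp; split=> // Q u v; rewrite zmor_zout => /hp [h [h1 hu]].
exists h; split; first by split=> //; exact: zin_eq.
by move=> h' [e _]; exact: hu.
Qed.

(** The pushout form over the zero object is kept next to the coproduct property because it is what
    the gluing axiom takes as input. *)
Record wcop X Z := WCop {
  wS : W; wi1 : hom X wS; wi2 : hom Z wS; wp1 : hom wS X; wp2 : hom wS Z;
  w_cop : is_coproduct wi1 wi2;
  w11 : wp1 ∘ wi1 = idm X; w12 : wp1 ∘ wi2 = zmor Z X;
  w21 : wp2 ∘ wi1 = zmor X Z; w22 : wp2 ∘ wi2 = idm Z;
  wc1 : cof wi1; wc2 : cof wi2;
  w_po : is_pushout (zin X) (zin Z) wi1 wi2 }.

Lemma coproduct_ext X Z S (i : hom X S) (j : hom Z S) Q (h h' : hom S Q) :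
  is_coproduct i j -> h ∘ i = h' ∘ i -> h ∘ j = h' ∘ j -> h = h'.
Proof.
move=> c e1 e2; have [k [_ ku]] := c Q (h ∘ i) (h ∘ j).
by rewrite -(ku h) // -(ku h') // e1 e2.
Qed.

Lemma is_coproductC X Z S (i : hom X S) (j : hom Z S) :
  is_coproduct i j -> is_coproduct j i.
Proof.
move=> c Q u v; have [h [[h1 h2] hu]] := c Q v u.
by exists h; split=> // h' [e1 e2]; apply: hu.
Qed.

Lemma wcop_exists X Z : inhabited (wcop X Z).
Proof.
have [S [i [j po]]] := cof_pushout (zin Z) (cof_zin X).
have c : is_coproduct i j.
  move=> Q u v; have [_ po2] := po; apply: po2; exact: zin_eq.
have [p1 [[p11 p12] _]] := c X (idm X) (zmor Z X).
have [p2 [[p21 p22] _]] := c Z (zmor X Z) (idm Z).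
have cj : cof j := cof_cobase (cof_zin X) po.
have po' : is_pushout (zin Z) (zin X) j i.
  have [e po2] := po; split=> // Q u v /esym /po2 [h [[h1 h2] hu]].
  by exists h; split=> // h' [e1 e2]; apply: hu.
have ci : cof i := cof_cobase (cof_zin Z) po'.
by constructor; exact: (WCop c p11 p12 p21 p22 ci cj po).
Qed.
Definition wsum X Z : wcop X Z := sval (cid (let: inhabits c := wcop_exists X Z in
  ex_intro (fun _ => True) c I)).

Lemma split_pushout X Z S (i : hom X S) (j : hom Z S) (p : hom S Z) :
  is_coproduct i j -> p ∘ i = zmor X Z -> p ∘ j = idm Z ->
  is_pushout i (zout X) p (zin Z).
Proof.
move=> c pi pj; apply: pushout_cofiber => // Q u ui; exists (u ∘ j); split.
  apply: (coproduct_ext c); rewrite -!compA ?pi ?pj ?compm1 // ui.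
  by rewrite !zmor_l.
by move=> h <-; rewrite -compA pj compm1.
Qed.

Definition wcs1 X Z (c : wcop X Z) : cofseq X (wS c) Z :=
  CofSeq (wc1 c) (split_pushout (w_cop c) (w21 c) (w22 c)).
Definition wcs2 X Z (c : wcop X Z) : cofseq Z (wS c) X :=
  CofSeq (wc2 c) (split_pushout (is_coproductC (w_cop c)) (w12 c) (w11 c)).
Lemma wcs_cop X Z (c : wcop X Z) : cofseq_cop (wcs1 c) (wcs2 c).
Proof. by split; [exact: w_cop|exact: w22|exact: w11]. Qed.

Lemma wmap_exists X X' Z (c : wcop X Z) (c' : wcop X' Z) (f : hom X X') :
  exists t : hom (wS c) (wS c'), t ∘ wi1 c = wi1 c' ∘ f /\ t ∘ wi2 c = wi2 c'.
Proof.
by have [t [[t1 t2] _]] := w_cop c (wi1 c' ∘ f) (wi2 c'); exists t.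
Qed.
Definition wmap X X' Z (c : wcop X Z) (c' : wcop X' Z) (f : hom X X') :=
  sval (cid (wmap_exists c c' f)).
Lemma wmap1 X X' Z (c : wcop X Z) (c' : wcop X' Z) (f : hom X X') :
  wmap c c' f ∘ wi1 c = wi1 c' ∘ f.
Proof. by rewrite /wmap; case: cid => t []. Qed.
Lemma wmap2 X X' Z (c : wcop X Z) (c' : wcop X' Z) (f : hom X X') :
  wmap c c' f ∘ wi2 c = wi2 c'.
Proof. by rewrite /wmap; case: cid => t []. Qed.

Lemma wmap_weq X X' Z (c : wcop X Z) (c' : wcop X' Z) (f : hom X X') :
  weq f -> weq (wmap c c' f).
Proof.
move=> wf; apply: (weq_glue (cof_zin X) (cof_zin X') (w_po c) (w_po c')
  (weq_id (zob W)) wf (weq_id Z)).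
- exact: zin_eq.
- exact: zin_eq.
- exact: wmap1.
- by rewrite wmap2 compm1.
Qed.

Lemma wmap_mor1 X X' Z (c : wcop X Z) (c' : wcop X' Z) (f : hom X X') :
  cofseq_mor (wcs1 c) (wcs1 c') f (wmap c c' f) (idm Z).
Proof.
split=> /=; first exact: wmap1.
apply: (coproduct_ext (w_cop c)); rewrite -!compA ?wmap1 ?wmap2 ?comp1m.
  by rewrite compA !w21 zmor_r.
by rewrite !w22.
Qed.
Lemma wmap_mor2 X X' Z (c : wcop X Z) (c' : wcop X' Z) (f : hom X X') :
  cofseq_mor (wcs2 c) (wcs2 c') (idm Z) (wmap c c' f) f.
Proof.
split=> /=; first by rewrite wmap2 compm1.
apply: (coproduct_ext (w_cop c)); rewrite -!compA ?wmap1 ?wmap2.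
  by rewrite w11 compm1 compA w11 comp1m.
by rewrite !w12 zmor_l.
Qed.

Lemma cop_uniq X Y T T' (D1 : cofseq X T Y) (D2 : cofseq Y T X)
    (D1' : cofseq X T' Y) (D2' : cofseq Y T' X) :
  cofseq_cop D1 D2 -> cofseq_cop D1' D2' ->
  exists t : hom T T', [/\ is_iso t, cofseq_mor D1 D1' (idm X) t (idm Y)
    & cofseq_mor D2 D2' (idm Y) t (idm X)].
Proof.
move=> [c p12 p21] [c' p12' p21'].
have [t [[t1 t2] _]] := c T' (cfi D1') (cfi D2').
have [s [[s1 s2] _]] := c' T (cfi D1) (cfi D2).
exists t; split.
- exists s; split; [apply: (coproduct_ext c)|apply: (coproduct_ext c')];
    by rewrite -compA ?t1 ?t2 ?s1 ?s2 ?t1 ?t2 comp1m.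
- split; first by rewrite t1 compm1.
  apply: (coproduct_ext c); rewrite -!compA ?t1 ?t2 ?p12 ?p12' ?compm1 //.
  by rewrite !cofseq_zero zmor_l.
- split; first by rewrite t2 compm1.
  apply: (coproduct_ext c); rewrite -!compA ?t1 ?t2 ?p21 ?p21' ?compm1 //.
  by rewrite !cofseq_zero zmor_l.
Qed.

(** * The three staircases on a cofiber sequence and an object *)

Section Triangle.
Variables (X Y C Z : W) (D : cofseq X Y C).
Let cX := wsum X Z. Let cY := wsum Y Z. Let cC := wsum C Z.
Notation i := (cfi D).
Notation p := (cfp D).

Lemma ctri1_po : is_pushout (wi1 cY ∘ i) (zout X) (wmap cY cC p) (zin (wS cC)).
Proof.
apply: pushout_cofiber => [|Q u].
  by rewrite compA wmap1 -compA cofseq_zero zmor_l.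
rewrite compA => /cofseq_lift [h [h1 hu]].
have [k [[k1 k2] ku]] := w_cop cC h (u ∘ wi2 cY).
exists k; split.
  apply: (coproduct_ext (w_cop cY)); rewrite -compA ?wmap1 ?wmap2 //.
  by rewrite compA k1.
move=> k' e; apply: ku; split.
  by symmetry; apply: hu; rewrite -compA -(wmap1 cY cC) compA e.
by rewrite -(wmap2 cY cC p) compA e.
Qed.
Lemma ctri1_cof : cof (wi1 cY ∘ i).
Proof. by apply: cof_comp; [exact: wc1|exact: cfi_cof]. Qed.
Definition ctri1 : cofseq X (wS cY) (wS cC) := CofSeq ctri1_cof ctri1_po.

(** [X ⊕ Z -> Y ⊕ Z] is the cobase change of [X -> Y] along the inclusion of [X] in [X ⊕ Z]. *)
Lemma ctri2_cof : cof (wmap cX cY i).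
Proof.
apply: (cof_cobase (f := i) (g := wi1 cX) (u := wi1 cY)); first exact: cfi_cof.
split; first by rewrite wmap1.
move=> Q u v e; have [k [[k1 k2] ku]] := w_cop cY u (v ∘ wi2 cX).
exists k; split.
  split=> //; apply: (coproduct_ext (w_cop cX)); rewrite -compA ?wmap1 ?wmap2 //.
  by rewrite compA k1 e.
move=> k' [e1 e2]; apply: ku; split=> //.
by rewrite -e2 -compA wmap2.
Qed.
Lemma ctri2_po : is_pushout (wmap cX cY i) (zout (wS cX)) (p ∘ wp1 cY) (zin C).
Proof.
apply: pushout_cofiber => [|Q u e].
  apply: (coproduct_ext (w_cop cX)); rewrite zmor_r -!compA ?wmap1 ?wmap2.
    by rewrite (compA (wp1 cY)) w11 comp1m cofseq_zero.
  by rewrite w12 zmor_l.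
have /cofseq_lift [h [h1 hu]] : (u ∘ wi1 cY) ∘ i = zmor X Q.
  by rewrite -compA -(wmap1 cX cY) compA e zmor_r.
exists h; split.
  apply: (coproduct_ext (w_cop cY)); rewrite -!compA ?w11 ?w12.
    by rewrite compm1.
  by rewrite -(wmap2 cX cY i) (compA u) e zmor_r !zmor_l.
by move=> h' e'; apply: hu; rewrite -e' -!compA w11 compm1.
Qed.
Definition ctri2 : cofseq (wS cX) (wS cY) C := CofSeq ctri2_cof ctri2_po.

Lemma ctri_stair1 : cofseq_stair D (wcs1 cY) ctri1 (wcs1 cC).
Proof.
split=> //=; first by rewrite wmap1.
apply: (coproduct_ext (w_cop cY)); rewrite -compA ?wmap1 ?wmap2.
  by rewrite compA !w21 zmor_r.
by rewrite !w22.
Qed.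
Lemma ctri_stair2 : cofseq_stair (wcs1 cX) ctri2 ctri1 (wcs2 cC).
Proof.
split=> /=; first by rewrite wmap1.
  apply: (coproduct_ext (w_cop cX)); rewrite -!compA ?wmap1 ?wmap2.
    by rewrite w21 (compA (wmap _ _ _)) wmap1 -compA cofseq_zero !zmor_l.
  by rewrite w22 compm1.
apply: (coproduct_ext (w_cop cY)); rewrite -!compA ?wmap1 ?wmap2.
  by rewrite w11 compm1 compA w11 comp1m.
by rewrite !w12 zmor_l.
Qed.
Lemma ctri_stair3 : cofseq_stair (wcs2 cX) ctri2 (wcs2 cY) D.
Proof.
split=> //=; first by rewrite wmap2.
apply: (coproduct_ext (w_cop cX)); rewrite -!compA ?wmap1 ?wmap2.
  by rewrite w11 compm1 compA w11 comp1m.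
by rewrite !w12 zmor_l.
Qed.
End Triangle.

Lemma czero_po : is_pushout (idm (zob W)) (zout (zob W)) (idm (zob W)) (zin (zob W)).
Proof.
apply: pushout_cofiber => [|Q u _]; first exact: zin_eq.
by exists u; split=> [|h <-]; rewrite compm1.
Qed.
Definition czero : cofseq (zob W) (zob W) (zob W) :=
  CofSeq (cof_iso (is_iso_id (zob W))) czero_po.

Lemma waldhausen_coherent : coherent (waldhausen_setting W).
Proof.
split=> /=.
- exists czero; split=> // X D e; split=> /=; rewrite ?e ?comp1m ?compm1 //.
- move=> X Y; exists (wS (wsum X Y)), (wcs1 (wsum X Y)), (wcs2 (wsum X Y)).
  exact: wcs_cop.
- by move=> X Y T D1 D2 [c p1 p2]; split=> //; exact: is_coproductC.
- move=> X Y T T' D1 D2 D1' D2' s s'; have [t [it m1 m2]] := cop_uniq s s'.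
  by exists (exist _ t (weq_iso it)).
- move=> X X' Z f; exists (wS (wsum X Z)), (wS (wsum X' Z)).
  exists (wcs1 (wsum X Z)), (wcs2 (wsum X Z)), (wcs1 (wsum X' Z)), (wcs2 (wsum X' Z)).
  exists (exist _ (wmap (wsum X Z) (wsum X' Z) (sval f)) (wmap_weq _ _ (proj2_sig f))).
  split; [exact: wcs_cop|exact: wcs_cop|exact: wmap_mor1|exact: wmap_mor2].
- move=> X Y C Z D; exists (wS (wsum X Z)), (wS (wsum Y Z)), (wS (wsum C Z)).
  exists (wcs1 _), (wcs2 _), (wcs1 _), (wcs2 _), (wcs1 _), (wcs2 _).
  exists (ctri1 Z D), (ctri2 Z D); split; [exact: wcs_cop|exact: wcs_cop|exact: wcs_cop|].
  by split; [exact: ctri_stair1|exact: ctri_stair2|exact: ctri_stair3].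
Qed.
End Waldhausen.

(** * The derived setting *)

Section LocalizedMaps.
Variables (C D : category).
Variables (w : forall X Y : C, hom X Y -> Prop) (v : forall X Y : D, hom X Y -> Prop).
Variable F : functor C D.
Hypothesis Fw : forall X Y (f : hom X Y), w f -> v (fmap F f).

Lemma Ho_in_iso X Y (f : hom X Y) : w f -> is_iso (Ho_in w f).
Proof.
move=> wf; exists (cls (linv wf : lsetoid w Y X) : @hom (Ho w) Y X).
by split; rewrite [LHS]Ho_compE; apply/clsP; [exact: lrel_invl|exact: lrel_invr].
Qed.
Lemma Ho_functor_iso X Y (f : @hom (Ho w) X Y) : is_iso f -> is_iso (fmap (Ho_functor Fw) f).
Proof.
by move=> [g [gf fg]]; exists (fmap (Ho_functor Fw) g);
  rewrite -!fmap_comp gf fg !fmap_id.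
Qed.

End LocalizedMaps.

Section Derived.
Variables (W : waldhausen).
Notation wqX := (@S2_X_weq W).
Notation wqY := (@S2_Y_weq W).
Notation wqC := (@S2_C_weq W).

Section Sum.
Variable Z : W.

Lemma wmap_id X : wmap (wsum X Z) (wsum X Z) (idm X) = idm _.
Proof.
apply: (coproduct_ext (w_cop (wsum X Z))); rewrite ?wmap1 ?wmap2 comp1m ?compm1 //.
Qed.
Lemma wmap_comp X Y V (g : hom Y V) (f : hom X Y) :
  wmap (wsum X Z) (wsum V Z) (g ∘ f) =
  wmap (wsum Y Z) (wsum V Z) g ∘ wmap (wsum X Z) (wsum Y Z) f.
Proof.
apply: (coproduct_ext (w_cop (wsum X Z))); rewrite -compA ?wmap1 ?wmap2 //.
by rewrite [RHS]compA wmap1 compA.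
Qed.

(** An isomorphism of [Ho W] is a class of words, so its sum with [Z] is formed letter by letter: a
    functor to cofiber sequences preserving weak equivalences lifts the whole word to
    [Ho (S2 W)]. *)
Definition sum1 : functor W (S2 W).
Proof.
refine (@Functor W (S2 W) (fun X => S2Ob (wcs1 (wsum X Z)))
  (fun X Y f => exist _ (f, wmap (wsum X Z) (wsum Y Z) f, idm Z) (wmap_mor1 _ _ f)) _ _).
- by move=> X; apply: sig_prop_inj; rewrite /= wmap_id.
- by move=> X Y V g f; apply: sig_prop_inj; rewrite /= wmap_comp comp1m.
Defined.
Definition sum2 : functor W (S2 W).
Proof.
refine (@Functor W (S2 W) (fun X => S2Ob (wcs2 (wsum X Z)))
  (fun X Y f => exist _ (idm Z, wmap (wsum X Z) (wsum Y Z) f, f) (wmap_mor2 _ _ f)) _ _).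
- by move=> X; apply: sig_prop_inj; rewrite /= wmap_id.
- by move=> X Y V g f; apply: sig_prop_inj; rewrite /= wmap_comp comp1m.
Defined.

Lemma sum1_weq X Y (f : hom X Y) : weq f -> s2weq (fmap sum1 f).
Proof. by move=> wf; split; [exact: wf|exact: wmap_weq|exact: weq_id]. Qed.
Lemma sum2_weq X Y (f : hom X Y) : weq f -> s2weq (fmap sum2 f).
Proof. by move=> wf; split; [exact: weq_id|exact: wmap_weq|exact: wf]. Qed.

Notation lw := (lword (@weq W)).

Lemma sum1X X Y (u : lw X Y) : lword_map wqX (lword_map sum1_weq u) = u.
Proof.
elim: u => {X Y} [//|X Y f wf|X Y V g IHg f IHf] /=.
  by congr linv; exact: Prop_irrelevance.
by rewrite IHg IHf.
Qed.
Lemma sum2C X Y (u : lw X Y) : lword_map wqC (lword_map sum2_weq u) = u.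
Proof.
elim: u => {X Y} [//|X Y f wf|X Y V g IHg f IHf] /=.
  by congr linv; exact: Prop_irrelevance.
by rewrite IHg IHf.
Qed.
Lemma sum12Y X Y (u : lw X Y) :
  lword_map wqY (lword_map sum1_weq u) = lword_map wqY (lword_map sum2_weq u).
Proof.
elim: u => {X Y} [//|X Y f wf|X Y V g IHg f IHf] /=.
  by congr linv; exact: Prop_irrelevance.
by rewrite IHg IHf.
Qed.
Lemma linv_id (wf : weq (idm Z)) : lrel (linv wf) (lin (@weq W) (idm Z)).
Proof.
apply: lrel_trans (lrel_sym (lrel_m1 _)) _; exact: lrel_invl.
Qed.
(** The quotient component is a word in the identity of [Z] and its formal inverse: not the identity
    as a word, but equal to it in the localization. *)
Lemma sum1C X Y (u : lw X Y) :
  lrel (lword_map wqC (lword_map sum1_weq u) : lw Z Z) (lin (@weq W) (idm Z)).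
Proof.
elim: u => {X Y} [X Y f|X Y f wf|X Y V g IHg f IHf] /=.
- exact: lrel_refl.
- exact: linv_id.
- exact: lrel_trans (lrel_comp IHg IHf) (lrel_1m _).
Qed.
Lemma sum2X X Y (u : lw X Y) :
  lrel (lword_map wqX (lword_map sum2_weq u) : lw Z Z) (lin (@weq W) (idm Z)).
Proof.
elim: u => {X Y} [X Y f|X Y f wf|X Y V g IHg f IHf] /=.
- exact: lrel_refl.
- exact: linv_id.
- exact: lrel_trans (lrel_comp IHg IHf) (lrel_1m _).
Qed.
End Sum.

Lemma derived_coherent : coherent (derived_setting W).
Proof.
have [cz cc cC _ _ ct] := waldhausen_coherent W.
split=> //=.
- move=> X Y T T' D1 D2 D1' D2' s s'; have [t [it m1 m2]] := cop_uniq s s'.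
  have wt := weq_iso it.
  pose u1 : @hom (S2 W) (S2Ob D1) (S2Ob D1') := exist _ (idm X, t, idm Y) m1.
  pose u2 : @hom (S2 W) (S2Ob D2) (S2Ob D2') := exist _ (idm Y, t, idm X) m2.
  have w1 : s2weq u1 by split=> //=; exact: weq_id.
  have w2 : s2weq u2 by split=> //=; exact: weq_id.
  exists (exist _ _ (Ho_in_iso wt)); split.
    exists (exist _ _ (Ho_in_iso w1)).
    by split; rewrite /= Ho_fmapE.
  exists (exist _ _ (Ho_in_iso w2)).
  by split; rewrite /= Ho_fmapE.
- move=> X X' Z [f fi]; exists (wS (wsum X Z)), (wS (wsum X' Z)).
  exists (wcs1 (wsum X Z)), (wcs2 (wsum X Z)), (wcs1 (wsum X' Z)), (wcs2 (wsum X' Z)).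
  have i1 := Ho_functor_iso (@sum1_weq Z) fi.
  have i2 := Ho_functor_iso (@sum2_weq Z) fi.
  have it := Ho_functor_iso wqY i1.
  exists (exist _ _ it); split; [exact: wcs_cop|exact: wcs_cop| |].
  + exists (exist _ _ i1); rewrite /= -(@repK (lsetoid _ X X') f) !Ho_fmapE.
    split=> //; first by rewrite sum1X.
    by apply/clsP; apply: lrel_sym; exact: sum1C.
  + exists (exist _ _ i2); rewrite /= -(@repK (lsetoid _ X X') f) !Ho_fmapE.
    split=> //; last by rewrite sum2C.
      by apply/clsP; apply: lrel_sym; exact: sum2X.
    by rewrite sum12Y.
Qed.
End Derived.

Import GRing.Theory.
Local Open Scope ring_scope.

(** * Additive categories *)

Section Additive.
Variable A : Defs.additive.
Implicit Types X Y Z S : A.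

Lemma comp0l X Y Z (f : hom X Y) : (0 : hom Y Z) ∘ f = 0.
Proof. by apply: (addrI (0 ∘ f)); rewrite -compDl !addr0. Qed.
Lemma comp0r X Y Z (g : hom Y Z) : g ∘ (0 : hom X Y) = 0.
Proof. by apply: (addrI (g ∘ 0)); rewrite -compDr !addr0. Qed.
Lemma compNl X Y Z (g : hom Y Z) (f : hom X Y) : (- g) ∘ f = - (g ∘ f).
Proof. by apply: (addrI (g ∘ f)); rewrite -compDl !subrr comp0l. Qed.
Lemma compNr X Y Z (g : hom Y Z) (f : hom X Y) : g ∘ (- f) = - (g ∘ f).
Proof. by apply: (addrI (g ∘ f)); rewrite -compDr !subrr comp0r. Qed.
Lemma hom_to0 X (f g : hom X (zob A)) : f = g.
Proof. by rewrite (zout_uniq f) (zout_uniq g). Qed.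
Lemma idm_zob : idm (zob A) = 0.
Proof. exact: hom_to0. Qed.

Section Biproduct.
Variables (X Y S : A) (B : biproduct X Y S).
Lemma bp1i1K Z (h : hom X Z) : h ∘ bp1 B ∘ bi1 B = h.
Proof. by rewrite -compA bp1i1 compm1. Qed.
Lemma bp2i2K Z (h : hom Y Z) : h ∘ bp2 B ∘ bi2 B = h.
Proof. by rewrite -compA bp2i2 compm1. Qed.
Lemma bp1i2K Z (h : hom X Z) : h ∘ bp1 B ∘ bi2 B = 0.
Proof. by rewrite -compA bp1i2 comp0r. Qed.
Lemma bp2i1K Z (h : hom Y Z) : h ∘ bp2 B ∘ bi1 B = 0.
Proof. by rewrite -compA bp2i1 comp0r. Qed.
Lemma bi_ext Z (f g : hom S Z) :
  f ∘ bi1 B = g ∘ bi1 B -> f ∘ bi2 B = g ∘ bi2 B -> f = g.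
Proof.
by move=> e1 e2; rewrite -[f]compm1 -[g]compm1 -(bip B) !compDr !compA e1 e2.
Qed.
Lemma bp_ext Z (f g : hom Z S) :
  bp1 B ∘ f = bp1 B ∘ g -> bp2 B ∘ f = bp2 B ∘ g -> f = g.
Proof.
by move=> e1 e2; rewrite -[f]comp1m -[g]comp1m -(bip B) !compDl -!compA e1 e2.
Qed.
End Biproduct.

Definition bpE := (bp1i1, bp2i2, bp1i2, bp2i1, bp1i1K, bp2i2K, bp1i2K, bp2i1K).
Definition cE := (compA, compDl, compDr, compNl, compNr, comp0l, comp0r,
  comp1m, compm1).
Definition zE := (@addr0, @add0r, @oppr0, @subr0, @sub0r, @opprK, @subrr, @addNr).

Definition bi_swap X Y S (B : biproduct X Y S) : biproduct Y X S.
Proof.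
refine (@Biproduct _ Y X S (bi2 B) (bi1 B) (bp2 B) (bp1 B) _ _ _ _ _);
  rewrite ?bpE //.
by rewrite addrC bip.
Defined.

Definition bi_l X : biproduct X (zob A) X.
Proof.
refine (@Biproduct _ X (zob A) X (idm X) 0 (idm X) 0 _ _ _ _ _);
  rewrite ?cE ?idm_zob ?zE //.
Defined.
Definition bi_r X : biproduct (zob A) X X.
Proof.
refine (@Biproduct _ (zob A) X X 0 (idm X) 0 (idm X) _ _ _ _ _);
  rewrite ?cE ?idm_zob ?zE //.
Defined.

(** Coordinates in which the morphism [(h, -1)] is an inclusion; they exhibit triangles of
    degenerate special octahedra as split. *)
Definition shear1 X Y S (B : biproduct X Y S) (h : hom Y X) : biproduct Y X S.
Proof.
refine (@Biproduct _ Y X S (bi1 B ∘ h - bi2 B) (bi1 B) (- bp2 B)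
  (bp1 B + h ∘ bp2 B) _ _ _ _ _); rewrite ?cE ?bpE ?cE ?zE //.
by rewrite [X in _ + X]addrC addrACA addNr add0r addrC bip.
Defined.
Definition shear2 X Y S (B : biproduct X Y S) (h : hom X Y) : biproduct X Y S.
Proof.
refine (@Biproduct _ X Y S (bi1 B - bi2 B ∘ h) (bi2 B) (bp1 B)
  (h ∘ bp1 B + bp2 B) _ _ _ _ _); rewrite ?cE ?bpE ?cE ?zE //.
by rewrite addrA subrK bip.
Defined.

(** The middle exchange between [(X ⊕ X') ⊕ (Y ⊕ Y')] and [(X ⊕ Y) ⊕ (X' ⊕ Y')], realized on the
    given object [S'']. *)
Definition bi_interchange X X' X'' Y Y' Y'' S S' S'' (BX : biproduct X X' X'')
  (BY : biproduct Y Y' Y'') (B : biproduct X Y S) (B' : biproduct X' Y' S')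
  (B'' : biproduct X'' Y'' S'') : biproduct S S' S''.
Proof.
refine (@Biproduct _ S S' S''
  (bi1 B'' ∘ bi1 BX ∘ bp1 B + bi2 B'' ∘ bi1 BY ∘ bp2 B)
  (bi1 B'' ∘ bi2 BX ∘ bp1 B' + bi2 B'' ∘ bi2 BY ∘ bp2 B')
  (bi1 B ∘ bp1 BX ∘ bp1 B'' + bi2 B ∘ bp1 BY ∘ bp2 B'')
  (bi1 B' ∘ bp2 BX ∘ bp1 B'' + bi2 B' ∘ bp2 BY ∘ bp2 B'') _ _ _ _ _).
- by apply: (bi_ext (B := B)); rewrite !cE !bpE !cE ?bpE ?zE.
- by apply: (bi_ext (B := B')); rewrite !cE !bpE !cE ?bpE ?zE.
- by apply: (bi_ext (B := B')); rewrite !cE !bpE !cE ?bpE ?zE.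
- by apply: (bi_ext (B := B)); rewrite !cE !bpE !cE ?bpE ?zE.
- by apply: (bi_ext (B := B'')); [apply: (bi_ext (B := BX))|apply: (bi_ext (B := BY))];
  rewrite !cE !bpE !cE ?bpE ?zE.
Defined.

Definition bi_map X X' S Y Y' S' (B : biproduct X X' S) (B' : biproduct Y Y' S')
  (f : hom X Y) (f' : hom X' Y') : hom S S' :=
  bi1 B' ∘ f ∘ bp1 B + bi2 B' ∘ f' ∘ bp2 B.

Lemma bi_map_iso X X' S Y Y' S' (B : biproduct X X' S) (B' : biproduct Y Y' S')
  (f : hom X Y) (f' : hom X' Y') :
  is_iso f -> is_iso f' -> is_iso (bi_map B B' f f').
Proof.
move=> [g [gf fg]] [g' [gf' fg']]; exists (bi_map B' B g g'); rewrite /bi_map.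
split; rewrite !cE !bpE !cE !zE.
  by rewrite -!compA (compA g) gf (compA g') gf' !comp1m bip.
by rewrite -!compA (compA f) fg (compA f') fg' !comp1m bip.
Qed.

Lemma is_iso_opp X Y (f : hom X Y) : is_iso f -> is_iso (- f).
Proof.
by move=> [g [gf fg]]; exists (- g); rewrite !compNl !compNr !opprK.
Qed.
End Additive.

Section Suspension.
Variable T : suspended.
Implicit Types X Y Z C : T.
Notation "'Σ' X" := (Sg T X) (at level 30, right associativity).
Notation "'Σm' f" := (fmap (Sg T) f) (at level 30, right associativity).

Lemma Sg0 X Y : Σm (0 : hom X Y) = 0.
Proof. by apply: (addrI (Σm 0)); rewrite -SgD !addr0. Qed.
Lemma SgN X Y (f : hom X Y) : Σm (- f) = - Σm f.
Proof. by apply: (addrI (Σm f)); rewrite -SgD !subrr Sg0. Qed.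
Lemma idm_Szob : idm (Σ zob T) = 0.
Proof. by rewrite -fmap_id idm_zob Sg0. Qed.
Lemma hom_toS0 X (f g : hom X (Σ zob T)) : f = g.
Proof. by rewrite -[f]comp1m -[g]comp1m idm_Szob !comp0l. Qed.

Definition SE := (@fmap_comp, SgD, SgN, Sg0, @fmap_id).

Definition bi_Sg X Y S (B : biproduct X Y S) : biproduct (Σ X) (Σ Y) (Σ S).
Proof.
refine (@Biproduct _ (Σ X) (Σ Y) (Σ S) (Σm bi1 B) (Σm bi2 B) (Σm bp1 B)
  (Σm bp2 B) _ _ _ _ _); rewrite -!fmap_comp ?bpE ?fmap_id ?Sg0 //.
by rewrite -SgD bip fmap_id.
Defined.

Section SgBiproduct.
Variables (X Y S : T) (B : biproduct X Y S).
Lemma Sbp1i1 : Σm bp1 B ∘ Σm bi1 B = idm _.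
Proof. exact: (bp1i1 (bi_Sg B)). Qed.
Lemma Sbp2i2 : Σm bp2 B ∘ Σm bi2 B = idm _.
Proof. exact: (bp2i2 (bi_Sg B)). Qed.
Lemma Sbp1i2 : Σm bp1 B ∘ Σm bi2 B = 0.
Proof. exact: (bp1i2 (bi_Sg B)). Qed.
Lemma Sbp2i1 : Σm bp2 B ∘ Σm bi1 B = 0.
Proof. exact: (bp2i1 (bi_Sg B)). Qed.
Lemma Sbp1i1K Z (h : hom (Σ X) Z) : h ∘ Σm bp1 B ∘ Σm bi1 B = h.
Proof. exact: (bp1i1K (bi_Sg B)). Qed.
Lemma Sbp2i2K Z (h : hom (Σ Y) Z) : h ∘ Σm bp2 B ∘ Σm bi2 B = h.
Proof. exact: (bp2i2K (bi_Sg B)). Qed.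
Lemma Sbp1i2K Z (h : hom (Σ X) Z) : h ∘ Σm bp1 B ∘ Σm bi2 B = 0.
Proof. exact: (bp1i2K (bi_Sg B)). Qed.
Lemma Sbp2i1K Z (h : hom (Σ Y) Z) : h ∘ Σm bp2 B ∘ Σm bi1 B = 0.
Proof. exact: (bp2i1K (bi_Sg B)). Qed.
End SgBiproduct.

Definition SbpE := (Sbp1i1, Sbp2i2, Sbp1i2, Sbp2i1, Sbp1i1K, Sbp2i2K, Sbp1i2K,
  Sbp2i1K).

End Suspension.

(** Rewrites to sums of left-bracketed composites and cancels inclusions against projections; the
    variants ending in [K] reach such pairs inside a longer composite. *)
Ltac normC := repeat progress rewrite ?SE ?cE ?bpE ?SbpE ?zE.

(** * Sums of triangles and of octahedral diagrams *)

Section Sums.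
Variable T : suspended.
Implicit Types X Y Z C : T.
Notation "'Σ' X" := (Sg T X) (at level 30, right associativity).
Notation "'Σm' f" := (fmap (Sg T) f) (at level 30, right associativity).

Lemma tri_eq X Y C (D D' : tri X Y C) :
  t1 D = t1 D' -> t2 D = t2 D' -> t3 D = t3 D' -> D = D'.
Proof. by case: D => a b c; case: D' => a' b' c' /= -> -> ->. Qed.

Lemma tri_mor_id X Y C (D : tri X Y C) : tri_mor D D (idm X) (idm Y) (idm C).
Proof. by split; rewrite ?fmap_id !comp1m compm1. Qed.
Lemma tri_iso_refl X Y C (D : tri X Y C) : tri_isomorphic D D.
Proof.
exists (idm X), (idm Y), (idm C); split; try exact: is_iso_id.
exact: tri_mor_id.
Qed.

Lemma is_triangle_sum X Y C X' Y' C' X'' Y'' C'' (BX : biproduct X X' X'')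
    (BY : biproduct Y Y' Y'') (BC : biproduct C C' C'')
    (D : tri X Y C) (D' : tri X' Y' C') :
  is_triangle D -> is_triangle D' -> is_triangle (tri_sum BX BY BC D D').
Proof.
move=> [a b c] [a' b' c']; split=> /=; normC.
- by rewrite -!compA (compA (t2 D)) a (compA (t2 D')) a'; normC.
- by rewrite -!compA (compA (t3 D)) b (compA (t3 D')) b'; normC.
- by rewrite -!compA (compA (Σm t1 D)) c (compA (Σm t1 D')) c'; normC.
Qed.

Lemma tri_mor_sum X Y C X' Y' C' X'' Y'' C'' (BX : biproduct X X' X'')
    (BY : biproduct Y Y' Y'') (BC : biproduct C C' C'')
    X1 Y1 C1 X1' Y1' C1' X1'' Y1'' C1'' (BX1 : biproduct X1 X1' X1'')
    (BY1 : biproduct Y1 Y1' Y1'') (BC1 : biproduct C1 C1' C1'')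
    (D : tri X Y C) (D' : tri X' Y' C') (D1 : tri X1 Y1 C1) (D1' : tri X1' Y1' C1')
    a b c a' b' c' : tri_mor D D1 a b c -> tri_mor D' D1' a' b' c' ->
  tri_mor (tri_sum BX BY BC D D') (tri_sum BX1 BY1 BC1 D1 D1')
    (bi_map BX BX1 a a') (bi_map BY BY1 b b') (bi_map BC BC1 c c').
Proof.
move=> [e1 e2 e3] [e1' e2' e3']; split; rewrite /bi_map /=; normC.
- by rewrite -!compA (compA b) e1 (compA b') e1' !compA.
- by rewrite -!compA (compA c) e2 (compA c') e2' !compA.
- by rewrite -!compA (compA (Σm a)) e3 (compA (Σm a')) e3' !compA.
Qed.
Lemma tri_iso_sum X Y C X' Y' C' X'' Y'' C'' (BX : biproduct X X' X'')
    (BY : biproduct Y Y' Y'') (BC : biproduct C C' C'')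
    X1 Y1 C1 X1' Y1' C1' X1'' Y1'' C1'' (BX1 : biproduct X1 X1' X1'')
    (BY1 : biproduct Y1 Y1' Y1'') (BC1 : biproduct C1 C1' C1'')
    (D : tri X Y C) (D' : tri X' Y' C') (D1 : tri X1 Y1 C1) (D1' : tri X1' Y1' C1') :
  tri_isomorphic D D1 -> tri_isomorphic D' D1' ->
  tri_isomorphic (tri_sum BX BY BC D D') (tri_sum BX1 BY1 BC1 D1 D1').
Proof.
move=> [a [b [c [ia ib ic m]]]] [a' [b' [c' [ia' ib' ic' m']]]].
exists (bi_map BX BX1 a a'), (bi_map BY BY1 b b'), (bi_map BC BC1 c c').
by split; [exact: bi_map_iso..|exact: tri_mor_sum].
Qed.

Lemma tri_sum_interchange X Y C X' Y' C' XK YK CK XK' YK' CK'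
    X2 Y2 C2 XK2 YK2 CK2 XX YY CC
    (BX : biproduct X X' X2) (BY : biproduct Y Y' Y2) (BC : biproduct C C' C2)
    (BXK : biproduct XK XK' XK2) (BYK : biproduct YK YK' YK2)
    (BCK : biproduct CK CK' CK2)
    X3 Y3 C3 X3' Y3' C3' (EX : biproduct X XK X3) (EY : biproduct Y YK Y3)
    (EC : biproduct C CK C3) (EX' : biproduct X' XK' X3')
    (EY' : biproduct Y' YK' Y3') (EC' : biproduct C' CK' C3')
    (FX : biproduct X2 XK2 XX) (FY : biproduct Y2 YK2 YY)
    (FC : biproduct C2 CK2 CC)
    (D : tri X Y C) (D' : tri X' Y' C') (K : tri XK YK CK) (K' : tri XK' YK' CK') :
  tri_sum FX FY FC (tri_sum BX BY BC D D') (tri_sum BXK BYK BCK K K') =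
  tri_sum (bi_interchange BX BXK EX EX' FX) (bi_interchange BY BYK EY EY' FY)
    (bi_interchange BC BCK EC EC' FC) (tri_sum EX EY EC D K)
    (tri_sum EX' EY' EC' D' K').
Proof.
by apply: tri_eq => /=; normC; rewrite -!addrA; congr (_ + _); rewrite addrCA.
Qed.

Lemma octahedral_sum (O O' : octdata T) (X Y Z Cf Cg Cgf : T)
    (BX : biproduct (oX O) (oX O') X) (BY : biproduct (oY O) (oY O') Y)
    (BZ : biproduct (oZ O) (oZ O') Z) (Bf : biproduct (oCf O) (oCf O') Cf)
    (Bg : biproduct (oCg O) (oCg O') Cg)
    (Bgf : biproduct (oCgf O) (oCgf O') Cgf) :
  octahedral O -> octahedral O' -> octahedral (oct_sum BX BY BZ Bf Bg Bgf).
Proof.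
move=> [[a1 a2 a3 a4] a5 a6 [a7 a8] [a9 a10]].
move=> [[b1 b2 b3 b4] b5 b6 [b7 b8] [b9 b10]].
split=> /=; first by split; exact: is_triangle_sum.
- by normC; rewrite a5 b5 !compA.
- by normC; rewrite a6 b6 !compA.
- split; normC.
    by rewrite -!compA (compA _ (t2 (of_ O))) a7 (compA _ (t2 (of_ O'))) b7 !compA.
  by rewrite -!compA (compA _ (t1 (ot_ O))) a8 (compA _ (t1 (ot_ O'))) b8 !compA.
- split; normC.
    by rewrite -!compA (compA _ (t2 (ogf O))) a9 (compA _ (t2 (ogf O'))) b9 !compA.
  by rewrite -!compA (compA _ (t2 (ot_ O))) a10 (compA _ (t2 (ot_ O'))) b10 !compA.
Qed.

Lemma octahedral_deg0 X Y C (D : tri X Y C) :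
  is_triangle D -> octahedral (oct_deg0 D).
Proof. by move=> [a b c]; (do ?split); rewrite /=; normC. Qed.
Lemma octahedral_deg1 X Y C (D : tri X Y C) :
  is_triangle D -> octahedral (oct_deg1 D).
Proof. by move=> [a b c]; (do ?split); rewrite /=; normC. Qed.
Lemma octahedral_deg2 X Y C (D : tri X Y C) :
  is_triangle D -> octahedral (oct_deg2 D).
Proof. by move=> [a b c]; (do ?split); rewrite /=; normC. Qed.
End Sums.

(** * Coherence of triangulated settings *)

Section TriCoherent.
Variable T : triangulated.
Implicit Types X Y Z C : T.
Notation "'Σ' X" := (Sg T X) (at level 30, right associativity).
Notation "'Σm' f" := (fmap (Sg T) f) (at level 30, right associativity).

Variables (P : forall X Y C : T, tri X Y C -> Prop) (Q : octdata T -> Prop).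
Hypothesis QP : forall O, Q O -> oct_all P O.
Hypothesis Q_sum : forall (O O' : octdata T) (X Y Z Cf Cg Cgf : T)
    (BX : biproduct (oX O) (oX O') X) (BY : biproduct (oY O) (oY O') Y)
    (BZ : biproduct (oZ O) (oZ O') Z) (Bf : biproduct (oCf O) (oCf O') Cf)
    (Bg : biproduct (oCg O) (oCg O') Cg)
    (Bgf : biproduct (oCgf O) (oCgf O') Cgf),
    Q O -> Q O' -> Q (oct_sum BX BY BZ Bf Bg Bgf).
Hypothesis Q0 : forall X Y C (D : tri X Y C), P D -> Q (oct_deg0 D).
Hypothesis Q1 : forall X Y C (D : tri X Y C), P D -> Q (oct_deg1 D).
Hypothesis Q2 : forall X Y C (D : tri X Y C), P D -> Q (oct_deg2 D).
Hypothesis PL : forall X, P (tri_idL X).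
Hypothesis PR : forall X, P (tri_idR X).

Lemma tri_idL0 : tri_idL (zob T) = tri_idR (zob T).
Proof. by apply: tri_eq; rewrite /= ?idm_zob. Qed.

Let T1 X Y S (B : biproduct X Y S) : tri X S Y := Tri (bi1 B) (bp2 B) 0.
Let T2 X Y S (B : biproduct X Y S) : tri Y S X := Tri (bi2 B) (bp1 B) 0.

(** The biproducts [bi_l] and [bi_r] present an object as its own sum with zero, so that the sum of
    the two degenerate octahedra has exactly the required objects. *)
Lemma stair1 X Y C Z YZ CZ (D : tri X Y C) (BY : biproduct Y Z YZ)
    (BC : biproduct C Z CZ) : P D ->
  Q (OctData D (T1 BY) (tri_sum (bi_l X) BY BC D (tri_idR Z)) (T1 BC)).
Proof.
move=> PD;
have := @Q_sum (oct_deg2 D) (oct_deg0 (tri_idR Z)) _ _ _ _ _ _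
  (bi_l _) (bi_l _) BY (bi_l _) (bi_r _) BC (Q2 PD) (Q0 (PR Z)).
rewrite /oct_sum /=; congr (Q (OctData _ _ _ _)); apply: tri_eq => /=; normC => //.
Qed.
Lemma stair2 X Y C Z XZ YZ CZ (D : tri X Y C) (BX : biproduct X Z XZ)
    (BY : biproduct Y Z YZ) (BC : biproduct C Z CZ) : P D ->
  Q (OctData (T1 BX) (tri_sum BX BY (bi_l C) D (tri_idL Z))
       (tri_sum (bi_l X) BY BC D (tri_idR Z)) (T2 BC)).
Proof.
move=> PD;
have := @Q_sum (oct_deg1 D) (oct_deg2 (tri_idR Z)) _ _ _ _ _ _
  (bi_l _) BX BY (bi_r _) (bi_l _) BC (Q1 PD) (Q2 (PR Z)).
rewrite /oct_sum /=; congr (Q (OctData _ _ _ _)); apply: tri_eq => /=; normC => //.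
Qed.
Lemma stair3 X Y C Z XZ YZ (D : tri X Y C) (BX : biproduct X Z XZ)
    (BY : biproduct Y Z YZ) : P D ->
  Q (OctData (T2 BX) (tri_sum BX BY (bi_l C) D (tri_idL Z)) (T2 BY) D).
Proof.
move=> PD;
have := @Q_sum (oct_deg0 D) (oct_deg1 (tri_idL Z)) _ _ _ _ _ _
  (bi_r _) BX BY (bi_l _) (bi_l _) (bi_l _) (Q0 PD) (Q1 (PL Z)).
rewrite /oct_sum /=; congr (Q (OctData _ _ _ _)); apply: tri_eq => /=; normC => //.
Qed.

Lemma tri_coherent : coherent (tri_setting P Q).
Proof.
have ctri (X Y C Z : T) (D : tri X Y C) : P D ->
    exists XZ YZ CZ (BX : biproduct X Z XZ) (BY : biproduct Y Z YZ)
      (BC : biproduct C Z CZ) (D' : tri X YZ CZ) (D'' : tri XZ YZ C),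
      [/\ Q (OctData D (T1 BY) D' (T1 BC)), Q (OctData (T1 BX) D'' D' (T2 BC))
        & Q (OctData (T2 BX) D'' (T2 BY) D)].
  move=> PD; have [XZ [BX]] := biprod_ex X Z; have [YZ [BY]] := biprod_ex Y Z.
  have [CZ [BC]] := biprod_ex C Z; exists XZ, YZ, CZ, BX, BY, BC.
  exists (tri_sum (bi_l X) BY BC D (tri_idR Z)), (tri_sum BX BY (bi_l C) D (tri_idL Z)).
  by split; [exact: stair1|exact: stair2|exact: stair3].
(* Split triangles lie in [P] because they occur in the staircases on an identity triangle. *)
have pT (X Y : T) : exists S (B : biproduct X Y S), P (T1 B) /\ P (T2 B).
  have [S [YZ [CZ [B [BY [BC [D' [D'' [_ /QP [p _ _ _] /QP [q _ _ _]]]]]]]]]] :=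
    ctri _ _ _ Y _ (PL X).
  by exists S, B.
split=> /=.
- exists (exist _ _ (PL (zob T))); split=> //=.
    by move=> X [D PD] /= e; rewrite tri_idL0 e; exact: Q1 (PL X).
  by move=> X [D PD] /= e; rewrite tri_idL0 e; exact: Q0 (PR X).
- move=> X Y; have [S [B [p q]]] := pT X Y.
  by exists S, (exist _ _ p), (exist _ _ q); exists B.
- by move=> X Y S D1 D2 [B [-> ->]]; exists (bi_swap B).
- move=> X Y S S' D1 D2 D1' D2' [B [-> ->]] [B' [-> ->]].
  have it := bi_map_iso B B' (is_iso_id X) (is_iso_id Y).
  by exists (exist _ _ it); split; split; rewrite /= /bi_map; normC.
- move=> X X' Z [f jf] /=.
  have [S [B [p q]]] := pT X Z; have [S' [B' [p' q']]] := pT X' Z.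
  have it := bi_map_iso B B' jf (is_iso_id Z).
  exists S, S', (exist _ _ p), (exist _ _ q), (exist _ _ p'), (exist _ _ q').
  exists (exist _ _ it); split; [by exists B|by exists B'| |];
    by split; rewrite /= /bi_map; normC.
- move=> X Y C Z [D PD].
  have [XZ [YZ [CZ [BX [BY [BC [D' [D'' [s1 s2 s3]]]]]]]]] := ctri _ _ _ Z _ PD.
  have [_ pY pD' pC] := QP s1; have [pX pD'' _ pC2] := QP s2.
  have [pX2 _ pY2 _] := QP s3; exists XZ, YZ, CZ, (exist _ _ pX), (exist _ _ pX2).
  exists (exist _ _ pY), (exist _ _ pY2), (exist _ _ pC), (exist _ _ pC2).
  exists (exist _ _ pD'), (exist _ _ pD''); split=> //; [by exists BX|by exists BY|by exists BC].
Qed.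
End TriCoherent.

(** * Closure properties of distinguished and virtual triangles *)

Section Distinguished.
Variable T : triangulated.
Implicit Types X Y Z C : T.
Notation "'Σ' X" := (Sg T X) (at level 30, right associativity).
Notation "'Σm' f" := (fmap (Sg T) f) (at level 30, right associativity).

(** Filling a morphism from the rotation of the identity triangle on [W] to the rotation of [D]
    gives [Σ W -> Σ X], which desuspends because the suspension is full and faithful. *)
Lemma dist_exact1 X Y C (D : tri X Y C) W (u : hom W Y) :
  dist D -> t2 D ∘ u = 0 -> exists v, u = t1 D ∘ v.
Proof.
move=> dD e; have /dist_rot dI := dist_id W; have /dist_rot dR := dD.
have [|c [_ _]] := @dist_fill T _ _ _ _ _ _ _ _ u (0 : hom (zob T) C) dI dR.
  by rewrite /= e; normC.
have [v <-] := equivalence_full (Sg_equiv T) c.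
rewrite /=; normC => /oppr_inj; rewrite -fmap_comp => ev; exists v.
exact: (equivalence_faithful (Sg_equiv T)).
Qed.
Lemma dist_exact2 X Y C (D : tri X Y C) W (u : hom W C) :
  dist D -> t3 D ∘ u = 0 -> exists v, u = t2 D ∘ v.
Proof. by move=> /dist_rot dD; exact: (@dist_exact1 _ _ _ (tri_rot D)). Qed.
Lemma dist_exact3 X Y C (D : tri X Y C) W (u : hom W (Σ X)) :
  dist D -> Σm t1 D ∘ u = 0 -> exists v, u = t3 D ∘ v.
Proof.
move=> /dist_rot dD e; apply: (@dist_exact2 _ _ _ (tri_rot D)) => //=.
by normC; rewrite e oppr0.
Qed.

(* The sum is exact under all functors Hom(W, -), so by the five lemma it is
   isomorphic to a distinguished triangle on the same first morphism. *)
Lemma dist_sum X Y C X' Y' C' X'' Y'' C'' (BX : biproduct X X' X'')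
    (BY : biproduct Y Y' Y'') (BC : biproduct C C' C'')
    (D : tri X Y C) (D' : tri X' Y' C') :
  dist D -> dist D' -> dist (tri_sum BX BY BC D D').
Proof.
move=> dD dD'; set S := tri_sum _ _ _ _ _.
have tS : is_triangle S by apply: is_triangle_sum; exact: dist_triangle.
have ex2 W (u : hom W C'') : t3 S ∘ u = 0 -> exists v, u = t2 S ∘ v.
  move=> e.
  have e1 : t3 D ∘ (bp1 BC ∘ u) = 0.
    have := congr1 (fun w => Σm bp1 BX ∘ w) e; rewrite /S /=; normC => <-.
    by normC.
  have e2 : t3 D' ∘ (bp2 BC ∘ u) = 0.
    have := congr1 (fun w => Σm bp2 BX ∘ w) e; rewrite /S /=; normC => <-.
    by normC.
  have [v hv] := dist_exact2 dD e1; have [v' hv'] := dist_exact2 dD' e2.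
  exists (bi1 BY ∘ v + bi2 BY ∘ v'); rewrite /S /=.
  by apply: (bp_ext (B := BC)); normC; rewrite ?hv ?hv'.
have ex3 W (u : hom W (Σ X'')) : Σm t1 S ∘ u = 0 -> exists v, u = t3 S ∘ v.
  move=> e.
  have e1 : Σm t1 D ∘ (Σm bp1 BX ∘ u) = 0.
    have := congr1 (fun w => Σm bp1 BY ∘ w) e; rewrite /S /=; normC => <-.
    by normC.
  have e2 : Σm t1 D' ∘ (Σm bp2 BX ∘ u) = 0.
    have := congr1 (fun w => Σm bp2 BY ∘ w) e; rewrite /S /=; normC => <-.
    by normC.
  have [v hv] := dist_exact3 dD e1; have [v' hv'] := dist_exact3 dD' e2.
  exists (bi1 BC ∘ v + bi2 BC ∘ v'); rewrite /S /=.
  by apply: (bp_ext (B := bi_Sg BX)) => /=; normC; rewrite ?hv ?hv'.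
have [C0 [i [q dE]]] := dist_ex (t1 S); set E := Tri _ _ _ in dE.
have [|c1 [_ m2 m3]] := @dist_fill T _ _ _ _ _ _ D E (bi1 BX) (bi1 BY) dD dE.
  by rewrite /E /S /=; normC.
have [|c2 [_ n2 n3]] := @dist_fill T _ _ _ _ _ _ D' E (bi2 BX) (bi2 BY) dD' dE.
  by rewrite /E /S /=; normC.
pose c := c1 ∘ bp1 BC + c2 ∘ bp2 BC.
have k2 : c ∘ t2 S = t2 E.
  rewrite /c /S /=; normC; rewrite m2 n2 -!compA -compDr bip.
  exact: compm1.
have k3 : t3 E ∘ c = t3 S.
  by rewrite /c /S compDr !compA -m3 -n3.
have [_ _ k23] := tS; have [k12 _ _] := tS.
have [_ l23 l31] := dist_triangle dE.
(* Injectivity on morphisms from every object, together with a right inverse, makes [c]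
   invertible. *)
have c_inj W (u : hom W C'') : c ∘ u = 0 -> u = 0.
  move=> e; have [|v ev] := ex2 _ u; first by rewrite -k3 -compA e comp0r.
  have [|w ew] := dist_exact1 (u := v) dE; first by rewrite -k2 -compA -ev.
  by rewrite ev ew compA k12 comp0l.
have [|s es] := ex3 _ (t3 E); first exact: l31.
(* The lift [s] of [t3 E] through [t3 S] inverts [c] only up to a morphism killed by [t3 E];
   exactness writes this as [t2 E ∘ w], and [t2 S ∘ w] corrects it. *)
have [|w ew] := dist_exact2 (u := idm C0 - c ∘ s) dE.
  by rewrite compDr compNr compm1 compA k3 -es subrr.
pose s' := s + t2 S ∘ w.
have cs : c ∘ s' = idm C0 by rewrite /s' compDr compA k2 -ew addrC subrK.
have ic : is_iso c.
  exists s'; split=> //; apply/eqP; rewrite -subr_eq0; apply/eqP/c_inj.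
  by rewrite compDr compNr compA cs comp1m compm1 subrr.
have [d [dc cd]] := ic.
apply: dist_iso dE; exists (idm _), (idm _), d; split; [exact: is_iso_id..| |split].
- by exists c.
- by rewrite comp1m compm1.
- by rewrite compm1 -k2 compA dc comp1m.
- by rewrite fmap_id comp1m -k3 -compA cd compm1.
Qed.

Lemma dist_idR X : dist (tri_idR X).
Proof.
apply/dist_rot; apply: dist_iso (dist_id X).
exists (idm X), (idm X), 0; split; [exact: is_iso_id..| |split; rewrite /=; normC] => //.
by exists 0; split; [exact: hom_to0|exact: hom_toS0].
Qed.
Lemma dist_split X Y S (B : biproduct X Y S) : dist (Tri (bi1 B) (bp2 B) 0).
Proof.
have := dist_sum (bi_l X) B (bi_r Y) (dist_id X) (dist_idR Y).
by congr dist; apply: tri_eq => /=; normC.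
Qed.

Lemma octahedron_sum (O O' : octdata T) (X Y Z Cf Cg Cgf : T)
    (BX : biproduct (oX O) (oX O') X) (BY : biproduct (oY O) (oY O') Y)
    (BZ : biproduct (oZ O) (oZ O') Z) (Bf : biproduct (oCf O) (oCf O') Cf)
    (Bg : biproduct (oCg O) (oCg O') Cg)
    (Bgf : biproduct (oCgf O) (oCgf O') Cgf) :
  octahedron O -> octahedron O' -> octahedron (oct_sum BX BY BZ Bf Bg Bgf).
Proof.
move=> [o [a b c d]] [o' [a' b' c' d']]; split; first exact: octahedral_sum.
by split; exact: dist_sum.
Qed.
Lemma octahedron_deg0 X Y C (D : tri X Y C) : dist D -> octahedron (oct_deg0 D).
Proof.
by move=> dD; split; [exact/octahedral_deg0/dist_triangle|split=> //; exact: dist_idR].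
Qed.
Lemma octahedron_deg1 X Y C (D : tri X Y C) : dist D -> octahedron (oct_deg1 D).
Proof.
move=> dD; split; [exact/octahedral_deg1/dist_triangle|split=> //].
  exact: dist_id.
exact: dist_idR.
Qed.
Lemma octahedron_deg2 X Y C (D : tri X Y C) : dist D -> octahedron (oct_deg2 D).
Proof.
by move=> dD; split; [exact/octahedral_deg2/dist_triangle|split=> //; exact: dist_id].
Qed.

Lemma breuning_coherent : coherent (breuning_setting T).
Proof.
apply: tri_coherent.
- by move=> O [].
- by move=> O O' *; exact: octahedron_sum.
- exact: octahedron_deg0.
- exact: octahedron_deg1.
- exact: octahedron_deg2.
- exact: dist_id.
- exact: dist_idR.
Qed.
End Distinguished.

Lemma pretriangulated3_coherent (T3 : pretriangulated3) :
  coherent (pretriangulated3_setting T3).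
Proof.
apply: tri_coherent.
- by move=> O /dist3_octahedron [].
- by move=> O O' *; exact: dist3_sum.
- exact: dist3_deg0.
- exact: dist3_deg1.
- exact: dist3_deg2.
- exact: dist_id.
- exact: dist_idR.
Qed.

(** * Special octahedra and virtual triangles *)

Section SpecialVirtual.
Variable T : triangulated.
Implicit Types X Y Z C : T.
Notation "'Σ' X" := (Sg T X) (at level 30, right associativity).
Notation "'Σm' f" := (fmap (Sg T) f) (at level 30, right associativity).

Lemma dist_eq X Y C (D D' : tri X Y C) :
  t1 D = t1 D' -> t2 D = t2 D' -> t3 D = t3 D' -> dist D -> dist D'.
Proof. by move=> e1 e2 e3; rewrite (tri_eq e1 e2 e3). Qed.

Lemma dist_opp13 X Y C (D : tri X Y C) :
  dist (Tri (- t1 D) (t2 D) (- t3 D)) <-> dist D.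
Proof.
have i : is_iso (- idm X) by apply: is_iso_opp; exact: is_iso_id.
split; apply: dist_iso; exists (- idm X), (idm Y), (idm C);
  by split; [exact: i|exact: is_iso_id|exact: is_iso_id|split; rewrite /=; normC].
Qed.

Lemma dist_opp23 X Y C (D : tri X Y C) :
  dist (Tri (t1 D) (- t2 D) (- t3 D)) <-> dist D.
Proof.
have i : is_iso (- idm C) by apply: is_iso_opp; exact: is_iso_id.
split; apply: dist_iso; exists (idm X), (idm Y), (- idm C);
  by split; [exact: is_iso_id|exact: is_iso_id|exact: i|split; rewrite /=; normC].
Qed.

Lemma dist_mid X Y Y' C (D : tri X Y C) (D' : tri X Y' C) (b : hom Y Y')
    (b' : hom Y' Y) : b' ∘ b = idm Y -> b ∘ b' = idm Y' ->
  b ∘ t1 D = t1 D' -> t2 D' ∘ b = t2 D -> t3 D = t3 D' -> dist D -> dist D'.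
Proof.
move=> b'b bb' e1 e2 e3; apply: dist_iso; exists (idm X), b, (idm C).
split; [exact: is_iso_id|by exists b'|exact: is_iso_id|split].
- by rewrite compm1.
- by rewrite comp1m.
- by rewrite fmap_id comp1m compm1.
Qed.

(** In each of the three degenerate octahedra one of the two additional triangles is split in
    sheared coordinates, and the other is [D] or a rotation of it, up to signs and a zero
    summand. *)
Lemma special_deg0 X Y C (D : tri X Y C) : dist D -> special_octahedron (oct_deg0 D).
Proof.
move=> dD; split; first exact: octahedron_deg0.
- move=> S B; apply: dist_eq (dist_split (shear1 B (t1 D))); rewrite /=; normC => //.
  by have [_ ->] := dist_triangle dD.
- move=> S B; move/dist_rot/dist_opp13: dD.
  apply: (@dist_mid _ _ _ _ _ _ (bi2 B) (bp2 B)) => /=; normC => //.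
  by rewrite -(bip B) (hom_toS0 (bp1 B) 0); normC.
Qed.
Lemma special_deg1 X Y C (D : tri X Y C) : dist D -> special_octahedron (oct_deg1 D).
Proof.
move=> dD; split; first exact: octahedron_deg1.
- move=> S B; apply: (@dist_mid _ _ _ _ _ _ (bi1 B) (bp1 B)) dD => /=; normC => //.
  by rewrite -(bip B) (hom_to0 (bp2 B) 0); normC.
- move=> S B; apply: dist_eq (dist_split (shear1 B (t3 D))); rewrite /=; normC => //.
Qed.
Lemma special_deg2 X Y C (D : tri X Y C) : dist D -> special_octahedron (oct_deg2 D).
Proof.
move=> dD; split; first exact: octahedron_deg2.
- by move=> S B; apply: dist_eq (dist_split (shear2 B (t2 D))); rewrite /=; normC.
- move=> S B; move/dist_rot/dist_rot: dD => /=.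
  move=> /(dist_opp23) h; apply: (@dist_mid _ _ _ _ _ _ (bi1 B) (bp1 B)) h => /=; normC => //.
  by rewrite -(bip B) (hom_to0 (bp2 B) 0); normC.
Qed.

Lemma special_sum (O O' : octdata T) (X Y Z Cf Cg Cgf : T)
    (BX : biproduct (oX O) (oX O') X) (BY : biproduct (oY O) (oY O') Y)
    (BZ : biproduct (oZ O) (oZ O') Z) (Bf : biproduct (oCf O) (oCf O') Cf)
    (Bg : biproduct (oCg O) (oCg O') Cg)
    (Bgf : biproduct (oCgf O) (oCgf O') Cgf) :
  special_octahedron O -> special_octahedron O' ->
  special_octahedron (oct_sum BX BY BZ Bf Bg Bgf).
Proof.
move=> [o p q] [o' p' q']; split; first exact: octahedron_sum.
- move=> S B; have [S1 [B1]] := biprod_ex (oZ O) (oCf O).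
  have [S2 [B2]] := biprod_ex (oZ O') (oCf O').
  apply: dist_eq (dist_sum BY (bi_interchange BZ Bf B1 B2 B) Bgf (p _ B1) (p' _ B2)).
  + by apply: (bi_ext (B := BY)); rewrite /=; normC.
  + by apply: (bp_ext (B := Bgf)); rewrite /=; normC.
  + by rewrite /=; normC.
- move=> S B; have [S1 [B1]] := biprod_ex (Σ oX O) (oCg O).
  have [S2 [B2]] := biprod_ex (Σ oX O') (oCg O').
  apply: dist_eq (dist_sum Bgf (bi_interchange (bi_Sg BX) Bg B1 B2 B) (bi_Sg BY)
    (q _ B1) (q' _ B2)).
  + by apply: (bi_ext (B := Bgf)); rewrite /=; normC.
  + by apply: (bp_ext (B := bi_Sg BY)); rewrite /=; normC.
  + by rewrite /=; normC.
Qed.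

Lemma special_coherent : coherent (special_setting T).
Proof.
apply: tri_coherent.
- by move=> O [[]].
- by move=> O O' *; exact: special_sum.
- exact: special_deg0.
- exact: special_deg1.
- exact: special_deg2.
- exact: dist_id.
- exact: dist_idR.
Qed.

Lemma virtual_triangle X Y C (D : tri X Y C) : virtual D -> is_triangle D.
Proof. by case. Qed.
Lemma dist_virtual X Y C (D : tri X Y C) : dist D -> virtual D.
Proof.
move=> dD; split; first exact: dist_triangle.
exists _, _, _, (tri_idL (zob T)), X, Y, C, (bi_l X), (bi_l Y), (bi_l C).
exists X, Y, C, D; split; [exact: contractible_L|exact: dist_triangle| |].
  rewrite (_ : tri_sum _ _ _ _ _ = D); first exact: tri_iso_refl.
  by apply: tri_eq => /=; normC.
by split; [exists (t1 D)|exists (t2 D)|exists (t3 D)]; case: D dD.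
Qed.
(** The contractible summands are added separately and then moved to their places by the
    interchange; the three distinguished witnesses are sums of the given ones. *)
Lemma virtual_sum X Y C X' Y' C' X'' Y'' C'' (BX : biproduct X X' X'')
    (BY : biproduct Y Y' Y'') (BC : biproduct C C' C'')
    (D : tri X Y C) (D' : tri X' Y' C') :
  virtual D -> virtual D' -> virtual (tri_sum BX BY BC D D').
Proof.
move=> [tD [XK [YK [CK [K [X1 [Y1 [C1 [EX [EY [EC [X2 [Y2 [C2 [E]]]]]]]]]]]]]]].
move=> [cK tE iE [[f df] [i di] [q dq]]].
move=> [tD' [XK' [YK' [CK' [K' [X1' [Y1' [C1' [EX' [EY' [EC' [X2' [Y2' [C2' [E']]]]]]]]]]]]]]].
move=> [cK' tE' iE' [[f' df'] [i' di'] [q' dq']]].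
split; first exact: is_triangle_sum.
have [XK2 [BXK]] := biprod_ex XK XK'; have [YK2 [BYK]] := biprod_ex YK YK'.
have [CK2 [BCK]] := biprod_ex CK CK'.
have [XX [FX]] := biprod_ex X'' XK2; have [YY [FY]] := biprod_ex Y'' YK2.
have [CC [FC]] := biprod_ex C'' CK2.
have [X3 [BX3]] := biprod_ex X2 X2'; have [Y3 [BY3]] := biprod_ex Y2 Y2'.
have [C3 [BC3]] := biprod_ex C2 C2'.
exists XK2, YK2, CK2, (tri_sum BXK BYK BCK K K'), XX, YY, CC, FX, FY, FC.
exists X3, Y3, C3, (tri_sum BX3 BY3 BC3 E E'); split.
- exact: contractible_sum.
- exact: is_triangle_sum.
- rewrite (tri_sum_interchange BX BY BC BXK BYK BCK EX EY EC EX' EY' EC' FX FY FC).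
  exact: tri_iso_sum.
- have s := dist_sum BX3 BY3 BC3.
  split; [have := s _ _ df df'|have := s _ _ di di'|have := s _ _ dq dq'];
    by eexists; eassumption.
Qed.

Lemma virtual_coherent : coherent (virtual_setting T).
Proof.
have vL X : virtual (tri_idL X) by exact/dist_virtual/dist_id.
have vR X : virtual (tri_idR X) by exact/dist_virtual/dist_idR.
apply: tri_coherent => //.
- by move=> O [].
- move=> O O' X Y Z Cf Cg Cgf BX BY BZ Bf Bg Bgf [o [a b c d]] [o' [a' b' c' d']].
  by split; [exact: octahedral_sum|split; exact: virtual_sum].
- by move=> X Y C D v; split; [exact/octahedral_deg0/virtual_triangle|].
- by move=> X Y C D v; split; [exact/octahedral_deg1/virtual_triangle|].
- by move=> X Y C D v; split; [exact/octahedral_deg2/virtual_triangle|].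
Qed.
End SpecialVirtual.

Theorem theorem1p5p4 (W : waldhausen) (T : triangulated)
    (T3 : pretriangulated3) :
     (let det : det_data (waldhausen_setting W) (Gamma (D_W W)) := Ddet (waldhausen_setting W) in
      [/\ is_det det, is_universal_det det & is_universal_nc_det det]) /\
     (let det : det_data (derived_setting W) (Gamma (D_der W)) := Ddet (derived_setting W) in
      [/\ is_det det, is_universal_det det & is_universal_nc_det det]) /\
     (let det : det_data (breuning_setting T) (Gamma (D_bT T)) := Ddet (breuning_setting T) in
      [/\ is_det det, is_universal_det det & is_universal_nc_det det]) /\
     (let det : det_data (special_setting T) (Gamma (D_dT T)) := Ddet (special_setting T) in
      [/\ is_det det, is_universal_det det & is_universal_nc_det det]) /\
     (let det : det_data (virtual_setting T) (Gamma (D_vT T)) := Ddet (virtual_setting T) in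
      [/\ is_det det, is_universal_det det & is_universal_nc_det det]) /\
     (let det : det_data (pretriangulated3_setting T3) (Gamma (D_sT3 T3)) := Ddet (pretriangulated3_setting T3) in
      [/\ is_det det, is_universal_det det & is_universal_nc_det det]).
Proof.
split; first exact: Ddet_universal_det (waldhausen_coherent W).
split; first exact: Ddet_universal_det (derived_coherent W).
split; first exact: Ddet_universal_det (breuning_coherent T).
split; first exact: Ddet_universal_det (special_coherent T).
split; first exact: Ddet_universal_det (virtual_coherent T).
exact: Ddet_universal_det (pretriangulated3_coherent T3).
Qed.
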